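(* Let $\varphi$ be an increasing concave function on $[0,1]$ such that $\lim_{t\to0^+}\varphi(t)=0$ and $q_\varphi^0<1$. Then the space $C(M_\varphi^0)[0,1]$ has the Dunford–Pettis property.
   Context: Convention: $\varphi(0)=0$, $\varphi>0$ on $(0,1]$. Marcinkiewicz space $M_\varphi$ on $[0,1]$: measurable $f$ with $\|f\|=\sup_{0<t\le1}\frac{\varphi(t)}{t}\int_0^tf^*(s)\,ds<\infty$, $f^*$ the decreasing rearrangement. $M_\varphi^0$ is the subspace of elements with order continuous norm ($\|f\chi_{A_n}\|\to0$ whenever $A_n$ decrease with $m(\bigcap A_n)=0$), with the norm of $M_\varphi$. With $Cf(x)=\frac1x\int_0^xf(t)\,dt$, $C(M_\varphi^0)[0,1]=\{f:C|f|\in M_\varphi^0\}$, $\|f\|=\|C|f|\|_{M_\varphi}$. Index: $\overline\varphi^0(s)=\sup_{0<t\le\min(1,1/s)}\varphi(st)/\varphi(t)$, $q_\varphi^0=\lim_{s\to\infty}\ln\overline\varphi^0(s)/\ln s$. Dunford–Pettis property: $x_n\to0$ weakly and $x_n^*\to0$ weakly in the dual imply $x_n^*(x_n)\to0$. *)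

(* Defs.v *)
From HB Require Import structures.
From mathcomp Require Import all_boot all_order all_algebra.
From mathcomp Require Import all_classical all_reals all_analysis.
Set Implicit Arguments. Unset Strict Implicit. Unset Printing Implicit Defensive.
Import Order.TTheory GRing.Theory Num.Theory.
Import numFieldNormedType.Exports.
Local Open Scope classical_set_scope.
Local Open Scope ring_scope.

Section Defs.
Variable R : realType.
Local Notation mu := (@lebesgue_measure R).

Definition distrib (f : R -> R) (l : R) : \bar R :=
  mu (`[(0:R), (1:R)] `&` [set x | l < `|f x|]).

Definition drearr (f : R -> R) (s : R) : \bar R :=
  ereal_inf [set l%:E | l in [set l : R | 0 <= l /\ (distrib f l <= s%:E)%E]].

Definition mnorm (phi : R -> R) (f : R -> R) : \bar R :=
  ereal_sup [set ((phi t / t)%:E * \int[mu]_(s in `[0%R, t]) drearr f s)%E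
            | t in `](0:R), (1:R)]].

Definition Mphi (phi : R -> R) (f : R -> R) : Prop :=
  measurable_fun `[(0:R), (1:R)] f /\ (mnorm phi f < +oo)%E.

(* M_phi^0: elements with order continuous norm *)
Definition Mphi0 (phi : R -> R) (f : R -> R) : Prop :=
  Mphi phi f /\
  forall A : nat -> set R,
    (forall n, measurable (A n) /\ A n `<=` `[(0:R), (1:R)]) ->
    (forall n, A n.+1 `<=` A n) ->
    mu (\bigcap_n A n) = 0%E ->
    mnorm phi (fun x => f x * \1_(A n) x) @[n --> \oo] --> 0%E.

Definition Cabs (f : R -> R) (x : R) : R :=
  fine ((x^-1)%:E * \int[mu]_(t in `[0%R, x]) (`|f t|)%:E)%E.

(* Cesaro–Marcinkiewicz space C(M_phi^0)[0,1]: C|f| must be a (finite a.e.)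
   measurable function on [0,1] lying in M_phi^0 *)
Definition CesM0 (phi : R -> R) (f : R -> R) : Prop :=
  measurable_fun `[(0:R), (1:R)] f /\
  (forall x, 0 < x < 1 -> (\int[mu]_(t in `[0%R, x]) (`|f t|)%:E < +oo)%E) /\
  Mphi0 phi (Cabs f).

Definition cnorm (phi : R -> R) (f : R -> R) : \bar R := mnorm phi (Cabs f).

Definition bdd_lin (T : Type) (S : (T -> R) -> Prop) (N : (T -> R) -> \bar R)
    (L : (T -> R) -> R) : Prop :=
  (forall f g, S f -> S g -> L (fun x => f x + g x) = L f + L g) /\
  (forall (a : R) f, S f -> L (fun x => a * f x) = a * L f) /\
  exists C : R, forall f, S f -> ((`|L f|)%:E <= C%:E * N f)%E.

Definition dnorm (T : Type) (S : (T -> R) -> Prop) (N : (T -> R) -> \bar R)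
    (L : (T -> R) -> R) : \bar R :=
  ereal_sup [set (`|L f|)%:E | f in [set f | S f /\ (N f <= 1)%E]].

(* Dunford–Pettis property of the normed space (S, N):
   x_n -> 0 weakly in X, x*_n -> 0 weakly in X* (i.e. tested against the bidual)
   imply x*_n(x_n) -> 0 *)
Definition DunfordPettis (S : (R -> R) -> Prop) (N : (R -> R) -> \bar R) : Prop :=
  forall (x : nat -> R -> R) (xs : nat -> (R -> R) -> R),
    (forall n, S (x n)) ->
    (forall n, bdd_lin S N (xs n)) ->
    (forall L, bdd_lin S N L -> L (x n) @[n --> \oo] --> 0) ->
    (forall Phi, bdd_lin (bdd_lin S N) (dnorm S N) Phi ->
                 Phi (xs n) @[n --> \oo] --> 0) ->
    xs n (x n) @[n --> \oo] --> 0.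

Definition dilation (phi : R -> R) (s : R) : R :=
  sup [set phi (s * t) / phi t | t in [set t : R | 0 < t /\ t <= Num.min 1 s^-1]].

Definition q0 (phi : R -> R) : R :=
  lim ((fun s => ln (dilation phi s) / ln s) @ +oo).

End Defs.

(* Main.v *)
Require Import Defs.
From HB Require Import structures.
From mathcomp Require Import all_boot all_order all_algebra.
From mathcomp Require Import finmap.
From mathcomp Require Import all_classical all_reals all_analysis.
From mathcomp Require Import measurable_realfun.
From mathcomp Require Import ring lra.
Set Implicit Arguments. Unset Strict Implicit. Unset Printing Implicit Defensive.
Import Order.TTheory GRing.Theory Num.Theory.
Import numFieldNormedType.Exports.
Local Open Scope classical_set_scope.
Local Open Scope ring_scope.

(* Since q < 1, the integral of 1/phi over [0, t] is at most C t / phi(t), so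
   the M_phi norm of g is controlled by any bound g <= M / phi(min(x, 1 - x)).
   Near 0 the average C|f|(x) is governed by (1/x) int_0^x |f|, near 1 by
   int_0^x |f|; hence, with the weight phi(x)/x on (0, 1/2] and phi(1 - x) on
   (1/2, 1), cut along its dyadic levels, f |-> f * weight is an isomorphism of
   C(M_phi^0) onto a c_0-sum of L^1 spaces over sets of finite measure.

   For such a sum, let x_n and l_n be weakly null in the space and in its dual.
   On finitely many blocks, Hahn decompositions give sets P_n outside which l_n
   is bounded by d.  Then mu(P_n) -> 0, as otherwise an ultrafilter limit of
   averages gives an element of the bidual that is at least d on infinitely many
   of the +-l_n, and x_n is uniformly integrable by Schur's theorem; so l_n tends
   to 0 on these blocks along x_n.  The remaining blocks are handled by a gliding
   hump, since bounded elements supported on disjoint groups of blocks form a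
   weakly unconditionally Cauchy series. *)

(** * Weakly null sequences *)

Section WeaklyNullSequences.
Variable R : realType.
Implicit Types (u : nat -> R) (a : nat -> nat -> R).

(** No description of the dual or the bidual is used: functionals are known only by their values on
    indicators and cuts, and norming functionals are explicit, namely signs on one block in the
    space and evaluations at elements of the unit ball in the dual. Apart from the ultrafilter
    argument, weak convergence is always exploited in one way: if sum_k |L_k f| is at most C times
    the norm of f, bounded multipliers turn the L_k into a single bounded functional, so Schur's
    theorem applies to the matrix L_k(x_n). The obstacle on the function side is the right end:
    elements of the space need not be integrable up to 1, so the weight has to vanish there and the
    levels accumulate at both ends. The sum carries a sup norm because the weight changes by a
    factor 2 from level to level: an integral over (0, x] or (1/2, x] is a geometric series governed
    by the level of x, while C|f| sees a single level on an interval just after it. Order continuity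
    on sets shrinking to the two ends becomes the c_0 condition. *)

Definition vanishes u :=
  forall e : R, 0 < e -> exists N, forall n, (N <= n)%N -> `|u n| <= e.

Lemma vanishesP u : vanishes u <-> (u n @[n --> \oo] --> 0).
Proof.
split=> [h|/cvgr0Pnorm_le h e e0].
  apply/cvgr0Pnorm_le => e e0; have [N hN] := h e e0.
  by exists N.
by have [N _ hN] := h e e0; exists N => n Nn; apply: hN.
Qed.

Lemma vanishes_subseq u (s : nat -> nat) : (forall n, (n <= s n)%N) ->
  vanishes u -> vanishes (u \o s).
Proof.
move=> hs hu e e0; have [N hN] := hu e e0.
by exists N => n Nn; apply: hN; rewrite (leq_trans Nn).
Qed.

Lemma not_vanishes u : ~ vanishes u ->
  exists2 e : R, 0 < e & forall N, exists2 n, (N <= n)%N & e < `|u n|.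
Proof.
move=> /existsNP[e /not_implyP[e0 h]]; exists e => // N.
move/forallNP: h => /(_ N) /existsNP[n /not_implyP[Nn /negP]].
by rewrite -ltNge; exists n.
Qed.

Lemma gliding_hump (P : nat -> nat -> nat -> Prop) :
  (forall K n0, exists n M, [/\ (n0 <= n)%N, (K < M)%N & P K n M]) ->
  exists n K : nat -> nat, [/\ forall j, (n j < n j.+1)%N,
    forall j, (K j < K j.+1)%N & forall j, P (K j) (n j) (K j.+1)].
Proof.
move=> h.
have /choice[f hf] : forall q : nat * nat, exists r : nat * nat,
    [/\ (q.1 <= r.1)%N, (q.2 < r.2)%N & P q.2 r.1 r.2].
  by move=> [n0 K]; have [n [M H]] := h K n0; exists (n, M).
(* The state is a lower bound for the next index and the left end of the next block: passing the
   successor of [n] makes the indices strictly increase, while [M] is handed on unchanged so that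
   consecutive blocks are adjacent. *)
pose s := fix s j := if j is j'.+1 then f ((s j').1.+1, (s j').2) else (0, 0)%N.
exists (fun j => (s j.+1).1), (fun j => (s j).2); split=> j.
- by have [] := hf ((s j.+1).1.+1, (s j.+1).2).
- by have [] := hf ((s j).1.+1, (s j).2).
- by have [] := hf ((s j).1.+1, (s j).2).
Qed.

Lemma small_half_power (d : R) m : 0 < d ->
  exists2 M, (m < M)%N & 2 ^- M <= d.
Proof.
move=> d0; have h : 0 < `|2^-1 : R| < 1.
  by rewrite gtr0_norm ?invr_gt0// invf_lt1 ?ltr1n ?andbT ?invr_gt0.
have /andP[_ h1] := h.
have /vanishesP/(_ d d0)[N hN] := @cvg_expr R 2^-1 h1.
exists (maxn N m.+1); first by rewrite leq_maxr.
have : `|(2^-1 : R) ^+ (maxn N m.+1)| <= d := hN _ (leq_maxl N m.+1).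
rewrite exprVn.
by apply: le_trans; exact: ler_norm.
Qed.

Lemma incr_ge (s : nat -> nat) : (forall j, (s j < s j.+1)%N) ->
  forall j, (j <= s j)%N.
Proof. by move=> h; elim=> // j ih; apply: leq_ltn_trans ih (h j). Qed.

Lemma incr_le (s : nat -> nat) : (forall j, (s j < s j.+1)%N) ->
  {homo s : i j / (i <= j)%N}.
Proof.
move=> h; apply: homo_leq => [//|i j k|j]; first exact: leq_trans.
exact: ltnW.
Qed.

Lemma incr_block_inj (K : nat -> nat) i j k : (forall j, (K j < K j.+1)%N) ->
  (K i <= k < K i.+1)%N -> (K j <= k < K j.+1)%N -> i = j.
Proof.
move=> hK /andP[ik ki] /andP[jk kj].
case: (ltngtP i j) => // lt.
  have := leq_trans ki (leq_trans (incr_le hK lt) jk).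
  by rewrite ltnn.
have := leq_trans kj (leq_trans (incr_le hK lt) ik).
by rewrite ltnn.
Qed.

Lemma sum_half_powers_le K : \sum_(k < K) 2 ^- k <= 2 :> R.
Proof.
have -> : \sum_(k < K) 2 ^- k = 2 - 2 ^- K * 2 :> R.
  elim: K => [|K ih]; first by rewrite big_ord0 expr0 invr1 mul1r subrr.
  by rewrite big_ord_recr/= ih exprS invfM; lra.
by rewrite gerBl mulr_ge0// invr_ge0 exprn_ge0.
Qed.

(** * Absolutely convergent series and Schur's theorem *)

Definition bounded_sums u (C : R) := forall K, \sum_(k < K) `|u k| <= C.

Definition seriesR u : R := limn (series u).

Lemma bounded_sums_cvg u C : bounded_sums u C -> cvgn (series u).
Proof.
move=> h; apply: normed_cvg; rewrite /normed_series_of.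
apply: nondecreasing_is_cvgn.
  by apply/nondecreasing_seqP => n; rewrite seriesSr lerDl normr_ge0.
exists C => _ [K _ <-]; rewrite /series/= big_mkord; exact: h.
Qed.

Lemma seriesRD u w C C' : bounded_sums u C -> bounded_sums w C' ->
  seriesR (fun k => u k + w k) = seriesR u + seriesR w.
Proof.
move=> /bounded_sums_cvg hu /bounded_sums_cvg hw.
rewrite /seriesR; apply/cvg_lim => //.
rewrite (_ : series _ = (fun n => series u n + series w n)); first exact: cvgD.
by apply/funext => n; rewrite /series/= big_split.
Qed.

Lemma seriesRZ u c C : bounded_sums u C ->
  seriesR (fun k => c * u k) = c * seriesR u.
Proof.
move=> /bounded_sums_cvg hu; rewrite /seriesR.
apply/cvg_lim => //.
rewrite (_ : series _ = (fun n => c * series u n)).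
  by apply: cvgM => //; exact: cvg_cst.
by apply/funext => n; rewrite /series/= mulr_sumr.
Qed.

Lemma seriesR_close u C m c : bounded_sums u C ->
  (forall K, \sum_(k < K | k != m :> nat) `|u k| <= c) ->
  `|seriesR u - u m| <= c.
Proof.
move=> /bounded_sums_cvg hu h.
have hc : (fun n => `|series u n - u m|) @ \oo --> `|seriesR u - u m|.
  apply: cvg_norm; apply: cvgB; [exact: hu | exact: cvg_cst].
rewrite -(cvg_lim _ hc)//; apply: limr_le.
  exact: cvgP hc.
exists m.+1 => // n /= mn; rewrite /series/= big_mkord.
rewrite (bigD1 (Ordinal mn))//= addrAC subrr add0r.
by apply: le_trans (h n); apply: ler_norm_sum.
Qed.

Lemma seriesR_le u C : bounded_sums u C -> `|seriesR u| <= C.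
Proof.
move=> hb; have hu := bounded_sums_cvg hb.
have hc : (fun n => `|series u n|) @ \oo --> `|seriesR u|.
  by apply: cvg_norm; exact: hu.
rewrite -(cvg_lim _ hc)//; apply: limr_le; first exact: cvgP hc.
exists 0%N => // n _; rewrite /series/= big_mkord.
by apply: le_trans (hb n); apply: ler_norm_sum.
Qed.

Lemma seriesR_single u m : (forall k, k != m -> u k = 0) -> seriesR u = u m.
Proof.
move=> h; apply/eqP; rewrite -subr_eq0 -normr_le0.
have h0 K : \sum_(k < K | k != m :> nat) `|u k| = 0.
  by rewrite big1// => i im; rewrite h// normr0.
apply: (@seriesR_close u `|u m|) => // K; last by rewrite h0.
case: (ltnP m K) => mK.
  by rewrite (bigD1 (Ordinal mK))//= h0 addr0.
rewrite big1// => i _; rewrite h ?normr0//.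
by rewrite neq_ltn (leq_trans (ltn_ord i) mK).
Qed.

Lemma bounded_sums_tail u C (e : R) : bounded_sums u C -> 0 < e ->
  exists M, forall K, \sum_(M <= k < K) `|u k| <= e.
Proof.
move=> hb e0.
have hcv : cvgn (series (fun k => `|u k|)).
  apply: nondecreasing_is_cvgn.
    by apply/nondecreasing_seqP => n; rewrite seriesSr lerDl normr_ge0.
  exists C => _ [K _ <-]; rewrite /series/= big_mkord; exact: hb.
have /cvg_cauchy/cauchy_ballP := hcv => /(_ _ (e0))[[A B]]/=.
move=> [[N1 _ h1] [N2 _ h2]] hAB.
exists (maxn N1 N2) => K.
case: (leqP (maxn N1 N2) K) => [hK|hK]; last by rewrite big_geq ?ltW// ltnW.
have hA := h1 (maxn N1 N2) (leq_maxl _ _).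
have hB := h2 K (leq_trans (leq_maxr _ _) hK).
have := hAB (_, _) (conj hA hB); rewrite /ball/= distrC => /ltW.
rewrite /series/= (@big_cat_nat _ _ _ (maxn N1 N2) 0 K)//= addrAC subrr add0r.
by apply: le_trans; apply: ler_norm.
Qed.

(* The diagonal part of Schur's theorem on l^1; keeping only the diagonal avoids
   any uniform boundedness argument. *)
Lemma schur_diagonal a :
  (forall n, exists C, bounded_sums (a n) C) ->
  (forall t : nat -> R, (forall k, `|t k| <= 1) ->
     vanishes (fun n => seriesR (fun k => t k * a n k))) ->
  vanishes (fun n => a n n).
Proof.
move=> hC ht; apply: contrapT => /not_vanishes[e e0 he].
have col k : vanishes (fun n => a n k).
  have := ht (fun j => (j == k)%:R).
  rewrite (_ : (fun n => seriesR _) = (fun n => a n k)); last first.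
    apply/funext => n; rewrite (seriesR_single (m := k)) ?eqxx ?mul1r//.
    by move=> j /negbTE->; rewrite mul0r.
  by apply => j; case: (j == k); rewrite ?normr1 ?normr0.
have cols K (d : R) : 0 < d -> exists N, forall n, (N <= n)%N ->
    \sum_(k < K) `|a n k| <= d.
  elim: K d => [|K ih] d d0; first by exists 0%N => n _; rewrite big_ord0 ltW.
  have d2 : 0 < d / 2 by rewrite divr_gt0.
  have [N1 h1] := ih _ d2; have [N2 h2] := col K _ d2.
  exists (maxn N1 N2) => n; rewrite geq_max => /andP[n1 n2].
  by rewrite big_ord_recr/= (splitr d) lerD ?h1 ?h2.
have e4 : 0 < e / 4 by rewrite divr_gt0.
(* Row [n] has a large diagonal entry inside the block [[K, M)] and little mass before and after
   that block. *)
pose P K n M := [/\ (K <= n < M)%N,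
    e < `|a n n|, \sum_(k < K) `|a n k| <= e / 4 &
    forall K', \sum_(M <= k < K') `|a n k| <= e / 4].
have /gliding_hump[n [K [hn hK hP]]] : forall K n0, exists n M,
    [/\ (n0 <= n)%N, (K < M)%N & P K n M].
  move=> K n0; have [N hN] := cols K _ e4.
  have [n hn hen] := he (maxn (maxn n0 N) K).
  move: hn; rewrite !geq_max => /andP[/andP[n0n Nn] Kn].
  have [C hCn] := hC n.
  have [M hM] := bounded_sums_tail hCn e4.
  exists n, (maxn M n.+1); split=> //.
    by rewrite leq_max ltnS Kn orbT.
  split=> //; first by rewrite Kn/= leq_max ltnSn orbT.
  - exact: hN.
  - move=> K'; case: (leqP (maxn M n.+1) K') => [hK'|hK']; last first.
      by rewrite big_geq ?ltW// ltnW.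
    apply: le_trans (hM K').
    rewrite [leRHS](@big_cat_nat _ _ _ (maxn M n.+1))//= ?leq_maxl//.
    by rewrite lerDr sumr_ge0.
(* Nonzero only at the chosen diagonal places, so that inside its block the row [n j] is tested at
   the diagonal entry alone; the mass off the block costs at most [e / 4 + e / 4]. *)
pose t k : R := if `[< exists j, n j = k >] then Num.sg (a k k) else 0.
have t1 k : `|t k| <= 1.
  rewrite /t; case: ifP => _; last by rewrite normr0.
  by rewrite normr_sg; case: (_ != _).
have [N hN] := ht t t1 _ e4.
pose j := N; have := hN (n j) (incr_ge hn j).
have [hj1 hj2 hj3 hj4] := hP j.
have tn : t (n j) * a (n j) (n j) = `|a (n j) (n j)|.
  by rewrite /t; case: asboolP => [_|[]]; [rewrite -normrEsg | exists j].
have [C hCn] := hC (n j).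
have tle k : `|t k * a (n j) k| <= `|a (n j) k|.
  by rewrite normrM ler_piMl.
have hb : bounded_sums (fun k => t k * a (n j) k) C.
  by move=> K'; apply: le_trans (hCn K'); apply: ler_sum => i _; exact: tle.
have hcl : `|seriesR (fun k => t k * a (n j) k) - t (n j) * a (n j) (n j)|
    <= e / 4 + e / 4.
  apply: (@seriesR_close (fun k => t k * a (n j) k) C (n j)) => // K'.
  (* The range is enlarged so that it can be cut at [K j] and at [K j.+1]. *)
  have step : \sum_(k < K' | k != n j :> nat) `|t k * a (n j) k| <=
      \sum_(0 <= k < maxn K' (K j.+1) | k != n j) `|t k * a (n j) k|.
    rewrite -(big_mkord (fun k => k != n j) (fun k => `|t k * a (n j) k|)).
    rewrite [leRHS](@big_cat_nat _ _ _ K')//= ?leq_maxl//.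
    by rewrite lerDl sumr_ge0.
  apply: le_trans step _.
  have KK : (K j <= K j.+1)%N by rewrite ltnW.
  rewrite (@big_cat_nat _ _ _ (K j))//=; last first.
    by rewrite (leq_trans KK)// leq_maxr.
  rewrite lerD//.
    apply: le_trans hj3; rewrite big_mkord big_mkcond/=; apply: ler_sum => i _.
    by case: ifP => // _; exact: tle.
  rewrite (@big_cat_nat _ _ _ (K j.+1))//= ?leq_maxr//.
  rewrite [X in X + _]big1_seq ?add0r//; last first.
    move=> k /andP[kn]; rewrite mem_index_iota => hk.
    rewrite /t; case: asboolP => [[i ik]|_]; last by rewrite mul0r normr0.
    have [hi1 _ _ _] := hP i; move: hi1; rewrite ik => hi1.
    by move: kn; rewrite -ik (incr_block_inj hK hi1 hk) eqxx.
  apply: le_trans (hj4 (maxn K' (K j.+1))).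
  rewrite big_mkcond/=; apply: ler_sum => i _.
  by case: ifP => // _; exact: tle.
move=> h1; rewrite tn in hcl.
have : `|a (n j) (n j)| <= `|seriesR (fun k => t k * a (n j) k)|
   + `|seriesR (fun k => t k * a (n j) k) - `|a (n j) (n j)| |.
  rewrite distrC -lerBlDl -{1}(normr_id (a (n j) (n j))).
  exact: lerB_dist.
lra.
Qed.

(** * Weakly null sequences and unconditional series of functionals *)

Section Abstract.
Variables (T : Type) (S : (T -> R) -> Prop) (N : (T -> R) -> \bar R).
Hypothesis Nfin : forall f, S f -> N f \is a fin_num.
Hypothesis N0 : forall f, S f -> (0 <= N f)%E.

Definition weakly_null (x : nat -> T -> R) :=
  forall L, bdd_lin S N L -> vanishes (fun n => L (x n)).

Lemma bdd_lin_bound L : bdd_lin S N L ->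
  exists2 C, 0 <= C & forall f, S f -> `|L f| <= C * fine (N f).
Proof.
move=> [_ [_ [C hC]]]; exists `|C| => // f Sf.
rewrite -lee_fin EFinM fineK ?Nfin//; apply: le_trans (hC f Sf) _.
by rewrite lee_wpmul2r ?N0// lee_fin ler_norm.
Qed.

Lemma weakly_null_subseq x (s : nat -> nat) : (forall n, (n <= s n)%N) ->
  weakly_null x -> weakly_null (x \o s).
Proof. by move=> hs hx L bL; apply: (vanishes_subseq hs (hx L bL)). Qed.

(** The type [T] is arbitrary because this serves twice: in the space, and in the dual, where the
    [L k] are evaluations. Each bounded [t] gives the bounded functional summing [t k * L k f],
    which is the test that [schur_diagonal] asks for. *)
Lemma weakly_null_unconditional (L : nat -> (T -> R) -> R) (C : R)
    (x : nat -> T -> R) :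
  (forall k, bdd_lin S N (L k)) ->
  (forall f, S f -> bounded_sums (fun k => L k f) (C * fine (N f))) ->
  (forall n, S (x n)) -> weakly_null x -> vanishes (fun n => L n (x n)).
Proof.
move=> bL hC Sx wx; apply: (@schur_diagonal (fun n k => L k (x n))).
  by move=> n; exists (C * fine (N (x n))); apply: hC.
move=> t t1.
have bt f : S f -> bounded_sums (fun k => t k * L k f) (C * fine (N f)).
  move=> Sf K; apply: le_trans (hC f Sf K); apply: ler_sum => i _.
  by rewrite normrM ler_piMl.
apply: (wx (fun f => seriesR (fun k => t k * L k f))); split; [|split].
- move=> f g Sf Sg; rewrite -(seriesRD (bt _ Sf) (bt _ Sg)).
  congr seriesR; apply/funext => k.
  by have [-> //] := bL k; rewrite mulrDr.
- move=> c f Sf; rewrite -(seriesRZ _ (bt _ Sf)).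
  congr seriesR; apply/funext => k.
  by have [_ [-> //]] := bL k; rewrite mulrCA.
- exists C => f Sf; rewrite -(fineK (Nfin Sf)) -EFinM lee_fin.
  exact/seriesR_le/bt.
Qed.

(* Apply the previous lemma to 2^-k L_k, with L_k norming a subsequence of
   norm at least 2^k. *)
Lemma weakly_null_bounded (x : nat -> T -> R) :
  (forall f c, S f -> c < fine (N f) -> exists L,
     [/\ bdd_lin S N L, forall g, S g -> `|L g| <= fine (N g) & c < `|L f|]) ->
  (forall n, S (x n)) -> weakly_null x ->
  exists2 M, 0 < M & forall n, fine (N (x n)) <= M.
Proof.
move=> norming Sx wx; apply: contrapT => /forall2NP hM.
have unb c m : exists2 n, (m <= n)%N & c < fine (N (x n)).
  apply: contrapT => /forall2NP h.
  (* If no index from [m] on had norm above [c], this [M] would bound the whole sequence. *)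
  pose M := Num.max 1 (Num.max c (\sum_(k < m) fine (N (x k)))).
  have M0 : 0 < M by rewrite lt_max ltr01.
  case: (hM M) => // /existsNP[n]; apply; rewrite /M.
  have [nm|mn] := ltnP n m.
    rewrite !le_max; apply/orP; right; apply/orP; right.
    rewrite (bigD1 (Ordinal nm))//= lerDl sumr_ge0// => i _.
    by rewrite fine_ge0 ?N0.
  case: (h n) => // /negP; rewrite -leNgt => hc.
  by rewrite !le_max hc orbT.
have /choice[s hs] : forall k, exists n, (k <= n)%N /\ 2 ^+ k < fine (N (x n)).
  by move=> k; have [n ? ?] := unb (2 ^+ k) k; exists n.
have /choice[L hL] : forall k, exists L, [/\ bdd_lin S N L,
    forall g, S g -> `|L g| <= fine (N g) & 2 ^+ k < `|L (x (s k))|].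
  by move=> k; apply: norming; [exact: Sx | have [] := hs k].
pose L' k f : R := 2 ^- k * L k f.
have h2 k : 0 < 2 ^- k :> R by rewrite invr_gt0 exprn_gt0.
have hv : vanishes (fun n => L' n (x (s n))).
  apply: (@weakly_null_unconditional L' 2 (x \o s)).
  - move=> k; have [[La [Lz [C hC]]] _ _] := hL k; split; [|split].
    + by move=> f g Sf Sg; rewrite /L' La// mulrDr.
    + by move=> c f Sf; rewrite /L' Lz// mulrCA.
    + exists (2 ^- k * C) => f Sf.
      rewrite /L' normrM gtr0_norm// EFinM (EFinM (2 ^- k) C) -muleA.
      by apply: lee_wpmul2l; [rewrite lee_fin ltW | exact: hC].
  - move=> f Sf K.
    have -> : 2 * fine (N f) = fine (N f) * 2 by rewrite mulrC.
    apply: (@le_trans _ _ (fine (N f) * \sum_(k < K) 2 ^- k)).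
      rewrite mulr_sumr; apply: ler_sum => k _.
      have [_ h _] := hL k.
      rewrite /L' normrM gtr0_norm// mulrC.
      by apply: ler_wpM2r; [exact: ltW | exact: h].
    by rewrite ler_wpM2l ?fine_ge0 ?N0// sum_half_powers_le.
  - by move=> n; apply: Sx.
  - by apply: weakly_null_subseq wx => n; have [] := hs n.
have h12 : 0 < 2^-1 :> R by rewrite invr_gt0.
have [n0 hn0] := hv _ h12.
have := hn0 n0 (leqnn _); rewrite /L' normrM gtr0_norm//.
have [_ _ h] := hL n0.
have : 2 ^- n0 * 2 ^+ n0 < 2 ^- n0 * `|L n0 (x (s n0))| by rewrite ltr_pM2l.
rewrite mulVf ?expf_neq0//; lra.
Qed.

End Abstract.
End WeaklyNullSequences.

(** * Sums of L^1 spaces *)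

(* No measurability is needed: for nonnegative functions the integral is a
   supremum over the simple functions below. *)
Lemma ge0_le_integral_any d (T : measurableType d) (R : realType)
    (mu : {measure set T -> \bar R}) (A : set T) (f g : T -> \bar R) :
  (forall x, A x -> (0 <= f x)%E) -> (forall x, A x -> (f x <= g x)%E) ->
  (\int[mu]_(x in A) f x <= \int[mu]_(x in A) g x)%E.
Proof.
move=> f0 fg; have g0 x : A x -> (0 <= g x)%E.
  by move=> Ax; apply: le_trans (f0 x Ax) (fg x Ax).
rewrite !ge0_integralE//; apply: le_ereal_sup => _ [h hf <-]; exists h => // x.
apply: le_trans (hf x) _; rewrite /patch; case: ifPn => // xA.
by apply: fg; rewrite inE in xA.
Qed.

Lemma le_lebesgue_measure (R : realType) (A B : set R) : measurable A ->
  measurable B -> A `<=` B -> (lebesgue_measure A <= lebesgue_measure B)%E.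
Proof. by move=> mA mB AB; apply: le_measure; rewrite ?inE. Qed.

Section BlockL1.
Variable R : realType.
Local Notation mu := (@lebesgue_measure R).
Variables (D : set R) (kap : R -> nat).
Implicit Types (F G h : R -> R) (A B : set R) (a c e : R) (k K n : nat).

Definition block k := D `&` [set x | kap x = k].

Definition low K := D `&` [set x | (kap x < K)%N].

Definition block_int (F : R -> R) k : \bar R :=
  \int[mu]_(x in block k) (`|F x|)%:E.

(** The c_0-sum of the spaces L^1 over the blocks, made of functions rather than classes: values off
    [D] are free, and a bounded functional vanishes on functions of norm 0. *)
Definition c0L1 (F : R -> R) : Prop :=
  [/\ measurable_fun D F, forall k, (block_int F k < +oo)%E &
    forall e : R, 0 < e -> exists K, forall k, (K <= k)%N ->
      (block_int F k <= e%:E)%E].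

Definition c0L1_norm (F : R -> R) : \bar R := ereal_sup (range (block_int F)).

Hypothesis mD : measurable D.
Hypothesis mblock : forall k, measurable (block k).

Lemma block_int_ge0 F k : (0 <= block_int F k)%E.
Proof. by apply: integral_ge0 => x _; rewrite lee_fin. Qed.

Lemma block_int_le_norm F k : (block_int F k <= c0L1_norm F)%E.
Proof. by apply: ereal_sup_ubound; exists k. Qed.

Lemma c0L1_norm_ge0 F : (0 <= c0L1_norm F)%E.
Proof. exact: le_trans (block_int_ge0 F 0) (block_int_le_norm F 0). Qed.

Lemma c0L1_norm_le F (c : \bar R) : (forall k, (block_int F k <= c)%E) ->
  (c0L1_norm F <= c)%E.
Proof. by move=> h; apply: ge_ereal_sup => _ [k _ <-]. Qed.

Lemma c0L1_norm_fin F : c0L1 F -> c0L1_norm F \is a fin_num.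
Proof.
move=> [mF fF cF]; have [K hK] := cF 1 ltr01.
have fin k : block_int F k \is a fin_num by rewrite ge0_fin_numE ?block_int_ge0.
have : (c0L1_norm F <= (1 + \sum_(k < K) fine (block_int F k))%:E)%E.
  apply: c0L1_norm_le => k; have [kK|Kk] := ltnP k K.
    rewrite -(fineK (fin k)) lee_fin (bigD1 (Ordinal kK))//= addrCA lerDl.
    rewrite addr_ge0// sumr_ge0// => i _; exact/fine_ge0/block_int_ge0.
  apply: le_trans (hK k Kk) _; rewrite lee_fin lerDl.
  by rewrite sumr_ge0// => i _; exact/fine_ge0/block_int_ge0.
by move=> h; rewrite ge0_fin_numE ?c0L1_norm_ge0// (le_lt_trans h)// ltry.
Qed.

Lemma block_int_homo F G k : (forall x, D x -> `|G x| <= `|F x|) ->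
  (block_int G k <= block_int F k)%E.
Proof.
move=> h; rewrite /block_int.
apply: ge0_le_integral_any => x; first by rewrite lee_fin.
by move=> [Dx _]; rewrite lee_fin h.
Qed.

Lemma c0L1_solid F G : c0L1 F -> measurable_fun D G ->
  (forall x, D x -> `|G x| <= `|F x|) -> c0L1 G.
Proof.
move=> [mF fF cF] mG h; split=> //.
  by move=> k; apply: le_lt_trans (block_int_homo k h) (fF k).
move=> e e0; have [K hK] := cF e e0; exists K => k Kk.
exact: le_trans (block_int_homo k h) (hK k Kk).
Qed.

Lemma measurable_abs_block F k : measurable_fun D F ->
  measurable_fun (block k) (fun x => (`|F x|)%:E).
Proof.
move=> mF; apply/measurable_EFinP; apply: measurableT_comp => //.
by apply: measurable_funS mF => // x [].
Qed.

Lemma block_intD F G k : measurable_fun D F -> measurable_fun D G ->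
  (block_int (fun x => F x + G x)%R k <= block_int F k + block_int G k)%E.
Proof.
move=> mF mG; rewrite /block_int -ge0_integralD//.
- apply: ge0_le_integral_any => x _; first by rewrite lee_fin.
  by rewrite -EFinD lee_fin ler_normD.
- exact: mblock.
- exact: measurable_abs_block.
- exact: measurable_abs_block.
Qed.

Lemma block_intZ a F k : measurable_fun D F ->
  block_int (fun x => a * F x)%R k = (`|a|%:E * block_int F k)%E.
Proof.
move=> mF; rewrite /block_int -ge0_integralZl//.
- by apply: eq_integral => x _; rewrite normrM EFinM.
- exact: mblock.
- exact: measurable_abs_block.
Qed.

Lemma c0L1D F G : c0L1 F -> c0L1 G -> c0L1 (fun x => F x + G x).
Proof.
move=> [mF fF cF] [mG fG cG]; split; first exact: measurable_funD.
  move=> k; apply: le_lt_trans (block_intD k mF mG) _.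
  exact: lte_add_pinfty.
move=> e e0; have e2 : 0 < e / 2 by rewrite divr_gt0.
have [K1 h1] := cF _ e2; have [K2 h2] := cG _ e2.
exists (maxn K1 K2) => k; rewrite geq_max => /andP[k1 k2].
apply: le_trans (block_intD k mF mG) _.
by rewrite (splitr e) EFinD leeD ?h1 ?h2.
Qed.

Lemma c0L1Z a F : c0L1 F -> c0L1 (fun x => a * F x).
Proof.
move=> [mF fF cF]; split; first exact: measurable_funM.
  move=> k; rewrite block_intZ// lte_mul_pinfty//.
move=> e e0; have a1 : 0 < `|a| + 1 by rewrite ltr_wpDl.
have [K hK] := cF _ (divr_gt0 e0 a1); exists K => k Kk.
rewrite block_intZ//; apply: (@le_trans _ _ (`|a|%:E * (e / (`|a| + 1))%:E)%E).
  by apply: lee_wpmul2l; [rewrite lee_fin | exact: hK].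
rewrite -EFinM lee_fin mulrCA ger_pMr// ler_pdivrMr// mul1r; lra.
Qed.

Lemma c0L1_normZ a F : measurable_fun D F ->
  (c0L1_norm (fun x => a * F x)%R <= `|a|%:E * c0L1_norm F)%E.
Proof.
move=> mF; apply: c0L1_norm_le => k; rewrite block_intZ//.
by apply: lee_wpmul2l; [rewrite lee_fin | exact: block_int_le_norm].
Qed.

(** * Integrals over finitely many blocks and the functionals they define *)

Lemma lowS K : low K.+1 = low K `|` block K.
Proof.
apply/seteqP; split=> [x [Dx]|x [[Dx]|[Dx]]]/=.
- by rewrite ltnS leq_eqVlt => /orP[/eqP|]; [right|left].
- by move=> h; split=> //=; rewrite ltnS ltnW.
- by move=> h; split=> //=; rewrite h.
Qed.

Lemma low0 : low 0 = set0.
Proof. by apply/seteqP; split=> // x []. Qed.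

Lemma mlow K : measurable (low K).
Proof.
elim: K => [|K ih]; first by rewrite low0.
by rewrite lowS; apply: measurableU.
Qed.

(** On the first [K] blocks the largest block integral and the L^1 norm are equivalent; this is one
    direction and [c0L1_norm_le_Rint] is the other. *)
Lemma low_int_le F K : c0L1 F ->
  (\int[mu]_(x in low K) (`|F x|)%:E <= K%:R%:E * c0L1_norm F)%E.
Proof.
move=> cF; have [mF _ _] := cF; have fin := c0L1_norm_fin cF.
elim: K => [|K ih]; first by rewrite low0 integral_set0 mul0e.
rewrite lowS ge0_integral_setU//; first last.
- apply/disj_setPS => x [[_ /= h] [_ /= e]].
  by rewrite e ltnn in h.
- rewrite -lowS; apply/measurable_EFinP; apply: measurableT_comp => //.
  by apply: measurable_funS mF => // x [].
- exact: mblock.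
- exact: mlow.
- rewrite -natr1 EFinD ge0_muleDl ?lee_fin// mul1e leeD//.
  exact: block_int_le_norm.
Qed.

Lemma low_integrable F K A : c0L1 F -> measurable A -> A `<=` low K ->
  mu.-integrable A (EFin \o F).
Proof.
move=> cF mA sA; apply: (@integrableS _ _ _ mu (low K)) => //.
  exact: mlow.
have [mF _ _] := cF; apply/integrableP; split.
  by apply/measurable_EFinP; apply: measurable_funS mF => // x [].
apply: le_lt_trans (low_int_le K cF) _.
by rewrite lte_mul_pinfty// ltey_eq c0L1_norm_fin.
Qed.

Lemma low_Rint_le F K A : c0L1 F -> measurable A -> A `<=` low K ->
  \int[mu]_(x in A) `|F x| <= K%:R * fine (c0L1_norm F).
Proof.
move=> cF mA sA; have [mF _ _] := cF.
rewrite -lee_fin EFinM (fineK (c0L1_norm_fin cF)) /Rintegral fineK; last first.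
  apply: integrable_fin_num => //.
  exact: integrable_norm (low_integrable cF mA sA).
apply: le_trans (low_int_le K cF).
apply: ge0_subset_integral => //; first exact: mlow.
- apply/measurable_EFinP; apply: measurableT_comp => //.
  by apply: measurable_funS mF => // x [].
Qed.

Lemma c0L1_norm_le_Rint F K A : c0L1 F -> measurable A -> A `<=` low K ->
  (forall x, D x -> ~ A x -> F x = 0) ->
  (c0L1_norm F <= (\int[mu]_(x in A) `|F x|)%:E)%E.
Proof.
move=> cF mA sA F0; have [mF _ _] := cF; apply: c0L1_norm_le => k.
rewrite /Rintegral fineK; last first.
  apply: integrable_fin_num => //.
  exact: integrable_norm (low_integrable cF mA sA).
rewrite /block_int.
have -> : (\int[mu]_(x in block k) (`|F x|)%:E =
    \int[mu]_(x in block k `&` A) (`|F x|)%:E)%E.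
  rewrite [RHS]integral_mkcondr; apply: eq_integral => x; rewrite inE => -[Dx _].
  by rewrite patchE; case: ifPn => // /negP; rewrite inE => h; rewrite F0 ?normr0.
have mI : measurable (block k `&` A) by apply: measurableI.
apply: ge0_subset_integral => //.
- apply/measurable_EFinP; apply: measurableT_comp => //.
  by apply: measurable_funS mF => // x /sA [].
Qed.

Lemma measurable_fun_cut F A : measurable_fun D F -> measurable A ->
  measurable_fun D (fun x => F x * \1_A x).
Proof. by move=> mF mA; apply: measurable_funM => //; exact: measurable_indic. Qed.

Lemma cut_le F A (x : R) : `|F x * \1_A x| <= `|F x|.
Proof.
rewrite normrM ler_piMr// indicE.
by case: (_ \in _); rewrite ?normr1 ?normr0.
Qed.

Lemma c0L1_cut F A : c0L1 F -> measurable A -> c0L1 (fun x => F x * \1_A x).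
Proof.
move=> cF mA; have [mF _ _] := cF.
by apply: (c0L1_solid cF) => [|x _]; [exact: measurable_fun_cut|exact: cut_le].
Qed.

Lemma c0L1_indic A K : measurable A -> A `<=` low K -> (mu A < +oo)%E ->
  c0L1 \1_A /\ (c0L1_norm \1_A <= mu A)%E.
Proof.
move=> mA sA fA.
have E k : block_int \1_A k = mu (A `&` block k).
  rewrite -(@integral_indic _ _ _ mu (block k) (mblock k) A mA).
  by apply: eq_integral => x _; rewrite ger0_norm.
have le k : (block_int \1_A k <= mu A)%E.
  have mI : measurable (A `&` block k) by apply: measurableI.
  by rewrite E; apply: le_lebesgue_measure => // x [].
split; last exact: c0L1_norm_le.
split; first exact: measurable_indic.
  by move=> k; apply: le_lt_trans (le k) fA.
move=> e e0; exists K => k Kk; rewrite E (_ : A `&` block k = set0).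
  by rewrite measure0 lee_fin ltW.
apply/seteqP; split=> // x [/sA[_ /= h] [_ /= h']].
by rewrite h' ltnNge Kk in h.
Qed.

(** Functionals with a bounded density on finitely many blocks. With the sign of a function as
    density they recover its L^1 norm, which makes them the norming and test functionals of the
    space. *)
Lemma int_functional A K h : measurable A -> A `<=` low K ->
  measurable_fun D h -> (forall x, `|h x| <= 1) ->
  bdd_lin c0L1 c0L1_norm (fun F => \int[mu]_(x in A) (F x * h x)) /\
  (forall F, c0L1 F ->
    `|\int[mu]_(x in A) (F x * h x)| <= \int[mu]_(x in A) `|F x|).
Proof.
move=> mA sA mh h1.
have sub F : c0L1 F -> c0L1 (fun x => F x * h x).
  move=> cF; have [mF _ _] := cF.
  apply: (c0L1_solid cF); first exact: measurable_funM.
  by move=> x _; rewrite normrM ler_piMr.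
have int F : c0L1 F -> mu.-integrable A (EFin \o (fun x => F x * h x)).
  by move=> cF; apply: (low_integrable (sub F cF) mA sA).
have bound F : c0L1 F ->
    `|\int[mu]_(x in A) (F x * h x)| <= \int[mu]_(x in A) `|F x|.
  move=> cF; have le := @le_normr_Rintegral _ _ _ mu A _ mA (int F cF).
  apply: le_trans le _.
  apply: le_Rintegral => //.
  - exact: integrable_norm (int F cF).
  - exact: integrable_norm (low_integrable cF mA sA).
  - by move=> x _; rewrite normrM ler_piMr.
split=> //; split; [|split].
- move=> F G cF cG; rewrite -RintegralD//; [|exact: int..].
  by apply: eq_Rintegral => x _; rewrite mulrDl.
- move=> a F cF; rewrite -RintegralZl//; last exact: int.
  by apply: eq_Rintegral => x _; rewrite mulrA.
- exists K%:R => F cF; rewrite -(fineK (c0L1_norm_fin cF)) -EFinM lee_fin.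
  exact: le_trans (bound F cF) (low_Rint_le cF mA sA).
Qed.

Lemma measurable_sg F : measurable_fun D F ->
  measurable_fun D (fun x => Num.sg (F x)).
Proof.
move=> mF; apply: (@measurableT_comp _ _ _ _ _ _ (@Num.sg R)) => //.
apply: nondecreasing_measurable => // x y xy.
by case: (sgrP x); case: (sgrP y) => //; lra.
Qed.

Lemma sg_le1 (a : R) : `|Num.sg a| <= 1.
Proof. by rewrite normr_sg; case: (_ != _). Qed.

Lemma block_sub_low k : block k `<=` low k.+1.
Proof. by move=> x [Dx /= kx]; split=> //=; rewrite kx. Qed.

Lemma Rint_sg F A : \int[mu]_(x in A) (F x * Num.sg (F x)) =
  \int[mu]_(x in A) `|F x|.
Proof. by apply: eq_Rintegral => x _; rewrite mulrC -normrEsg. Qed.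

Lemma c0L1_weakly_null_bounded x : (forall n, c0L1 (x n)) ->
  weakly_null c0L1 c0L1_norm x ->
  exists2 M, 0 < M & forall n, fine (c0L1_norm (x n)) <= M.
Proof.
move=> Sx; apply: weakly_null_bounded => //.
- exact: c0L1_norm_fin.
- by move=> f _; apply: c0L1_norm_ge0.
move=> F c cF cc; have [mF fF _] := cF.
have : (c%:E < c0L1_norm F)%E by rewrite -(fineK (c0L1_norm_fin cF)) lte_fin.
move=> /ereal_sup_gt[_ [k _ <-]] hk.
(* The norm is a supremum over blocks, so some block integral exceeds [c]; integration against the
   sign of [F] on that block is the norming functional. *)
have [bL hL] := int_functional (mblock k) (@block_sub_low k) (measurable_sg mF)
  (fun x => sg_le1 (F x)).
exists (fun G => \int[mu]_(x in block k) (G x * Num.sg (F x))); split=> //.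
  move=> G cG; apply: le_trans (hL G cG) _.
  rewrite fine_le//; [|exact: c0L1_norm_fin|exact: block_int_le_norm].
  by have [_ fG _] := cG; rewrite ge0_fin_numE ?block_int_ge0 ?fG.
rewrite Rint_sg ger0_norm ?Rintegral_ge0// -lte_fin /Rintegral fineK//.
by rewrite ge0_fin_numE ?block_int_ge0 ?fF.
Qed.

(** * Uniform integrability of weakly null sequences *)

Hypothesis muD : (mu D < +oo)%E.

Lemma mu_low_fin A K : measurable A -> A `<=` low K -> mu A \is a fin_num.
Proof.
move=> mA sA; rewrite ge0_fin_numE//; apply: le_lt_trans muD.
by apply: le_lebesgue_measure => // x /sA [].
Qed.

Lemma abs_low_integrable F K A : c0L1 F -> measurable A -> A `<=` low K ->
  mu.-integrable A (EFin \o (fun x => `|F x|)).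
Proof. by move=> cF mA sA; apply: integrable_norm (low_integrable cF mA sA). Qed.

(** Truncation at height [n]: the excess [max (|F| - n) 0] has small integral over [low K] by
    dominated convergence, and the bounded part contributes at most [n * mu A]. *)
Lemma low_abs_cont F K e : c0L1 F -> 0 < e -> exists2 d : R, 0 < d &
  forall A, measurable A -> A `<=` low K -> (mu A <= d%:E)%E ->
    \int[mu]_(x in A) `|F x| <= e.
Proof.
move=> cF e0; have [mF _ _] := cF.
have mFl : measurable_fun (low K) F by apply: measurable_funS mF => // x [].
pose f n x : \bar R := (Num.max (`|F x| - n%:R) 0)%:E.
have f0 n x : (0 <= f n x)%E by rewrite /f lee_fin le_max lexx orbT.
have mf n B : B `<=` low K -> measurable B -> measurable_fun B (f n).
  move=> sB mB; apply/measurable_EFinP; apply: measurable_maxr => //.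
  apply: measurable_funB => //; apply: measurableT_comp => //.
  exact: (measurable_funS (mlow K) sB).
have intF := abs_low_integrable cF (mlow K) (@subset_refl _ (low K)).
have fcvg x : (f n x @[n --> \oo] --> 0)%E.
  apply: cvg_near_cst; near=> n; rewrite /f /cst/=; congr EFin.
  apply/max_idPr; rewrite subr_le0; near: n.
  exact: nbhs_infty_ger.
have fdom n x : (`|f n x| <= `|F x|%:E)%E.
  rewrite /f/= lee_fin ger0_norm ?le_max ?lexx ?orbT// ge_max normr_ge0 andbT.
  by rewrite gerBl.
have [||_ h _] := @dominated_convergence _ _ _ mu (low K) (mlow K) f (cst 0%E)
  (EFin \o (fun x => `|F x|)) (fun n => mf n _ (@subset_refl _ _) (mlow K))
  (measurable_cst _) _ intF.
- by apply: aeW => x _; exact: fcvg.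
- by apply: aeW => x n _; exact: fdom.
have {}h : (\int[mu]_(x in low K) f n x @[n --> \oo] --> 0)%E.
  apply: cvg_trans h; apply: near_eq_cvg; apply: nearW => n.
  by apply: eq_integral => x _; rewrite sube0 gee0_abs.
have e2 : 0 < e / 2 by rewrite divr_gt0.
have [n hn] : exists n, (\int[mu]_(x in low K) f n x <= (e / 2)%:E)%E.
  have /fine_cvgP[[N _ hN]] := h.
  move=> /cvgrPdist_le/(_ _ e2)[N' _ hN'].
  exists (maxn N N').
  have fin := hN (maxn N N') (leq_maxl _ _).
  rewrite -(fineK fin) lee_fin; have := hN' (maxn N N') (leq_maxr _ _).
  by rewrite /= sub0r normrN; apply: le_trans; exact: ler_norm.
have n1 : 0 < n%:R + 1 :> R by rewrite ltr_wpDl.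
exists (e / 2 / (n%:R + 1)); first by rewrite divr_gt0.
move=> A mA sA hA; rewrite -lee_fin /Rintegral fineK; last first.
  apply: integrable_fin_num => //; exact: (abs_low_integrable cF mA sA).
apply: (@le_trans _ _ (\int[mu]_(x in A) (n%:R%:E + f n x))%E).
  apply: ge0_le_integral_any => x _; first by rewrite lee_fin.
  by rewrite -EFinD lee_fin -lerBlDl le_max lexx.
rewrite ge0_integralD//; [|exact: mf].
rewrite (splitr e) EFinD leeD//.
  rewrite integral_cst//; apply: (@le_trans _ _
    (n%:R%:E * (e / 2 / (n%:R + 1))%:E)%E).
    by apply: lee_wpmul2l => //; rewrite lee_fin.
  rewrite -EFinM lee_fin mulrCA ger_pMr// ler_pdivrMr// mul1r; lra.
apply: le_trans hn; apply: ge0_subset_integral => //; first exact: mlow.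
exact: (mf n (low K) (@subset_refl _ _) (mlow K)).
Unshelve. all: by end_near.
Qed.

(** Suppose the integrals stay above [e]. Along a subsequence the later sets have a union so small
    that [x (n j)] has integral at most [e / 2] on it; removing that union leaves disjoint sets
    [Z j]. Integration against the sign of [x (n j)] on [Z j] defines functionals whose absolute
    values sum to at most the L^1 norm on [low K]. Their diagonal values must tend to 0, yet they
    exceed [e / 2]. *)
Lemma weakly_null_uniform_int x (Q : nat -> set R) K : (forall n, c0L1 (x n)) ->
  weakly_null c0L1 c0L1_norm x ->
  (forall n, measurable (Q n)) -> (forall n, Q n `<=` low K) ->
  vanishes (fun n => fine (mu (Q n))) ->
  vanishes (fun n => \int[mu]_(t in Q n) `|x n t|).
Proof.
move=> Sx wx mQ sQ vQ; apply: contrapT => /not_vanishes[e e0 he].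
have finQ n : mu (Q n) \is a fin_num by apply: (mu_low_fin (mQ n) (sQ n)).
have e2 : 0 < e / 2 by rewrite divr_gt0.
(* [2 * 2 ^- M] will bound the measure of the union of all later sets: their measures are at most
   [2 ^- k] for strictly increasing values of [k], the first of which is [M]. *)
pose P k n M := [/\ (mu (Q n) <= (2 ^- k)%:E)%E,
  e < \int[mu]_(t in Q n) `|x n t| & forall A, measurable A -> A `<=` low K ->
    (mu A <= (2 * 2 ^- M)%:E)%E -> \int[mu]_(t in A) `|x n t| <= e / 2].
have /gliding_hump[n [k [hn hk hP]]] : forall k n0, exists n M,
    [/\ (n0 <= n)%N, (k < M)%N & P k n M].
  move=> k n0; have k0 : 0 < 2 ^- k :> R by rewrite invr_gt0 exprn_gt0.
  have [N hN] := vQ _ k0; have [n] := he (maxn n0 N).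
  rewrite geq_max => /andP[n0n Nn]; rewrite ger0_norm ?Rintegral_ge0// => hen.
  have [d d0 hd] := low_abs_cont K (Sx n) e2.
  have d2 : 0 < d / 2 by rewrite divr_gt0.
  have [M kM hM] := @small_half_power R (d / 2) k d2.
  exists n, M; split=> //; split=> //.
    rewrite -(fineK (finQ n)) lee_fin; apply: le_trans (hN n Nn).
    exact: ler_norm.
  move=> A mA sA hA; apply: hd => //; apply: le_trans hA _.
  by rewrite lee_fin; lra.
pose U j := \bigcup_i Q (n (j.+1 + i)%N).
have mU j : measurable (U j) by apply: bigcup_measurable.
have muU j : (mu (U j) <= (2 * 2 ^- k j.+1)%:E)%E.
  have := @measure_sigma_subadditive _ _ _ mu (U j)
    (fun i => Q (n (j.+1 + i)%N)) (fun i => mQ _) (mU j) (@subset_refl _ _).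
  move=> /le_trans; apply; apply: lime_le.
    by apply: is_cvg_nneseries => i _ _.
  apply: nearW => m; apply: (@le_trans _ _
     (\sum_(0 <= i < m) (2 ^- k j.+1 * 2 ^- i)%:E)%E).
    apply: lee_sum => i _; have [h _ _] := hP (j.+1 + i)%N.
    apply: le_trans h _; rewrite lee_fin -invfM -exprD lef_pV2 ?posrE ?exprn_gt0//.
    rewrite ler_weXn2l ?ler1n//; elim: i => [|i ih]; first by rewrite !addn0.
    by rewrite !addnS (leq_ltn_trans ih)// hk.
  rewrite sumEFin lee_fin -mulr_sumr mulrC ler_wpM2r ?invr_ge0 ?exprn_ge0//.
  by rewrite big_mkord; exact: sum_half_powers_le.
pose Z j := Q (n j) `\` U j.
have mZ j : measurable (Z j) by apply: measurableD.
have sZ j : Z j `<=` low K by move=> t [/sQ].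
have disj i j t : (i < j)%N -> Z i t -> ~ Z j t.
  move=> ij [_ nU] [Qj _]; apply: nU; exists (j - i.+1)%N => //.
  by rewrite subnKC.
pose V J := \bigcup_(j in [set j | (j < J)%N]) Z j.
have VS J : V J.+1 = V J `|` Z J.
  apply/seteqP; split=> [t [j /= jJ Zj]|t [[j /= jJ Zj]|Zj]].
  - by move: jJ; rewrite ltnS leq_eqVlt => /orP[/eqP <-|jJ]; [right|left; exists j].
  - by exists j => //=; rewrite ltnS ltnW.
  - by exists J => //=.
have mV J : measurable (V J) by apply: bigcup_measurable.
have sV J : V J `<=` low K by move=> t [j _ /sZ].
have sumZ F J : c0L1 F -> \sum_(j < J) \int[mu]_(t in Z j) `|F t| =
    \int[mu]_(t in V J) `|F t|.
  move=> cF; elim: J => [|J ih].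
    rewrite big_ord0 (_ : V 0%N = set0) ?Rintegral_set0//.
    by apply/seteqP; split=> // t [].
  rewrite big_ord_recr/= ih VS Rintegral_setU//.
  - exact: mV.
  - exact: mZ.
  - by rewrite -VS; apply: (abs_low_integrable cF (mV _) (sV _)).
  - by apply/disj_setPS => t [[j /= jJ Zj]]; apply: (disj j J).
pose L j F := \int[mu]_(t in Z j) (F t * Num.sg (x (n j) t)).
have LP j := int_functional (mZ j) (@sZ j)
  (measurable_sg (let: And3 m _ _ := Sx (n j) in m)) (fun t => sg_le1 (x (n j) t)).
have := @weakly_null_unconditional R R c0L1 c0L1_norm c0L1_norm_fin L K%:R
  (x \o n).
case/(_ _ _ _ _ _ e2).
- by move=> j; have [] := LP j.
- move=> F cF J; apply: le_trans (low_Rint_le cF (mV J) (sV J)).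
  by rewrite -sumZ//; apply: ler_sum => j _; have [_ ->] := LP j.
- by move=> j /=; apply: Sx.
- exact: weakly_null_subseq (incr_ge hn) wx.
move=> j /(_ j (leqnn j)); rewrite /L/= Rint_sg ger0_norm ?Rintegral_ge0//.
have [_ h1 h2] := hP j.
have QE : Q (n j) = Z j `|` (Q (n j) `&` U j) by rewrite setUC setUIDK.
have mI : measurable (Q (n j) `&` U j) by apply: measurableI.
have sI : Q (n j) `&` U j `<=` low K by move=> t [/sQ].
have h3 : \int[mu]_(t in Q (n j) `&` U j) `|x (n j) t| <= e / 2.
  apply: h2 => //; apply: le_trans (muU j).
  by apply: le_lebesgue_measure => // t [].
move: h1; rewrite QE Rintegral_setU//; [lra| |..].
- exact: mZ.
- by rewrite -QE; apply: (abs_low_integrable (Sx _) (mQ _) (@sQ _)).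
- by apply/disj_setPS => t [[_ h] [_ /h]].
Qed.

(** * Bounded functionals as charges on finitely many blocks *)

Lemma mu_low_lty A K : measurable A -> A `<=` low K -> (mu A < +oo)%E.
Proof. by move=> mA sA; rewrite -ge0_fin_numE// (mu_low_fin mA sA). Qed.

Lemma c0L1_indic_low A K : measurable A -> A `<=` low K ->
  c0L1 \1_A /\ (c0L1_norm \1_A <= mu A)%E.
Proof. by move=> mA sA; apply: (c0L1_indic mA sA); exact: mu_low_lty sA. Qed.

Lemma bdd_lin_c0L1_bound l : bdd_lin c0L1 c0L1_norm l ->
  exists2 C, 0 <= C & forall f, c0L1 f -> `|l f| <= C * fine (c0L1_norm f).
Proof.
apply: bdd_lin_bound; first exact: c0L1_norm_fin.
by move=> f _; exact: c0L1_norm_ge0.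
Qed.

Lemma bdd_lin_indicU l A B K : bdd_lin c0L1 c0L1_norm l ->
  measurable A -> measurable B -> A `<=` low K -> B `<=` low K ->
  (forall t, A t -> ~ B t) -> l \1_(A `|` B) = l \1_A + l \1_B.
Proof.
move=> [lD _] mA mB sA sB AB.
have [cA _] := c0L1_indic_low mA sA.
have [cB _] := c0L1_indic_low mB sB.
rewrite -lD//; congr l; apply/funext => t; rewrite !indicE in_setU.
case: (boolP (t \in A)); case: (boolP (t \in B)); rewrite ?addr0 ?add0r//.
by rewrite !inE => Bt /AB.
Qed.

Lemma bdd_lin_indic0 l : bdd_lin c0L1 c0L1_norm l -> l \1_set0 = 0.
Proof.
move=> [_ [lZ _]].
have [c0 _] := c0L1_indic_low measurable0 (@sub0set _ (low 0)).
have := lZ 0 _ c0; rewrite mul0r => <-; congr l.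
by apply/funext => t; rewrite mul0r indicE in_set0.
Qed.

Lemma bdd_lin_indic_le (l : (R -> R) -> R) (C : R) A K : (forall f, c0L1 f ->
    `|l f| <= C * fine (c0L1_norm f)) -> 0 <= C ->
  measurable A -> A `<=` low K -> `|l \1_A| <= C * fine (mu A).
Proof.
move=> lC C0 mA sA; have fA := mu_low_fin mA sA.
have [cA nA] := c0L1_indic_low mA sA.
apply: le_trans (lC _ cA) _; rewrite ler_wpM2l// fine_le// c0L1_norm_fin//.
Qed.

(** On subsets of [low K] the set function [l \1_A] is dominated by [C * mu A], so finite additivity
    becomes countable additivity and the Hahn decomposition of charges applies. *)
Lemma functional_hahn l K : bdd_lin c0L1 c0L1_norm l -> exists P,
  [/\ measurable P, P `<=` low K,
      forall B, measurable B -> B `<=` P -> 0 <= l \1_B &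
      forall B, measurable B -> B `<=` low K `\` P -> l \1_B <= 0].
Proof.
move=> bl; have [C C0 lC] := bdd_lin_c0L1_bound bl.
(* Intersecting with [low K] defines the set function on all measurable sets. *)
pose nu (A : set (measurableTypeR R)) : \bar R := (l \1_(A `&` low K))%:E.
have nu0 : nu set0 = 0%E by rewrite /nu set0I bdd_lin_indic0.
have nufin (A : set (measurableTypeR R)) : measurable A -> nu A \is a fin_num.
  by [].
have nuadd : semi_sigma_additive nu.
  move=> F mF' tF mU'; rewrite /nu.
  have mF i : measurable (F i : set R) := mF' i.
  have mU : measurable (\bigcup_i F i : set R) := mU'.
  pose V n : set R := \bigcup_(i in [set i | (i < n)%N]) (F i `&` low K).
  (* The part of the union not yet exhausted. These sets decrease to the empty set, so their
     measure, and with it [l] on their indicators, tends to 0. *)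
  pose W n : set R := (\bigcup_i F i) `&` low K `\` V n.
  have mI i : measurable (F i `&` low K : set R).
    by apply: measurableI => //; exact: mlow.
  have mV n : measurable (V n) by apply: bigcup_measurable.
  have sV n : V n `<=` low K by move=> t [i _ []].
  have mW n : measurable (W n).
    by apply: measurableD => //; apply: measurableI => //; exact: mlow.
  have sW n : W n `<=` low K by move=> t [[]].
  have VS n : V n.+1 = V n `|` (F n `&` low K).
    apply/seteqP; split=> [t [j /= jJ Zj]|t [[j /= jJ Zj]|Zj]].
    - by move: jJ; rewrite ltnS leq_eqVlt => /orP[/eqP <-|jJ]; [right|left; exists j].
    - by exists j => //=; rewrite ltnS ltnW.
    - by exists n => //=.
  have sumE n : \sum_(0 <= i < n) l \1_(F i `&` low K) = l \1_(V n).
    elim: n => [|n ih].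
      rewrite big_geq// (_ : V 0%N = set0) ?bdd_lin_indic0//.
      by apply/seteqP; split=> // t [].
    rewrite big_nat_recr//= ih VS (@bdd_lin_indicU _ _ _ K)//.
    move=> t [i /= ilt [Fi _]] [Fn _].
    have := tF i n I I (ex_intro _ t (conj Fi Fn)) => ein.
    by rewrite ein ltnn in ilt.
  have splitW n : l \1_((\bigcup_i F i) `&` low K) = l \1_(V n) + l \1_(W n).
    rewrite -(@bdd_lin_indicU _ _ _ K)//; last by move=> t Vt [].
    congr (l \1_ _); rewrite /W setDUK// => t [i _ [Fi lt]].
    by split=> //; exists i.
  have muW : (fun n => fine (mu (W n))) @ \oo --> 0.
    have : mu (W n) @[n --> \oo] --> mu (\bigcap_n W n).
      apply: nonincreasing_cvg_mu => //.
      - exact: mu_low_lty (mW 0%N) (@sW 0%N).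
      - by apply: bigcapT_measurable => n; exact: mW.
      - move=> m n mn; apply/subsetPset => t [h1 h2]; split=> // -[i /= im Fi].
        by apply: h2; exists i => //=; apply: leq_trans im mn.
    rewrite (_ : \bigcap_n W n = set0); last first.
      apply/seteqP; split=> // t h; have [[[i _ Fi] lt] _] := h 0%N I.
      by have [_] := h i.+1 I; apply; exists i => //=.
    by rewrite measure0 => /fine_cvgP[].
  under eq_cvg do rewrite sumEFin sumE.
  apply/fine_cvgP; split; first exact: nearW.
  move/vanishesP: muW => muW.
  suff : (l \1_(V n) - l \1_((\bigcup_i F i) `&` low K)) @[n --> \oo] --> 0.
    move=> h; apply/subr_cvg0; exact: h.
  apply/vanishesP => e e0; have C1 : 0 < C + 1 by rewrite ltr_wpDl.
  have [N hN] := muW _ (divr_gt0 e0 C1); exists N => n Nn.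
  rewrite (splitW n) opprD addrA subrr add0r normrN.
  apply: le_trans (bdd_lin_indic_le lC C0 (mW n) (@sW n)) _.
  have := hN n Nn; rewrite ger0_norm ?fine_ge0// ler_pdivlMr// => h.
  apply: le_trans h; rewrite mulrC ler_wpM2l ?fine_ge0//; lra.
pose nuc : {charge set (measurableTypeR R) -> \bar R} :=
  HB.pack nu (isCharge.Build _ _ _ nu nu0 nufin nuadd).
have [P [N [[mP hP] [mN hN] PN _]]] := Hahn_decomposition nuc.
exists (P `&` low K); split.
- by apply: measurableI => //; exact: mlow.
- by move=> t [].
- move=> B mB sB; have BP : B `<=` P by move=> t /sB[].
  have := hP B mB BP; rewrite /= /nu lee_fin (_ : B `&` low K = B)//.
  by apply/setIidPl => t /sB[].
- move=> B mB sB.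
  have BN : B `<=` N.
    move=> t /sB[lt nP]; have : (P `|` N) t by rewrite PN.
    by case=> // Pt; exfalso; apply: nP.
  have := hN B mB BN; rewrite /= /nu lee_fin (_ : B `&` low K = B)//.
  by apply/setIidPl => t /sB[].
Qed.

Lemma bdd_lin_step l m (c : nat -> R) (B : nat -> set R) K :
  bdd_lin c0L1 c0L1_norm l -> (forall i, measurable (B i)) ->
  (forall i, B i `<=` low K) ->
  c0L1 (fun t => \sum_(i < m) c i * \1_(B i) t) /\
  l (fun t => \sum_(i < m) c i * \1_(B i) t) = \sum_(i < m) c i * l \1_(B i).
Proof.
move=> bl mB sB; have [lD [lZ _]] := bl.
have cB i : c0L1 \1_(B i).
  by have [] := c0L1_indic_low (mB i) (@sB i).
elim: m => [|m [c1 ih]].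
  rewrite big_ord0 (_ : (fun _ => _) = \1_set0); last first.
    by apply/funext => t; rewrite big_ord0 indicE in_set0.
  rewrite bdd_lin_indic0//; split=> //.
  by have [] := c0L1_indic_low measurable0 (@sub0set _ (low 0)).
rewrite (_ : (fun _ => _) = (fun t => \sum_(i < m) c i * \1_(B i) t +
  c m * \1_(B m) t)); last by apply/funext => t; rewrite big_ord_recr.
split; first by apply: c0L1D => //; exact: c0L1Z.
by rewrite lD//; [rewrite ih lZ// big_ord_recr|exact: c0L1Z].
Qed.

Import HBNNSimple.

(** The sign of [l] on indicators passes to nonnegative simple functions by linearity, then to [F]:
    the approximations cut to [G] converge in L^1 by dominated convergence, hence in [c0L1_norm],
    since [G] lies in finitely many blocks. *)
Lemma functional_le0 l (G : set R) F K : bdd_lin c0L1 c0L1_norm l ->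
  measurable G -> G `<=` low K ->
  (forall B, measurable B -> B `<=` G -> l \1_B <= 0) ->
  c0L1 F -> (forall t, 0 <= F t) -> l (fun t => F t * \1_G t) <= 0.
Proof.
move=> bl mG sG lG cF F0; have [mF _ _] := cF; have [lD [lZ _]] := bl.
have [C C0 lC] := bdd_lin_c0L1_bound bl.
have mFE : measurable_fun D (EFin \o F) by apply/measurable_EFinP.
pose g := nnsfun_approx mD mFE.
have gF t : D t -> (EFin \o g^~ t) @ \oo --> (F t)%:E.
  by move=> Dt; apply: (cvg_nnsfun_approx mD mFE) => // x _; rewrite lee_fin.
have gle n t : D t -> g n t <= F t.
  move=> Dt; have := gF t Dt => /fine_cvgP[_ h].
  rewrite -(cvg_lim _ h)//; apply: limr_ge; first exact: cvgP h.
  exists n => // m /= nm; have := nd_nnsfun_approx mD mFE nm.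
  by move=> /lefP/(_ t).
have g0 n t : 0 <= g n t by exact: fun_ge0.
have mg n : measurable_fun D (g n) by apply: measurable_funTS.
have cg n : c0L1 (g n).
  by apply: (c0L1_solid cF) => // t Dt; rewrite !ger0_norm// gle.
have cgG n : c0L1 (fun t => g n t * \1_G t) by apply: c0L1_cut.
have cFG : c0L1 (fun t => F t * \1_G t) by apply: c0L1_cut.
have lg n : l (fun t => g n t * \1_G t) <= 0.
  pose s := fset_set (g n @` setT).
  pose c i := if (i < #|` s|)%N then s`_i else 0.
  have c0 i : 0 <= c i.
    rewrite /c; case: ifP => // si; have := mem_nth 0 si.
    by rewrite in_fset_set// inE => -[t _ <-].
  pose B i := (g n @^-1` [set c i]) `&` G.
  have mB i : measurable (B i) by apply: measurableI.
  have sB i : B i `<=` low K by move=> t [_ /sG].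
  have := (@bdd_lin_step l #|` s| c B K bl mB sB).2.
  rewrite (_ : (fun _ => _) = (fun t => g n t * \1_G t)).
    move=> ->; apply: sumr_le0 => i _; apply: mulr_ge0_le0 => //.
    by apply: lG => // t [].
  apply/funext => t; rewrite (fimfunEord (g n) t) mulr_suml.
  apply: eq_bigr => i _; rewrite /c ltn_ord -mulrA; congr (_ * _).
  by rewrite /B indicI /= /c ltn_ord.
have sGD : G `<=` D by move=> t /sG[].
have mgG n : measurable_fun G (EFin \o g n).
  by apply/measurable_EFinP; apply: measurable_funTS.
have mFG : measurable_fun G (EFin \o F).
  exact: (measurable_funS mD sGD mFE).
have [||_ h _] := @dominated_convergence _ _ _ mu G mG (fun n => EFin \o g n)
  (EFin \o F) (EFin \o (fun x => `|F x|)) mgG mFG _ (abs_low_integrable cF mG sG).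
- by apply: aeW => t Gt; apply: gF; apply: sGD.
- apply: aeW => t n Gt /=; rewrite lee_fin !ger0_norm//.
  by apply: gle; apply: sGD.
apply/ler_addgt0Pl => e e0; rewrite addr0.
have C1 : 0 < C + 1 by rewrite ltr_wpDl.
have /fine_cvgP[[N1 _ hN1]] := h.
move=> /cvgrPdist_le/(_ _ (divr_gt0 e0 C1))[N _ hN].
pose n := maxn N1 N.
have {hN1} := hN1 n (leq_maxl _ _).
have {hN} := hN n (leq_maxr _ _); rewrite /= sub0r normrN.
rewrite ger0_norm ?fine_ge0 ?integral_ge0// => hn fin.
pose dF t := F t * \1_G t + -1 * (g n t * \1_G t).
have cdF : c0L1 dF by apply: c0L1D => //; exact: c0L1Z.
have : `|l dF| <= e.
  apply: le_trans (lC _ cdF) _.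
  apply: (@le_trans _ _ (C * (e / (C + 1)))); last first.
    by rewrite mulrCA ger_pMr// ler_pdivrMr// mul1r; lra.
  rewrite ler_wpM2l//; apply: le_trans hn.
  rewrite -lee_fin (fineK (c0L1_norm_fin cdF)) fineK//.
  apply: le_trans (c0L1_norm_le_Rint cdF mG sG _) _.
    by move=> t _ nG; rewrite /dF indicE memNset// !mulr0 addr0.
  rewrite /Rintegral fineK; last first.
    apply: integrable_fin_num => //.
    exact: integrable_norm (low_integrable cdF mG sG).
  apply: ge0_le_integral_any => t; first by rewrite lee_fin.
  move=> Gt; rewrite /dF indicE mem_set// !mulr1 mulN1r.
  by rewrite distrC.
rewrite /dF lD//; last exact: c0L1Z.
rewrite lZ// mulN1r => /(le_trans (ler_norm _)).
have := lg n; lra.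
Qed.

Lemma cut_norm_le F A K : c0L1 F -> measurable A -> A `<=` low K ->
  fine (c0L1_norm (fun t => F t * \1_A t)) <= \int[mu]_(t in A) `|F t|.
Proof.
move=> cF mA sA; have cFA := c0L1_cut cF mA.
rewrite -lee_fin (fineK (c0L1_norm_fin cFA)).
apply: le_trans (c0L1_norm_le_Rint cFA mA sA _) _.
  by move=> t _ nA; rewrite indicE memNset// mulr0.
rewrite lee_fin le_eqVlt; apply/orP; left; apply/eqP.
by apply: eq_Rintegral => t tA; rewrite indicE tA mulr1.
Qed.

(** [P1] and [P2] are positive Hahn sets of [l - d I] and [- l - d I], with [I] the integral over
    [low K]. Off both of them [|l|] is at most [d I] on nonnegative functions, by [functional_le0];
    on them only the norm bound [C] is available. *)
Lemma functional_split l (C d : R) K : bdd_lin c0L1 c0L1_norm l -> 0 <= C ->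
  0 < d -> (forall f, c0L1 f -> `|l f| <= C * fine (c0L1_norm f)) ->
  exists P1 P2, [/\ measurable P1 /\ P1 `<=` low K,
    measurable P2 /\ P2 `<=` low K,
    forall B, measurable B -> B `<=` P1 -> d * fine (mu B) <= l \1_B,
    forall B, measurable B -> B `<=` P2 -> d * fine (mu B) <= - l \1_B &
    forall F, c0L1 F -> `|l (fun t => F t * \1_(low K) t)| <=
      C * \int[mu]_(t in P1) `|F t| + C * \int[mu]_(t in P2) `|F t| +
      d * \int[mu]_(t in low K) `|F t|].
Proof.
move=> bl C0 d0 lC; have [lD [lZ _]] := bl.
pose I F := \int[mu]_(t in low K) (F t * cst 1 t).
have [bI hI] := @int_functional (low K) K (cst 1) (mlow K) (@subset_refl _ _)
  (measurable_cst _) (fun x => ltac:(by rewrite normr1)).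
have [ID [IZ _]] := bI.
have bdd_comb (a : R) : bdd_lin c0L1 c0L1_norm (fun F => a * l F - d * I F).
  have [_ [_ [C1 hC1]]] := bI.
  split; [|split].
  - by move=> f g cf cg; rewrite lD// /I ID// !mulrDr opprD addrACA.
  - by move=> b f cf; rewrite lZ// /I IZ// mulrBr !(mulrCA b).
  - exists (`|a| * C + d * K%:R) => f cf.
    rewrite -(fineK (c0L1_norm_fin cf)) -EFinM lee_fin mulrDl.
    apply: le_trans (ler_normB _ _) _; rewrite !normrM (gtr0_norm d0) lerD//.
      by rewrite -mulrA ler_wpM2l// lC.
    rewrite -mulrA ler_pM2l//; apply: le_trans (hI f cf) _.
    exact: low_Rint_le (mlow K) (@subset_refl _ _).
have Iindic B : measurable B -> B `<=` low K -> I \1_B = fine (mu B).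
  move=> mB sB; rewrite /I /Rintegral.
  under eq_integral do rewrite mulr1.
  rewrite (@integral_indic _ _ _ mu (low K) (mlow K) B mB) (_ : B `&` low K = B)//.
  exact/setIidPl.
have [P1 [mP1 sP1 P1pos P1neg]] := functional_hahn K (bdd_comb 1).
have [P2 [mP2 sP2 P2pos P2neg]] := functional_hahn K (bdd_comb (-1)).
exists P1, P2; split=> //.
- move=> B mB sB; have := P1pos B mB sB.
  by rewrite Iindic ?mul1r ?subr_ge0// => t /sB/sP1.
- move=> B mB sB; have := P2pos B mB sB.
  by rewrite Iindic ?mulN1r ?subr_ge0// => t /sB/sP2.
pose G := low K `\` (P1 `|` P2).
have mG : measurable G.
  by apply: measurableD; [exact: mlow | exact: measurableU].
have sG : G `<=` low K by move=> t [].
have Gpos H : c0L1 H -> (forall t, 0 <= H t) ->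
    `|l (fun t => H t * \1_G t)| <= d * I (fun t => H t * \1_G t).
  move=> cH H0.
  have h1 : 1 * l (fun t => H t * \1_G t) - d * I (fun t => H t * \1_G t) <= 0.
    apply: (functional_le0 (bdd_comb 1) mG sG) => // B mB sB.
    apply: P1neg => // t /sB[lt h]; split=> // P1t; apply: h; by left.
  have h2 : -1 * l (fun t => H t * \1_G t) - d * I (fun t => H t * \1_G t) <= 0.
    apply: (functional_le0 (bdd_comb (-1)) mG sG) => // B mB sB.
    apply: P2neg => // t /sB[lt h]; split=> // P2t; apply: h; by right.
  by rewrite ler_norml; apply/andP; split; lra.
move=> F cF; have [mF _ _] := cF.
(* [functional_le0] concerns nonnegative functions, so [F] is split into its positive and negative
   parts on [G]; on the other two pieces the norm bound is applied to [F] itself. *)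
pose Fp t := Num.max (F t) 0; pose Fm t := Num.max (- F t) 0.
have mFp : measurable_fun D Fp by apply: measurable_maxr.
have mFm : measurable_fun D Fm.
  by apply: measurable_maxr => //; exact: measurableT_comp.
have Fp0 t : 0 <= Fp t by rewrite le_max lexx orbT.
have Fm0 t : 0 <= Fm t by rewrite le_max lexx orbT.
have FE t : F t = Fp t - Fm t.
  by rewrite /Fp /Fm; case: (lerP 0 (F t)); case: (lerP 0 (- F t)); lra.
have absE t : `|F t| = Fp t + Fm t.
  rewrite /Fp /Fm; case: (ger0P (F t)) => ?;
    by case: (lerP 0 (F t)); case: (lerP 0 (- F t)); lra.
have cFp : c0L1 Fp.
  by apply: (c0L1_solid cF) => // t _; rewrite absE ger0_norm// lerDl.
have cFm : c0L1 Fm.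
  by apply: (c0L1_solid cF) => // t _; rewrite absE ger0_norm// lerDr.
(* The two sets come from separate Hahn decompositions, so [P1] is taken out of [P2] to make the
   pieces disjoint. *)
have mP21 : measurable (P2 `\` P1) by apply: measurableD.
have sP21 : P2 `\` P1 `<=` low K by move=> t [/sP2].
have cut1 := c0L1_cut cF mP1; have cut2 := c0L1_cut cF mP21.
have cutp := c0L1_cut cFp mG; have cutm := c0L1_cut cFm mG.
have -> : (fun t => F t * \1_(low K) t) = (fun t => F t * \1_P1 t +
    (F t * \1_(P2 `\` P1) t + (Fp t * \1_G t + -1 * (Fm t * \1_G t)))).
  apply/funext => t; rewrite mulN1r -mulrBl -FE -!mulrDr; congr (_ * _).
  rewrite !indicE /G !in_setD in_setU.
  case: (boolP (t \in P1)) => /= h1.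
    by rewrite !andbF !addr0 mem_set//; apply: sP1; rewrite inE in h1.
  case: (boolP (t \in P2)) => /= h2.
    by rewrite !andbF addr0 add0r mem_set//; apply: sP2; rewrite inE in h2.
  by rewrite andbT !add0r.
have czm : c0L1 (fun t => -1 * (Fm t * \1_G t)) by apply: c0L1Z.
rewrite lD//; last by apply: c0L1D => //; exact: c0L1D.
rewrite lD//; last exact: c0L1D.
rewrite lD// lZ// mulN1r addrA.
apply: le_trans (ler_normD _ _) _; apply: lerD.
  apply: le_trans (ler_normD _ _) _; apply: lerD.
    apply: le_trans (lC _ cut1) _; rewrite ler_wpM2l//.
    exact: cut_norm_le sP1.
  apply: le_trans (lC _ cut2) _; rewrite ler_wpM2l//.
  apply: le_trans (cut_norm_le cF mP21 sP21) _.
  rewrite -(setUIDK P2 P1) [leRHS]Rintegral_setU//.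
  - by rewrite setUIDK lerDr Rintegral_ge0.
  - exact: measurableI.
  - by rewrite setUIDK; apply: (abs_low_integrable cF mP2 sP2).
  - by apply/disj_setPS => t [[_ h1] [_ /= /(_ h1)]].
apply: le_trans (ler_normB _ _) _.
apply: le_trans (lerD (Gpos _ cFp Fp0) (Gpos _ cFm Fm0)) _.
rewrite -mulrDr ler_pM2l// /I -ID//.
apply: le_Rintegral.
- exact: mlow.
- have [cc _] : c0L1 (fun t => (Fp t * \1_G t + Fm t * \1_G t) * 1) /\ True.
    by split=> //; under eq_fun do rewrite mulr1; exact: c0L1D.
  exact: low_integrable cc (mlow K) (@subset_refl _ _).
- exact: abs_low_integrable cF (mlow K) (@subset_refl _ _).
- by move=> t _; rewrite mulr1 -mulrDl -absE ler_piMr// indicE.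
Qed.

(** Compactness of the segment gives a cluster point, and an ultrafilter converges to each of its
    cluster points. *)
Lemma ultrafilter_cvg (U : set_system nat) (u : nat -> R) (M : R) :
  UltraFilter U -> (forall n, `|u n| <= M) -> cvg (u @ U).
Proof.
move=> ultraU uM.
have uI : (u @ U) [set` `[- M, M]].
  by apply: (@filterE _ U) => n /=; rewrite in_itv/= -ler_norml.
have [p [_ clp]] := segment_compact (fmap_proper_filter u _) uI.
apply/cvg_ex; exists p => V Vp.
have [//|h] := @in_ultra_setVsetC _ U (u @^-1` V) ultraU.
by have [t [nVt Vt]] := clp (~` V) V h Vp; exfalso; apply: nVt.
Qed.

(** * The dual norm, elements of the bidual, and weakly null functionals on finitely many blocks *)

Local Notation dual := (bdd_lin c0L1 c0L1_norm).
Local Notation dual_norm := (dnorm c0L1 c0L1_norm).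

Lemma c0L1_0 : c0L1 (fun _ => 0).
Proof.
have [h _] := c0L1_indic_low measurable0 (@sub0set _ (low 0)).
by have := c0L1Z 0 h; under eq_fun do rewrite mul0r.
Qed.

Lemma c0L1_norm0 : c0L1_norm (fun _ => 0) = 0%E.
Proof.
apply/eqP; rewrite eq_le c0L1_norm_ge0 andbT; apply: c0L1_norm_le => k.
by rewrite /block_int integral0_eq// => x _; rewrite normr0.
Qed.

Lemma dual_norm_ge0 l : (0 <= dual_norm l)%E.
Proof.
apply: (@le_trans _ _ (`|l (fun _ => 0)|)%:E); first by rewrite lee_fin.
apply: ereal_sup_ubound; exists (fun _ => 0) => //; split; first exact: c0L1_0.
by rewrite c0L1_norm0.
Qed.

Lemma dual_norm_fin l : dual l -> dual_norm l \is a fin_num.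
Proof.
move=> bl; have [C C0 lC] := bdd_lin_c0L1_bound bl.
rewrite ge0_fin_numE ?dual_norm_ge0//; apply: (@le_lt_trans _ _ C%:E); last exact: ltry.
apply: ge_ereal_sup => _ [f [cf nf] <-]; rewrite lee_fin.
apply: le_trans (lC f cf) _; rewrite ler_piMr//.
by rewrite -lee_fin (fineK (c0L1_norm_fin cf)).
Qed.

Lemma dual_norm_bound l f : dual l -> c0L1 f -> (c0L1_norm f <= 1)%E ->
  `|l f| <= fine (dual_norm l).
Proof.
move=> bl cf nf; rewrite -lee_fin (fineK (dual_norm_fin bl)).
by apply: ereal_sup_ubound; exists f.
Qed.

Lemma dual_norm_le l f : dual l -> c0L1 f ->
  `|l f| <= fine (dual_norm l) * fine (c0L1_norm f).
Proof.
move=> bl cf; have [mf _ _] := cf; have [_ [lZ _]] := bl.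
have [C C0 lC] := bdd_lin_c0L1_bound bl.
(* A function of norm 0 cannot be normalised; in that case the crude bound gives [l f = 0]. *)
have := fine_ge0 (c0L1_norm_ge0 f); rewrite le_eqVlt => /orP[/eqP h|h].
  by have := lC f cf; rewrite -h !mulr0.
have := @dual_norm_bound l (fun t => (fine (c0L1_norm f))^-1 * f t) bl (c0L1Z _ cf).
rewrite lZ// normrM gtr0_norm ?invr_gt0// mulrC ler_pdivrMr//; apply.
apply: le_trans (c0L1_normZ _ mf) _.
rewrite -(fineK (c0L1_norm_fin cf)) -EFinM lee_fin gtr0_norm ?invr_gt0//.
by rewrite mulVf// gt_eqF.
Qed.

Lemma dual_eval f (a : R) : c0L1 f -> bdd_lin dual dual_norm (fun l => a * l f).
Proof.
move=> cf; split; [|split].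
- by move=> l l' _ _; rewrite mulrDr.
- by move=> b l _; rewrite mulrCA.
- exists (`|a| * fine (c0L1_norm f)) => l bl.
  rewrite -(fineK (dual_norm_fin bl)) -EFinM lee_fin normrM -mulrA.
  by rewrite ler_wpM2l// mulrC dual_norm_le.
Qed.

Lemma dual_weakly_null_bounded xs : (forall n, dual (xs n)) ->
  weakly_null dual dual_norm xs ->
  exists2 M, 0 < M & forall n, fine (dual_norm (xs n)) <= M.
Proof.
move=> Sx; apply: weakly_null_bounded => //.
- exact: dual_norm_fin.
- by move=> l _; exact: dual_norm_ge0.
move=> l c bl.
rewrite -lte_fin (fineK (dual_norm_fin bl)) => /ereal_sup_gt[_ [f [cf nf] <-]].
(* Evaluation at an element of the unit ball where [l] exceeds [c] is the norming functional on the
   dual. *)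
rewrite lte_fin => h; exists (fun l => 1 * l f); split.
- exact: dual_eval.
- by move=> l' bl'; rewrite mul1r dual_norm_bound.
- by rewrite mul1r.
Qed.

(* If mu(P_n) did not tend to 0, infinitely many of the P_n would have all
   finite intersections B_m of positive measure; an ultrafilter limit of the
   averages over B_m is an element of the bidual that is at least d on these
   functionals. *)
Lemma weakly_null_functional_sets xs (P : nat -> set R) (d : R) K :
  (forall n, dual (xs n)) -> weakly_null dual dual_norm xs ->
  (forall n, measurable (P n)) -> (forall n, P n `<=` low K) -> 0 < d ->
  (forall n B, measurable B -> B `<=` P n -> d * fine (mu B) <= xs n \1_B) ->
  vanishes (fun n => fine (mu (P n))).
Proof.
move=> Sx wx mP sP d0 hP; apply: contrapT => /not_vanishes[e e0 he].
have /choice[s hs] : forall k, exists n, (k <= n)%N /\ (e%:E < mu (P n))%E.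
  move=> k; have [n kn] := he k; rewrite ger0_norm ?fine_ge0// => h.
  by exists n; split=> //; rewrite -(fineK (mu_low_fin (mP n) (@sP n))) lte_fin.
(* The intersection of these sets is the upper limit of the [P (s j)]; it has measure at least [e]
   because the ambient measure is finite. *)
pose Tl n := \bigcup_(j in [set j | (n <= j)%N]) P (s j).
have mTl n : measurable (Tl n) by apply: bigcup_measurable.
have sTl n : Tl n `<=` low K by move=> t [j _ /sP].
have muW : (e%:E <= mu (\bigcap_n Tl n))%E.
  have : mu (Tl n) @[n --> \oo] --> mu (\bigcap_n Tl n).
    apply: nonincreasing_cvg_mu => //.
    - exact: mu_low_lty (mTl 0%N) (@sTl 0%N).
    - by apply: bigcapT_measurable => n; exact: mTl.
    - move=> m n mn; apply/subsetPset => t [i /= im Fi].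
      by exists i => //=; apply: leq_trans mn im.
  move=> hc; rewrite -(cvg_lim _ hc)//; apply: lime_ge; first exact: cvgP hc.
  apply: nearW => n; apply: ltW; have [_ h] := hs n; apply: lt_le_trans h _.
  by apply: le_lebesgue_measure => // t Pt; exists n => /=.
pose cap (q : seq nat) := foldr (fun k A => P (s k) `&` A) (low K) q.
have mcap q : measurable (cap q).
  by elim: q => [|k q ih]; [exact: mlow | exact: measurableI].
have scap q : cap q `<=` low K.
  by elim: q => // k q ih t [_ /ih].
(* There are countably many finite intersections, enumerated by [choice.pickle], so the null ones
   have a negligible union. A point [x] of the upper limit outside that union lies in infinitely
   many of the sets, and each finite intersection containing [x] has positive measure. *)
pose Zs n := if @choice.unpickle (seq nat) n is Some q then
  (if mu (cap q) == 0%E then cap q else set0) else set0.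
have negZ : mu.-negligible (\bigcup_n Zs n).
  apply: negligible_bigcup => n; rewrite /Zs.
  case: (choice.unpickle n) => [q|]; last exact: negligible_set0.
  case: eqP => h; last exact: negligible_set0.
  by exists (cap q); split=> //; exact: mcap.
have [x Wx nZx] : exists2 x, (\bigcap_n Tl n) x & ~ (\bigcup_n Zs n) x.
  apply: contrapT => /forall2NP h.
  have sub : \bigcap_n Tl n `<=` \bigcup_n Zs n.
    by move=> t Wt; have [] // := h t => /contrapT.
  have mcW : measurable (\bigcap_n Tl n) by apply: bigcapT_measurable.
  have [N0 [mN0 muN0 sN0]] := negZ.
  have := le_lebesgue_measure mcW mN0 (subset_trans sub sN0).
  by rewrite muN0 leNgt (lt_le_trans _ muW).
have lowx : low K x by have [j _ /sP] := Wx 0%N I.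
pose q m := [seq k <- iota 0 m | `[< P (s k) x >]].
pose B m := cap (q m).
have posB m : 0 < fine (mu (B m)).
  have Bx : B m x.
    rewrite /B; have : all (fun k => `[< P (s k) x >]) (q m) by exact: filter_all.
    by elim: (q m) => //= k r ih /andP[/asboolP Pk /ih].
  have : mu (B m) != 0%E.
    apply/negP => h; apply: nZx; exists (choice.pickle (q m)) => //.
    by rewrite /Zs choice.pickleK h.
  by move=> h; rewrite fine_gt0// lt0e h measure_ge0 (mu_low_lty (mcap _) (@scap _)).
have BP k m : (k < m)%N -> P (s k) x -> B m `<=` P (s k).
  move=> km Pk; have : k \in q m.
    by rewrite mem_filter mem_iota add0n km !andbT; apply/asboolP.
  rewrite /B; elim: (q m) => // i r ih; rewrite inE => /orP[/eqP <-|/ih h] t [].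
    by [].
  by move=> _ /h.
(* Along an ultrafilter refining the tails all the bounded sequences [v l] converge at once, so the
   limit is linear in [l]. *)
have [U [ultraU subU]] := ultraFilterLemma (@eventually_filter).
pose v (l : (R -> R) -> R) m : R := l \1_(B m) / fine (mu (B m)).
have vle l m : dual l -> `|v l m| <= fine (dual_norm l).
  move=> bl; have [_ [lZ _]] := bl.
  have [cB nB] := c0L1_indic_low (mcap (q m)) (@scap _).
  have [mB _ _] := cB.
  rewrite /v mulrC -lZ//; apply: dual_norm_bound => //; first exact: c0L1Z.
  apply: le_trans (c0L1_normZ _ mB) _.
  apply: (@le_trans _ _ (`|(fine (mu (B m)))^-1|%:E * mu (B m))%E).
    by apply: lee_wpmul2l => //; rewrite lee_fin.
  rewrite -[X in (_ * X)%E](fineK (mu_low_fin (mcap (q m)) (@scap _))).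
  by rewrite -EFinM lee_fin gtr0_norm ?invr_gt0// mulVf// gt_eqF.
have cv l : dual l -> cvg (v l @ U).
  by move=> bl; apply: (ultrafilter_cvg ultraU (fun m => vle l m bl)).
pose Phi l := lim (v l @ U).
have bPhi : bdd_lin dual dual_norm Phi.
  split; [|split].
  - move=> l l' bl bl'; rewrite /Phi; apply/cvg_lim => //.
    rewrite (_ : v _ = (fun m => v l m + v l' m)).
      by apply: cvgD; exact: cv.
    by apply/funext => m; rewrite /v mulrDl.
  - move=> a l bl; rewrite /Phi; apply/cvg_lim => //.
    rewrite (_ : v _ = (fun m => a * v l m)).
      by apply: cvgM; [exact: cvg_cst | exact: cv].
    by apply/funext => m; rewrite /v mulrA.
  - exists 1 => l bl; rewrite mul1e -(fineK (dual_norm_fin bl)) lee_fin.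
    have hc : (fun m => `|v l m|) @ U --> `|Phi l| by apply: cvg_norm; exact: cv.
    apply: (cvgr_to_le hc); apply: filterE => m; exact: vle.
have wx' : weakly_null dual dual_norm (xs \o s).
  by apply: weakly_null_subseq wx => n; have [] := hs n.
have d2 : 0 < d / 2 by rewrite divr_gt0.
have [N hN] := wx' _ bPhi _ d2.
have [k /= Nk Pk] := Wx N I.
(* For [m > k] the set [B m] lies inside [P (s k)], so the averages over it are at least [d]. *)
have : d <= Phi (xs (s k)).
  apply: limr_ge; first exact: cv.
  apply: subU; exists k.+1 => // m /= km.
  rewrite /v ler_pdivlMr//; apply: hP; first exact: mcap.
  exact: BP.
have := le_trans (ler_norm _) (hN k Nk); rewrite /=; lra.
Qed.

Lemma core_vanishes x xs K : (forall n, c0L1 (x n)) ->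
  weakly_null c0L1 c0L1_norm x -> (forall n, dual (xs n)) ->
  weakly_null dual dual_norm xs ->
  vanishes (fun n => xs n (fun t => x n t * \1_(low K) t)).
Proof.
move=> Sx wx Sxs wxs e e0.
have [M M0 hM] := c0L1_weakly_null_bounded Sx wx.
have [C C0 hC] := dual_weakly_null_bounded Sxs wxs.
have lC n f : c0L1 f -> `|xs n f| <= C * fine (c0L1_norm f).
  move=> cf; apply: le_trans (dual_norm_le (Sxs n) cf) _.
  by rewrite ler_wpM2r ?fine_ge0 ?c0L1_norm_ge0.
(* On [low K] the L^1 norm of [x n] is at most [K * M], so the term with [d] costs at most [e / 2];
   the two exceptional sets will cost [e / 4] each. *)
pose d := e / 2 / (K%:R * M + 1).
have KM : 0 < K%:R * M + 1 by rewrite ltr_wpDl// mulr_ge0// ltW.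
have d0 : 0 < d by rewrite !divr_gt0.
have /choice[P1 /choice[P2 hP]] := fun n =>
  functional_split K (Sxs n) (ltW C0) d0 (lC n).
have mP1 n : measurable (P1 n) by have [[]] := hP n.
have sP1 n : P1 n `<=` low K by have [[]] := hP n.
have mP2 n : measurable (P2 n) by have [_ []] := hP n.
have sP2 n : P2 n `<=` low K by have [_ []] := hP n.
have v1 : vanishes (fun n => fine (mu (P1 n))).
  apply: (weakly_null_functional_sets Sxs wxs mP1 sP1 d0) => n.
  by have [] := hP n.
(* The second set plays the role of the first one for [- xs n], which is again weakly null. *)
have v2 : vanishes (fun n => fine (mu (P2 n))).
  apply: (@weakly_null_functional_sets (fun n f => -1 * xs n f) _ d K) => //.
  - move=> n; have [lD [lZ [c hc]]] := Sxs n; split; [|split].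
    + by move=> f g cf cg; rewrite lD// mulrDr.
    + by move=> a f cf; rewrite lZ// mulrCA.
    + by exists c => f cf; rewrite mulN1r normrN; exact: hc.
  - move=> Phi bPhi; have [_ [PZ _]] := bPhi.
    move=> e' e0'; have [N hN] := wxs _ bPhi _ e0'; exists N => n Nn.
    by rewrite PZ// mulN1r normrN; exact: hN.
  - by move=> n B mB sB; rewrite mulN1r; have [_ _ _ ->] := hP n.
have e8 : 0 < e / 4 / C by rewrite !divr_gt0.
have [N1 h1] := weakly_null_uniform_int Sx wx mP1 sP1 v1 e8.
have [N2 h2] := weakly_null_uniform_int Sx wx mP2 sP2 v2 e8.
exists (maxn N1 N2) => n; rewrite geq_max => /andP[n1 n2].
have [_ _ _ _ /(_ _ (Sx n))/le_trans] := hP n; apply.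
have := h1 n n1; rewrite ger0_norm ?Rintegral_ge0// ler_pdivlMr// mulrC => {}h1.
have := h2 n n2; rewrite ger0_norm ?Rintegral_ge0// ler_pdivlMr// mulrC => {}h2.
have h3 : d * \int[mu]_(t in low K) `|x n t| <= e / 2.
  apply: (@le_trans _ _ (d * (K%:R * M + 1))); last by rewrite divfK ?gt_eqF.
  rewrite ler_pM2l//.
  apply: le_trans (low_Rint_le (Sx n) (mlow K) (@subset_refl _ _)) _.
  by apply: (@le_trans _ _ (K%:R * M)); [rewrite ler_wpM2l | rewrite lerDl].
lra.
Qed.

(** * Gliding hump over groups of blocks *)

Lemma tail_cut_small F (e : R) : c0L1 F -> 0 < e -> exists K, forall M,
  (K <= M)%N -> fine (c0L1_norm (fun t => F t * \1_(~` low M) t)) <= e.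
Proof.
move=> cF e0; have [mF _ hF] := cF; have [K hK] := hF e e0; exists K => M KM.
have mC : measurable (~` low M) by apply: measurableC; exact: mlow.
rewrite -lee_fin (fineK (c0L1_norm_fin (c0L1_cut cF mC))).
apply: c0L1_norm_le => k; have [kM|Mk] := ltnP k M.
  rewrite /block_int integral0_eq ?lee_fin ?ltW// => t [Dt /= kt].
  by rewrite indicE memNset ?mulr0 ?normr0//; apply; split=> //=; rewrite kt.
apply: le_trans (hK k (leq_trans KM Mk)).
by apply: block_int_homo => t _; exact: cut_le.
Qed.

(** A block meets at most one of the cuts, so a signed sum of them has norm at most [M] whatever the
    number of terms. This feature of sup norms makes the evaluations at the cuts an unconditional
    series on the dual. *)
Lemma sum_disjoint_cuts (x : nat -> R -> R) (k : nat -> nat) (c : nat -> R)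
    (M : R) l J :
  let y j t := x j t * \1_(low (k j.+1) `\` low (k j)) t in
  (forall j, (k j < k j.+1)%N) -> (forall j, c0L1 (x j)) ->
  (forall j, fine (c0L1_norm (x j)) <= M) -> 0 <= M ->
  (forall j, `|c j| <= 1) -> dual l ->
  let Y t := \sum_(j < J) c j * y j t in
  [/\ c0L1 Y, fine (c0L1_norm Y) <= M & l Y = \sum_(j < J) c j * l (y j)].
Proof.
move=> y hk cx hM M0 c1 bl Y; have [lD [lZ _]] := bl.
have mk j : measurable (low (k j.+1) `\` low (k j)) by apply: measurableD; exact: mlow.
have cy j : c0L1 (y j) by apply: c0L1_cut.
have [cY lY] : c0L1 Y /\ l Y = \sum_(j < J) c j * l (y j).
  rewrite /Y {Y}; elim: J => [|J [ih1 ih2]].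
    have -> : (fun t => \sum_(j < 0) c j * y j t) = (fun _ => 0).
      by apply/funext => t; rewrite big_ord0.
    split; first exact: c0L1_0.
    by rewrite big_ord0; have := lZ 0 _ c0L1_0; rewrite !mul0r.
  have -> : (fun t => \sum_(j < J.+1) c j * y j t) =
      (fun t => \sum_(j < J) c j * y j t + c J * y J t).
    by apply/funext => t; rewrite big_ord_recr.
  have cZ : c0L1 (fun t => c J * y J t) by apply: c0L1Z.
  by split; [exact: c0L1D | rewrite lD// ih2 lZ// big_ord_recr].
split=> //; rewrite -lee_fin (fineK (c0L1_norm_fin cY)).
apply: c0L1_norm_le => m.
have off j t : block m t -> ~ (k j <= m < k j.+1)%N -> y j t = 0.
  move=> [Dt /= kt] nm; rewrite /y indicE memNset ?mulr0// => -[[_ /= h1] h2].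
  apply: nm; rewrite -kt h1 andbT leqNgt; apply/negP => h; apply: h2.
  by split.
have [[i im]|ni] := pselect (exists i, (k i <= m < k i.+1)%N); last first.
  rewrite /block_int integral0_eq ?lee_fin// => t bt.
  rewrite /Y big1 ?normr0// => j _; rewrite (off j t bt) ?mulr0// => h.
  by apply: ni; exists j.
apply: (@le_trans _ _ (block_int (x i) m)); last first.
  apply: le_trans (block_int_le_norm _ _) _.
  by rewrite -(fineK (c0L1_norm_fin (cx i))) lee_fin.
rewrite /block_int; apply: ge0_le_integral_any => t; first by rewrite lee_fin.
move=> bt; rewrite lee_fin /Y.
have off' j : j != i -> c j * y j t = 0.
  move=> ji; rewrite (off j t bt) ?mulr0// => h.
  by rewrite (incr_block_inj hk h im) eqxx in ji.
have [iJ|Ji] := ltnP i J; last first.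
  rewrite big1 ?normr0// => j _; apply: off'.
  by rewrite neq_ltn (leq_trans (ltn_ord j) Ji).
rewrite (bigD1 (Ordinal iJ))//= big1 ?addr0; last first.
  by move=> j ji; apply: off'; apply: contraNneq ji => ji; apply/eqP/val_inj.
rewrite normrM; apply: le_trans (ler_piMl (normr_ge0 _) (c1 i)) _.
exact: cut_le.
Qed.

Theorem c0L1_DunfordPettis : DunfordPettis c0L1 c0L1_norm.
Proof.
move=> x xs Sx Sxs wx' wxs'.
have wx : weakly_null c0L1 c0L1_norm x by move=> L /wx'/vanishesP.
have wxs : weakly_null dual dual_norm xs by move=> L /wxs'/vanishesP.
apply/vanishesP; apply: contrapT => /not_vanishes[e e0 he].
have [M M0 hM] := c0L1_weakly_null_bounded Sx wx.
have e4 : 0 < e / 4 by rewrite divr_gt0.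
(* [xs n] is large on [x n], but small on its part in the first [K] blocks, by [core_vanishes], and
   on its part beyond the first [M] blocks, by the decay of [x n]; more than [e / 2] is left for the
   middle part. *)
pose P K n M := [/\ e < `|xs n (x n)|,
  `|xs n (fun t => x n t * \1_(low K) t)| <= e / 4 &
  `|xs n (fun t => x n t * \1_(~` low M) t)| <= e / 4].
have /gliding_hump[n [k [hn hk hP]]] : forall K n0, exists n M,
    [/\ (n0 <= n)%N, (K < M)%N & P K n M].
  move=> K n0; have [N hN] := core_vanishes K Sx wx Sxs wxs e4.
  have [n] := he (maxn n0 N); rewrite geq_max => /andP[n0n Nn] hen.
  have [C C0 lC] := bdd_lin_c0L1_bound (Sxs n).
  have C1 : 0 < C + 1 by rewrite ltr_wpDl.
  have [K' hK'] := tail_cut_small (Sx n) (divr_gt0 e4 C1).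
  exists n, (maxn K' K.+1); split=> //; first by rewrite leq_maxr.
  split=> //; first exact: hN.
  have mC A : measurable A -> measurable (~` A) by exact: measurableC.
  apply: le_trans (lC _ (c0L1_cut (Sx n) (mC _ (mlow _)))) _.
  apply: (@le_trans _ _ (C * (e / 4 / (C + 1)))).
    by rewrite ler_wpM2l// hK'// leq_maxl.
  by rewrite mulrCA ger_pMr// ler_pdivrMr// mul1r; lra.
pose y j t := x (n j) t * \1_(low (k j.+1) `\` low (k j)) t.
have mk j : measurable (low (k j.+1) `\` low (k j)) by apply: measurableD; exact: mlow.
have cy j : c0L1 (y j) by apply: c0L1_cut.
(* The roles are exchanged: the weakly null sequence is [xs \o n], in the dual, and the functionals
   are evaluations at the middle parts [y j]. Choosing the signs of [l (y j)] turns the sum of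
   absolute values into [l] of a single element of norm at most [M]. *)
have := @weakly_null_unconditional R _ dual dual_norm dual_norm_fin
  (fun j l => 1 * l (y j)) M (xs \o n).
case/(_ _ _ _ _ _ e4).
- by move=> j; apply: dual_eval.
- move=> l bl J.
  have c1 j : `|Num.sg (l (y j))| <= 1 by exact: sg_le1.
  have [cY nY lY] := @sum_disjoint_cuts (x \o n) k (fun j => Num.sg (l (y j))) M l
    J hk (fun j => Sx (n j)) (fun j => hM (n j)) (ltW M0) c1 bl.
  have -> : \sum_(i < J) `|1 * l (y i)| = \sum_(j < J) Num.sg (l (y j)) * l (y j).
    by apply: eq_bigr => j _; rewrite mul1r -normrEsg.
  rewrite -lY; apply: le_trans (ler_norm _) _.
  apply: le_trans (dual_norm_le bl cY) _; rewrite mulrC.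
  by apply: ler_wpM2r => //; apply: fine_ge0; exact: dual_norm_ge0.
- by move=> j; apply: Sxs.
- exact: weakly_null_subseq (incr_ge hn) wxs.
move=> j /(_ j (leqnn j)); rewrite /= mul1r => h.
have [h1 h2 h3] := hP j; have [lD _] := Sxs (n j).
have mC A : measurable A -> measurable (~` A) by exact: measurableC.
have c1 := c0L1_cut (Sx (n j)) (mlow (k j)).
have c2 := c0L1_cut (Sx (n j)) (mC _ (mlow (k j.+1))).
move: h1; have -> : x (n j) = (fun t => x (n j) t * \1_(low (k j)) t +
    (y j t + x (n j) t * \1_(~` low (k j.+1)) t)).
  apply/funext => t; rewrite /y -!mulrDr -[LHS]mulr1; congr (_ * _).
  rewrite !indicE in_setD in_setC.
  have sub : t \in low (k j) -> t \in low (k j.+1).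
    rewrite !inE => -[Dt /= ht]; split=> //=.
    exact: leq_trans ht (ltnW (hk j)).
  case: (boolP (t \in low (k j))) => [/sub ->|_] /=; first by rewrite !addr0.
  by case: (t \in low (k j.+1)); rewrite /= add0r ?addr0 ?add0r.
rewrite lD//; last exact: c0L1D.
rewrite lD// => h1.
have := le_trans (ltW h1) (le_trans (ler_normD _ _)
  (lerD (lexx _) (ler_normD _ _))); lra.
Qed.

End BlockL1.

(** Multiplication by [v] is an isomorphism of the two spaces, and functionals are carried over by
    composing with division by [v]. An element [Phi] of the second bidual is pulled back along this
    map; its boundedness rests on the comparison [dle] of the dual norms. *)
Lemma DunfordPettis_transfer (R : realType) (S1 S2 : (R -> R) -> Prop)
    (N1 N2 : (R -> R) -> \bar R) (v : R -> R) (C : R) :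
  0 < C -> (forall x, v x != 0) ->
  (forall f, S1 f <-> S2 (fun x => f x * v x)) ->
  (forall a f, S2 f -> S2 (fun x => a * f x)) ->
  (forall a f, S2 f -> (N2 (fun x => a * f x)%R <= `|a|%:E * N2 f)%E) ->
  S2 (fun _ => 0) -> N2 (fun _ => 0) = 0%E -> (forall f, (0 <= N1 f)%E) ->
  (forall f, S1 f -> (N1 f <= C%:E * N2 (fun x => f x * v x)%R)%E) ->
  (forall f, S1 f -> (N2 (fun x => f x * v x)%R <= C%:E * N1 f)%E) ->
  (forall f, (0 <= N2 f)%E) ->
  DunfordPettis S2 N2 -> DunfordPettis S1 N1.
Proof.
move=> C0 v0 S12 S2Z N2Z S20 N20 N1ge N12 N21 N2ge DP x xs Sx Sxs wx wxs.
have mv f : (fun y => f y / v y * v y) = f.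
  by apply/funext => y; rewrite divfK.
have mv' f : (fun y => f y * v y / v y) = f.
  by apply/funext => y; rewrite mulfK.
have S21 f : S2 f -> S1 (fun y => f y / v y) by move=> Sf; apply/S12; rewrite mv.
have push l : bdd_lin S1 N1 l -> bdd_lin S2 N2 (fun f => l (fun y => f y / v y)).
  move=> [lD [lZ [c hc]]]; split; [|split].
  - move=> f g Sf Sg; rewrite -lD; [|exact: S21..].
    by congr l; apply/funext => y; rewrite mulrDl.
  - move=> a f Sf; rewrite -lZ; last exact: S21.
    by congr l; apply/funext => y; rewrite mulrA.
  - exists (`|c| * C) => f Sf; apply: le_trans (hc _ (S21 f Sf)) _.
    apply: (@le_trans _ _ (`|c|%:E * N1 (fun y => f y / v y)%R)%E).
      by apply: lee_wpmul2r; rewrite ?N1ge// lee_fin ler_norm.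
    rewrite EFinM -muleA; apply: lee_wpmul2l; first by rewrite lee_fin.
    by apply: le_trans (N12 _ (S21 f Sf)) _; rewrite mv.
have pull l : bdd_lin S2 N2 l -> bdd_lin S1 N1 (fun f => l (fun y => f y * v y)).
  move=> [lD [lZ [c hc]]]; split; [|split].
  - move=> f g /S12 Sf /S12 Sg; rewrite -lD//.
    by congr l; apply/funext => y; rewrite mulrDl.
  - move=> a f /S12 Sf; rewrite -lZ//.
    by congr l; apply/funext => y; rewrite mulrA.
  - exists (`|c| * C) => f Sf; have Sf2 : S2 (fun y => f y * v y) by apply/S12.
    apply: le_trans (hc _ Sf2) _.
    apply: (@le_trans _ _ (`|c|%:E * N2 (fun y => f y * v y)%R)%E).
      by apply: lee_wpmul2r; rewrite ?N2ge// lee_fin ler_norm.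
    rewrite EFinM -muleA; apply: lee_wpmul2l; first by rewrite lee_fin.
    exact: N21.
have dle l : bdd_lin S1 N1 l ->
    (dnorm S2 N2 (fun f => l (fun y => (f y / v y)%R)) <=
    C%:E * dnorm S1 N1 l)%E.
  move=> [lD [lZ _]]; apply: ge_ereal_sup => _ [f [Sf Nf] <-].
  (* Shrinking by [C^-1] brings the preimage of [f] into the unit ball of the first space. *)
  have SC := S2Z C^-1 f Sf.
  have -> : l (fun y => f y / v y) = C * l (fun y => C^-1 * f y / v y).
    rewrite -lZ; last exact: (S21 _ SC).
    by congr l; apply/funext => y; rewrite !mulrA mulfV ?mul1r ?gt_eqF.
  rewrite normrM gtr0_norm// EFinM; apply: lee_wpmul2l; first by rewrite lee_fin ltW.
  apply: ereal_sup_ubound; exists (fun y => C^-1 * f y / v y) => //; split.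
    exact: (S21 _ SC).
  apply: le_trans (N12 _ (S21 _ SC)) _; rewrite (mv (fun y => C^-1 * f y)).
  apply: (@le_trans _ _ (C%:E * (C^-1%:E * N2 f))%E).
    apply: lee_wpmul2l; first by rewrite lee_fin ltW.
    by have := N2Z C^-1 f Sf; rewrite gtr0_norm ?invr_gt0.
  by rewrite muleA -EFinM mulfV ?gt_eqF// mul1e.
have := DP (fun n y => x n y * v y) (fun n f => xs n (fun y => f y / v y)).
have -> : (fun n => xs n (fun y => x n y * v y / v y)) = (fun n => xs n (x n)).
  by apply/funext => n; rewrite mv'.
apply.
- by move=> n; apply/S12.
- by move=> n; exact: push.
- by move=> L bL; exact: (wx _ (pull L bL)).
move=> Phi [PD [PZ [c hc]]].
apply: (wxs (fun l => Phi (fun f => l (fun y => f y / v y)))); split; [|split].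
- by move=> l l' bl bl'; rewrite -PD//; exact: push.
- by move=> a l bl; rewrite -PZ//; exact: push.
- exists (`|c| * C) => l bl; apply: le_trans (hc _ (push l bl)) _.
  have dge : (0 <= dnorm S2 N2 (fun f => l (fun y => (f y / v y)%R)))%E.
    apply: (@le_trans _ _ (`|l (fun y => 0 / v y)|%:E)); first by rewrite lee_fin.
    by apply: ereal_sup_ubound; exists (fun _ => 0) => //; split=> //; rewrite N20.
  apply: (@le_trans _ _ (`|c|%:E * dnorm S2 N2 (fun f => l (fun y => (f y / v y)%R)))%E).
    by apply: lee_wpmul2r => //; rewrite lee_fin ler_norm.
  rewrite EFinM -muleA; apply: lee_wpmul2l; first by rewrite lee_fin.
  exact: dle.
Qed.

(** * The Cesaro-Marcinkiewicz norm *)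

Lemma monotone_on_itv_measurable (R : realType) (I : set R) (f : R -> R) :
  is_interval I -> (forall x y, I x -> I y -> x <= y -> f x <= f y) ->
  measurable_fun I f.
Proof.
move=> iI f_nd; apply: (measurability (@RGenCInfty.G R)) => [|/= _ [_] [r] -> <-].
  exact: RGenCInfty.measurableE.
apply: is_interval_measurable => s t/= [Is]; rewrite in_itv/= andbT => fs [It].
rewrite in_itv/= andbT => ft u /andP[su ut].
have Iu : I u by apply: (iI s t) => //; rewrite su ut.
by split=> //=; rewrite in_itv/= andbT (le_trans fs)// f_nd.
Qed.

Lemma antitone_on_itv_measurable (R : realType) (I : set R) (f : R -> R) :
  is_interval I -> (forall x y, I x -> I y -> x <= y -> f y <= f x) ->
  measurable_fun I f.
Proof.
move=> iI f_ni; rewrite -(opprK f); apply/measurable_funN.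
by apply: monotone_on_itv_measurable => // x y Ix Iy xy; rewrite lerN2 f_ni.
Qed.

Lemma nneseries_le (R : realType) (u : nat -> \bar R) (c : \bar R) :
  (forall n, (0 <= u n)%E) -> (forall m, (\sum_(0 <= k < m) u k <= c)%E) ->
  (\sum_(0 <= k <oo) u k <= c)%E.
Proof.
by move=> u0 h; apply: lime_le; [exact: is_cvg_nneseries | exact: nearW].
Qed.

Lemma nneseries_ge_term (R : realType) (u : nat -> \bar R) k :
  (forall n, (0 <= u n)%E) -> (u k <= \sum_(0 <= k <oo) u k)%E.
Proof.
move=> u0; apply: (@le_trans _ _ (\sum_(0 <= i < k.+1) u i)%E).
  by rewrite big_nat_recr//= leeDr// sume_ge0.
exact: nneseries_lim_ge.
Qed.

Lemma lebesgue_measureU (R : realType) (A B : set R) : measurable A ->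
  measurable B -> (lebesgue_measure (A `|` B) <=
    lebesgue_measure A + lebesgue_measure B)%E.
Proof. by move=> mA mB; apply: measureU2. Qed.

(** * Concave functions with index below 1 *)

Section ConcaveWeight.
Variables (R : realType) (phi : R -> R).
Local Notation mu := (@lebesgue_measure R).
Implicit Types (a d s t x y A C : R) (k : nat).
Hypothesis phi0 : phi 0 = 0.
Hypothesis phi_gt0 : forall t : R, 0 < t <= 1 -> 0 < phi t.
Hypothesis phi_homo : forall x y : R, 0 <= x -> x <= y -> y <= 1 -> phi x <= phi y.
Hypothesis phi_concave : forall x y a : R, 0 <= x <= 1 -> 0 <= y <= 1 ->
  0 <= a <= 1 -> (1 - a) * phi x + a * phi y <= phi ((1 - a) * x + a * y).

Lemma phi_scale a y : 0 <= a <= 1 -> 0 <= y <= 1 -> a * phi y <= phi (a * y).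
Proof.
move=> a01 y01; have := @phi_concave 0 y a _ y01 a01.
by rewrite phi0 !mulr0 !add0r; apply; rewrite lexx ler01.
Qed.

Lemma phi_div_decr x y : 0 < x -> x <= y -> y <= 1 -> phi y / y <= phi x / x.
Proof.
move=> x0 xy y1; have y0 : 0 < y by apply: lt_le_trans xy.
have := @phi_scale (x / y) y; rewrite divfK ?gt_eqF// => /(_ _ _)-h.
rewrite ler_pdivlMr// mulrAC -mulrA mulrC; apply: h.
  apply/andP; split; first by rewrite divr_ge0// ltW.
  by rewrite ler_pdivrMr// mul1r.
by rewrite (ltW y0).
Qed.

Lemma phi_half x : 0 <= x <= 1 -> phi x <= 2 * phi (x / 2).
Proof.
move=> x01; have h2 : 0 < 2^-1 :> R by rewrite invr_gt0.
have := @phi_scale 2^-1 x _ x01; rewrite (ltW h2)/= invf_le1// ler1n => /(_ isT).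
by rewrite [_ * x]mulrC; lra.
Qed.

(** As [phi t / t] decreases, each quotient is at most [s]; the set is therefore bounded, and [sup]
    is a genuine supremum rather than a default value. *)
Lemma dilation_le s t : 1 < s -> 0 < t -> s * t <= 1 ->
  phi (s * t) <= dilation phi s * phi t /\ dilation phi s <= s.
Proof.
move=> s1 t0 st1; have s0 : 0 < s by apply: lt_trans s1.
pose E := [set phi (s * t) / phi t | t in [set t : R | 0 < t /\ t <= Num.min 1 s^-1]].
have minE : Num.min 1 s^-1 = s^-1.
  by apply/min_idPr; rewrite invf_le1// ltW.
have ub : ubound E s.
  move=> z [r [r0 rs] <-]; rewrite minE in rs.
  have sr1 : s * r <= 1 by rewrite mulrC -ler_pdivlMr// mul1r.
  have r1 : r <= 1 by apply: le_trans rs _; rewrite invf_le1// ltW.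
  rewrite ler_pdivrMr ?phi_gt0 ?r0//.
  have := @phi_div_decr r (s * r) r0.
  rewrite ler_pMl// ltW// sr1 => /(_ isT isT).
  by rewrite ler_pdivrMr ?mulr_gt0// mulrCA divfK ?gt_eqF// mulrC.
have Et : E (phi (s * t) / phi t).
  by exists t => //; split=> //; rewrite minE -[leRHS]mul1r ler_pdivlMr// mulrC.
have t1 : t <= 1 by apply: le_trans st1; rewrite ler_pMl// ltW.
split.
  rewrite -ler_pdivrMr ?phi_gt0 ?t0//; apply: sup_ubound => //.
  by exists s.
by apply: sup_le_ub => //; exists (phi (s * t) / phi t).
Qed.

Hypothesis q0_lt1 : q0 phi < 1.

(* If the dilation function were equal to s for all s > 1, the index would
   be 1; no convergence of the defining limit is needed. *)
Lemma dilation_lt : exists s d, [/\ 1 < s, 0 < d, d < s &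
  forall t, 0 < t -> s * t <= 1 -> phi (s * t) <= d * phi t].
Proof.
apply: contrapT => h.
have dil s : 1 < s -> dilation phi s = s.
  move=> s1; have s0 : 0 < s by apply: lt_trans s1.
  have ss : s * s^-1 <= 1 by rewrite mulfV ?gt_eqF.
  have si : 0 < s^-1 by rewrite invr_gt0.
  have [le1 le2] := dilation_le s1 si ss.
  (* Were the value below [s], it could serve as [d]; it is positive because [phi 1] is at most
     [d * phi s^-1]. *)
  apply/eqP; rewrite eq_le le2/= leNgt; apply/negP => lt.
  apply: h; exists s, (dilation phi s); split=> //.
    have := lt_le_trans _ le1; rewrite mulfV ?gt_eqF// => /(_ 0).
    rewrite phi_gt0 ?ltr01 ?lexx// => /(_ isT).
    by rewrite pmulr_lgt0// phi_gt0// si invf_le1// ltW.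
  by move=> t t0 st; have [] := dilation_le s1 t0 st.
move: q0_lt1; rewrite /q0.
suff -> : lim ((fun s => ln (dilation phi s) / ln s) @ +oo) = 1 by rewrite ltxx.
apply/cvg_lim => //; apply: cvg_near_cst.
near=> s; have s1 : 1 < s by near: s; exact: nbhs_pinfty_gt.
by rewrite dil// divff// gt_eqF// ln_gt0.
Unshelve. all: by end_near.
Qed.

Lemma phi_iter s d k t : 1 < s -> 0 < d ->
  (forall t, 0 < t -> s * t <= 1 -> phi (s * t) <= d * phi t) ->
  0 < t <= 1 -> phi t <= d ^+ k * phi (t * s ^- k).
Proof.
move=> s1 d0 h /andP[t0 t1]; have s0 : 0 < s by apply: lt_trans s1.
elim: k => [|k ih]; first by rewrite !expr0 invr1 mulr1 mul1r.
apply: le_trans ih _; rewrite exprSr -mulrA ler_pM2l ?exprn_gt0//.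
have p0 n : 0 < t * s ^- n by rewrite mulr_gt0// invr_gt0 exprn_gt0.
have E : s * (t * s ^- k.+1) = t * s ^- k.
  rewrite exprS invfM mulrCA; congr (_ * _).
  by rewrite mulrA mulfV ?gt_eqF// mul1r.
rewrite -{1}E; apply: h => //; rewrite E.
rewrite -[leRHS]mulr1; apply: ler_pM => //; first exact: ltW.
  by rewrite invr_ge0 exprn_ge0// ltW.
by rewrite invf_le1 ?exprn_gt0// exprn_ege1// ltW.
Qed.

(** At [x = s ^- k] the iterated inequality gives [phi x / x >= phi 1 * (s / d) ^+ k], unbounded
    since [d < s]. This is what keeps finitely many levels of the weight away from 0. *)
Lemma phi_div_unbounded A : exists2 x, 0 < x <= 2^-1 & A <= phi x / x.
Proof.
have [s [d [s1 d0 ds h]]] := dilation_lt.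
have s0 : 0 < s by apply: lt_trans s1.
have p1 : 0 < phi 1 by rewrite phi_gt0// ltr01 lexx.
have small : `|d / s| < 1 by rewrite ger0_norm ?divr_ge0 ?ltW// ltr_pdivrMr// mul1r.
have small' : `|s^-1| < 1 by rewrite gtr0_norm ?invr_gt0// invf_lt1.
have A1 : 0 < `|A| + 1 by rewrite ltr_wpDl.
have r0 : 0 < d / s by rewrite divr_gt0.
have /vanishesP/(_ _ (divr_gt0 p1 A1))[N hN] := cvg_expr small.
have h2 : 0 < 2^-1 :> R by rewrite invr_gt0.
have /vanishesP/(_ _ h2)[N' hN'] := cvg_expr small'.
pose k := maxn N N'.
have hk : `|(d / s) ^+ k| <= phi 1 / (`|A| + 1) := hN k (leq_maxl _ _).
have hk' : `|s^-1 ^+ k| <= 2^-1 := hN' k (leq_maxr _ _).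
have sk0 : 0 < s ^+ k by rewrite exprn_gt0.
have dk0 : 0 < d ^+ k by rewrite exprn_gt0.
exists (s ^- k).
  rewrite invr_gt0 sk0/=; move: hk'.
  by rewrite exprVn ger0_norm// invr_ge0 ltW.
apply: (@le_trans _ _ (`|A| + 1)); first by rewrite ler_wpDr// ler_norm.
have := @phi_iter s d k 1 s1 d0 h _; rewrite ltr01 lexx mul1r => /(_ isT) hp.
move: hk; rewrite (ger0_norm (exprn_ge0 k (ltW r0))) exprMn exprVn.
rewrite ler_pdivlMr// => hk.
rewrite invrK -(ler_pM2l dk0) mulrA.
apply: le_trans (ler_wpM2r (ltW sk0) hp).
by move: hk; rewrite mulrAC ler_pdivrMr.
Qed.

(** Cut [[0, t]] at the points [t * s ^- k]. Above the cut of index [k.+1], [1 / phi] is at most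
    [d ^+ k.+1 / phi t] by [phi_iter], while the intervals shrink by the factor [s]: the resulting
    series is geometric of ratio [d / s], whence the constant [d / (1 - d / s)]. *)
Lemma integral_inv_phi : exists2 C, 0 < C & forall t, 0 < t <= 1 ->
  (\int[mu]_(s in `[0%R, t]) ((phi s)^-1)%:E <= (C * (t / phi t))%:E)%E.
Proof.
have [s [d [s1 d0 ds h]]] := dilation_lt.
have s0 : 0 < s by apply: lt_trans s1.
have r1 : d / s < 1 by rewrite ltr_pdivrMr// mul1r.
have r1' : 0 < 1 - d / s by rewrite subr_gt0.
have r0 : 0 < d / s by rewrite divr_gt0.
exists (d / (1 - d / s)); first by rewrite divr_gt0.
move=> t /andP[t0 t1]; have pt : 0 < phi t by rewrite phi_gt0 ?t0.
pose u k x : \bar R := (d ^+ k.+1 / phi t * \1_(`[0%R, t * s ^- k]%classic) x)%:E.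
have u0 k x : (0 <= u k x)%E.
  by rewrite lee_fin mulr_ge0// divr_ge0 ?exprn_ge0 ?ltW.
have mu_ k : measurable_fun `[0%R, t] (u k).
  by apply/measurable_EFinP; apply: measurable_funM => //; exact: measurable_indic.
apply: (@le_trans _ _ (\int[mu]_(x in `[0%R, t]) \sum_(0 <= k <oo) u k x)%E).
  apply: ge0_le_integral_any => x /=; rewrite in_itv/= => /andP[x0 xt].
    rewrite lee_fin invr_ge0; move: x0; rewrite le_eqVlt => /orP[/eqP <-|x0].
      by rewrite phi0.
    by rewrite ltW// phi_gt0// x0 (le_trans xt).
  move: x0; rewrite le_eqVlt => /orP[/eqP <-|x0].
    by rewrite phi0 invr0; apply: nneseries_ge0 => k _ _; exact: u0.
  have small' : `|s^-1| < 1 by rewrite gtr0_norm ?invr_gt0// invf_lt1.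
  have ex : exists k, t * s ^- k < x.
    have x2 : 0 < x / 2 / t by rewrite !divr_gt0.
    have /vanishesP/(_ _ x2)[N hN] := cvg_expr small'.
    exists N; have hNN : `|s^-1 ^+ N| <= x / 2 / t := hN N (leqnn _).
    have sN : 0 <= s ^- N by rewrite invr_ge0 exprn_ge0// ltW.
    by move: hNN; rewrite exprVn (ger0_norm sN) ler_pdivlMr// mulrC; lra.
  (* The least [k] with [t * s ^- k < x] is positive because [x <= t]; its predecessor names the
     shell that contains [x]. *)
  case: (ex_minnP ex) => -[|k] hk kmin.
    by move: hk; rewrite expr0 invr1 mulr1 ltNge xt.
  have kx : x <= t * s ^- k.
    by rewrite leNgt; apply/negP => /kmin; rewrite ltnn.
  apply: le_trans (nneseries_ge_term k (u0 ^~ x)).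
  have -> : u k x = (d ^+ k.+1 / phi t)%:E.
    by rewrite /u indicE mem_set/= ?mulr1// in_itv/= kx ltW.
  rewrite lee_fin.
  have px : 0 < phi x by rewrite phi_gt0// x0 (le_trans xt).
  rewrite ler_pdivlMr// mulrC ler_pdivrMr//.
  apply: (@le_trans _ _ (d ^+ k.+1 * phi (t * s ^- k.+1))).
    by apply: phi_iter => //; rewrite t0.
  rewrite ler_pM2l ?exprn_gt0//; apply: phi_homo.
  - by rewrite mulr_ge0 ?invr_ge0 ?exprn_ge0 ?ltW.
  - exact: ltW.
  - exact: le_trans t1.
rewrite integral_nneseries//.
apply: nneseries_le => [k|m]; first by apply: integral_ge0 => x _; exact: u0.
have intu k : (\int[mu]_(x in `[0%R, t]) u k x <=
    (d * (t / phi t) * (d / s) ^+ k)%:E)%E.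
  rewrite /u; under eq_integral do rewrite EFinM.
  rewrite ge0_integralZl//; last 2 first.
  - by apply/measurable_EFinP; exact: measurable_indic.
  - by rewrite lee_fin divr_ge0 ?exprn_ge0 ?ltW.
  rewrite integral_indic//.
  have -> : (d * (t / phi t) * (d / s) ^+ k)%:E =
      ((d ^+ k.+1 / phi t)%:E * (t * s ^- k)%:E)%E.
    rewrite -EFinM; congr EFin; rewrite exprMn exprVn exprS; ring.
  apply: lee_wpmul2l; first by rewrite lee_fin divr_ge0 ?exprn_ge0 ?ltW.
  apply: (@le_trans _ _ (mu `[0%R, t * s ^- k])).
    by apply: le_lebesgue_measure => //; exact: measurableI.
  rewrite lebesgue_measure_itv/= lte_fin mulr_gt0 ?invr_gt0 ?exprn_gt0//.
  by rewrite -EFinB subr0.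
apply: (@le_trans _ _ (\sum_(0 <= k < m) (d * (t / phi t) * (d / s) ^+ k)%:E)%E).
  exact: lee_sum.
rewrite sumEFin lee_fin -mulr_sumr.
have geo : \sum_(0 <= k < m) (d / s) ^+ k <= (1 - d / s)^-1.
  rewrite -[leRHS]mul1r ler_pdivlMr//.
  suff -> : (\sum_(0 <= k < m) (d / s) ^+ k) * (1 - d / s) = 1 - (d / s) ^+ m.
    by rewrite gerBl exprn_ge0// ltW.
  elim: m => [|m ih]; first by rewrite big_geq// mul0r expr0 subrr.
  by rewrite big_nat_recr//= mulrDl ih exprS; ring.
rewrite [leRHS]mulrAC; apply: ler_wpM2l => //.
by rewrite mulr_ge0 ?divr_ge0 ?ltW.
Qed.

(** * Decreasing rearrangements and bounds for the Marcinkiewicz norm *)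

Hypothesis phi_lim : phi t @[t --> 0^'+] --> 0.
Implicit Types (f g : R -> R) (E : set R) (e : R).

Lemma phi_small e : 0 < e -> exists2 d : R, 0 < d <= 1 &
  forall t, 0 < t <= d -> phi t <= e.
Proof.
move=> e0; have [d /= d0 hd] := (cvgr0Pnorm_le _).1 phi_lim _ e0.
exists (Num.min 1 (d / 2)).
  by rewrite lt_min ltr01 divr_gt0//= ge_min lexx.
move=> t /andP[t0]; rewrite le_min => /andP[t1 td].
apply: le_trans (ler_norm _) _; apply: hd => //=.
by rewrite sub0r normrN gtr0_norm//; lra.
Qed.

Local Notation D01 := (`[(0 : R), (1 : R)]%classic : set R).

Lemma drearr_le g (l s : R) : 0 <= l -> (distrib g l <= s%:E)%E ->
  (drearr g s <= l%:E)%E.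
Proof. by move=> l0 h; apply: ereal_inf_lbound; exists l. Qed.

Lemma drearr_ge0 g s : (0 <= drearr g s)%E.
Proof. by apply: le_ereal_inf_tmp => _ [l [l0 _] <-]; rewrite lee_fin. Qed.

Lemma drearr_ge g (l s : R) : (forall l', 0 <= l' < l -> (s%:E < distrib g l')%E) ->
  (l%:E <= drearr g s)%E.
Proof.
move=> h; apply: le_ereal_inf_tmp => _ [l' [l0 hl] <-]; rewrite lee_fin leNgt.
apply/negP => ll; have := h l'; rewrite l0 ll => /(_ isT).
by rewrite ltNge hl.
Qed.

Lemma measurable_superlevel g (l : R) : measurable_fun D01 g ->
  measurable (D01 `&` [set x | l < `|g x|]).
Proof.
move=> mg; have : measurable_fun D01 (fun x => `|g x|) by exact: measurableT_comp.
move=> /(_ (measurable_itv _) `]l, +oo[%classic (measurable_itv _)).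
rewrite (_ : _ @^-1` _ = [set x | l < `|g x|])//.
by apply/seteqP; split=> x /=; rewrite in_itv/= andbT.
Qed.

Lemma mnorm_ge0 g : (0 <= mnorm phi g)%E.
Proof.
apply: (@le_trans _ _ ((phi 1 / 1)%:E * \int[mu]_(s in `[0%R, 1%R]) drearr g s)%E).
  apply: mule_ge0.
    by rewrite lee_fin divr1 ltW// phi_gt0// ltr01 lexx.
  by apply: integral_ge0 => s _; exact: drearr_ge0.
apply: ereal_sup_ubound; exists 1 => //=.
by rewrite in_itv/= ltr01 lexx.
Qed.

(** The rearrangement of [g] is at least [c] on [[0, t)], with [t] the measure of [E]; the supremum
    is tested at this [t]. *)
Lemma mnorm_ge g E (t c : R) : measurable_fun D01 g -> measurable E ->
  E `<=` D01 -> mu E = t%:E -> 0 < t <= 1 -> 0 <= c ->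
  (forall x, E x -> c <= `|g x|) -> ((phi t * c)%:E <= mnorm phi g)%E.
Proof.
move=> mg mE sE muE /andP[t0 t1] c0 hE.
apply: (@le_trans _ _ ((phi t / t)%:E * \int[mu]_(s in `[0%R, t]) drearr g s)%E);
  last by apply: ereal_sup_ubound; exists t => //=; rewrite in_itv/= t0.
have pt : 0 < phi t by rewrite phi_gt0 ?t0.
have -> : (phi t * c)%:E = ((phi t / t)%:E * (c * t)%:E)%E.
  by rewrite -EFinM; congr EFin; field; rewrite gt_eqF.
apply: lee_wpmul2l; first by rewrite lee_fin divr_ge0// ltW.
(* The end [s = t] is left out because the inequality [s < mu E] has to be strict. *)
have -> : (c * t)%:E = (\int[mu]_(s in `[0%R, t]) (c * \1_(`[0%R, t[%classic) s)%:E)%E.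
  under eq_integral do rewrite EFinM.
  rewrite ge0_integralZl//; last first.
    by apply/measurable_EFinP; exact: measurable_indic.
  rewrite integral_indic// EFinM; congr (_ * _)%E.
  rewrite (_ : `[0, t[ `&` `[0, t] = `[0, t[%classic); last first.
    by apply/setIidPl; apply: subset_itv; rewrite ?lexx// bnd_simp.
  have muI : mu `[0%R, t[ = t%:E.
    by rewrite lebesgue_measure_itv/= lte_fin t0 -EFinB subr0.
  exact: esym muI.
apply: ge0_le_integral_any => s _.
  by rewrite lee_fin mulr_ge0.
rewrite indicE; case: (boolP (s \in _)) => hs; last by rewrite mulr0 drearr_ge0.
rewrite mulr1; apply: drearr_ge => l /andP[l0 lc].
move: hs; rewrite inE/= in_itv/= => /andP[_ st].
apply: (@lt_le_trans _ _ (mu E)); first by rewrite muE lte_fin.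
apply: le_lebesgue_measure => //; first exact: measurable_superlevel.
by move=> x Ex; split; [exact: sE | rewrite /= (lt_le_trans lc)// hE].
Qed.

Definition dist01 (x : R) : R := Num.min x (1 - x).

(** To bound the rearrangement at [s], discard the points within [s / 4] of an end, of measure at
    most [s / 2]; elsewhere the second term is at most [e / phi (s / 4) <= 4 * e / phi s]. If
    [s >= 2 * a], all of [A] can be discarded as well; if [s < 2 * a], then
    [M <= M * phi (2 * a) / phi s]. So the rearrangement is at most a constant over [phi], and the
    integral of [1 / phi] is under control. An empty [A] gives norm bounds, an [A] of small measure
    gives order continuity. *)
Lemma mnorm_le g (A : set R) C (a M e : R) : 0 < C ->
  (forall t, 0 < t <= 1 ->
    (\int[mu]_(s in `[0%R, t]) ((phi s)^-1)%:E <= (C * (t / phi t))%:E)%E) ->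
  measurable_fun D01 g -> measurable A -> (mu A <= a%:E)%E ->
  0 < a -> 2 * a <= 1 -> 0 <= M -> 0 <= e ->
  (forall x, 0 < x < 1 -> `|g x| <= M * \1_A x + e / phi (dist01 x)) ->
  (mnorm phi g <= (C * (M * phi (2 * a) + 4 * e))%:E)%E.
Proof.
move=> C0 hC mg mA muA a0 a1 M0 e0 hg.
pose N := M * phi (2 * a) + 4 * e.
have p2a : 0 <= phi (2 * a) by rewrite ltW// phi_gt0// mulr_gt0.
have N0 : 0 <= N by rewrite addr_ge0 ?mulr_ge0.
have key s : 0 < s <= 1 -> (drearr g s <= (N / phi s)%:E)%E.
  move=> /andP[s0 s1]; have ps : 0 < phi s by rewrite phi_gt0 ?s0.
  have s4 : 0 < s / 4 <= 1 by apply/andP; split; lra.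
  have ps4 : 0 < phi (s / 4) by exact: phi_gt0.
  have hps : phi s <= 4 * phi (s / 4).
    have := @phi_half s; have := @phi_half (s / 2).
    have -> : s / 2 / 2 = s / 4 by lra.
    by move=> h1 h2; have := h1 ltac:(apply/andP; split; lra);
       have := h2 ltac:(apply/andP; split; lra); lra.
  pose l := M * ((s < 2 * a)%R)%:R + e / phi (s / 4).
  have l0 : 0 <= l.
    by apply: addr_ge0; [exact: mulr_ge0 | rewrite divr_ge0// ltW].
  apply: (@le_trans _ _ l%:E); last first.
    rewrite lee_fin /N mulrDl lerD//.
      case: (ltrP s (2 * a)) => h; last by rewrite mulr0 divr_ge0 ?mulr_ge0// ltW.
      by rewrite mulr1 -mulrA ler_peMr// ler_pdivlMr// mul1r phi_homo// ltW.
    rewrite ler_pdivrMr// mulrAC ler_pdivlMr//.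
    by have := ler_wpM2l e0 hps; lra.
  apply: drearr_le => //.
  pose B : set R := `[0%R, s / 4[%classic `|` `]1 - s / 4, 1%R]%classic.
  have mB : measurable B by apply: measurableU.
  have muB : (mu B <= (s / 2)%:E)%E.
    apply: le_trans (lebesgue_measureU _ _) _ => //.
    rewrite !lebesgue_measure_itv/= !lte_fin.
    have -> : 0 < s / 4 by lra.
    have -> : 1 - s / 4 < 1 by lra.
    by rewrite -!EFinB -EFinD lee_fin; lra.
  have out x : D01 x -> ~ B x -> 0 < x < 1 /\ e / phi (dist01 x) <= e / phi (s / 4).
    rewrite /B /= !in_itv/= => /andP[x0 x1] nB.
    have h1 : s / 4 <= x by rewrite leNgt; apply/negP => h; apply: nB; left; rewrite x0.
    have h2 : x <= 1 - s / 4.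
      by rewrite leNgt; apply/negP => h; apply: nB; right; rewrite x1 h.
    split; first by apply/andP; split; lra.
    have hd : s / 4 <= dist01 x by rewrite /dist01 le_min h1/=; lra.
    have hd1 : dist01 x <= 1 by rewrite /dist01 ge_min x1.
    rewrite ler_wpM2l// lef_pV2 ?posrE//.
      by apply: phi_homo => //; lra.
    by apply: phi_gt0; rewrite hd1 andbT; lra.
  have mS := measurable_superlevel l mg.
  rewrite /distrib; case: (ltrP s (2 * a)) => hsa.
    apply: (@le_trans _ _ (mu B)).
      apply: le_lebesgue_measure => // x [Dx /= hx]; apply: contrapT => nB.
      have [x01 he] := out x Dx nB; move: hx; apply/negP; rewrite -leNgt.
      by apply: le_trans (hg x x01) _; rewrite /l hsa mulr1 lerD// ler_piMr// indicE.
    by apply: le_trans muB _; rewrite lee_fin; lra.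
  apply: (@le_trans _ _ (mu (A `|` B))).
    apply: le_lebesgue_measure => //; first exact: measurableU.
    move=> x [Dx /= hx]; apply: contrapT => nAB.
    have nA : ~ A x by move=> Ax; apply: nAB; left.
    have nB : ~ B x by move=> Bx; apply: nAB; right.
    have [x01 he] := out x Dx nB; move: hx; apply/negP; rewrite -leNgt.
    apply: le_trans (hg x x01) _; rewrite indicE memNset// mulr0 add0r.
    by apply: le_trans he _; rewrite /l lerDr mulr_ge0.
  apply: le_trans (lebesgue_measureU _ _) _ => //.
  apply: (@le_trans _ _ (a%:E + (s / 2)%:E)%E); first exact: leeD.
  by rewrite -EFinD lee_fin; lra.
have mphi t : 0 < t <= 1 -> measurable_fun `]0%R, t] (fun s => ((phi s)^-1)%:E).
  move=> /andP[t0 t1]; apply/measurable_EFinP.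
  apply: antitone_on_itv_measurable; first exact: interval_is_interval.
  move=> x y /=; rewrite !in_itv/= => /andP[x0 xt] /andP[y0 yt] xy.
  have x1 : x <= 1 by exact: le_trans t1.
  have y1 : y <= 1 by exact: le_trans t1.
  rewrite lef_pV2 ?posrE ?phi_gt0 ?x0 ?y0//; apply: phi_homo => //; exact: ltW.
apply: ge_ereal_sup => _ [t /= + <-]; rewrite in_itv/= => t01.
have /andP[t0 t1] := t01; have pt : 0 < phi t by exact: phi_gt0.
apply: (@le_trans _ _ ((phi t / t)%:E * (N%:E * (C * (t / phi t))%:E))%E); last first.
  rewrite -!EFinM lee_fin -/N le_eqVlt; apply/orP; left; apply/eqP.
  by field; rewrite !gt_eqF.
apply: lee_wpmul2l; first by rewrite lee_fin divr_ge0// ltW.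
apply: (@le_trans _ _ (N%:E * \int[mu]_(s in `[0%R, t]) ((phi s)^-1)%:E)%E); last first.
  by apply: lee_wpmul2l; [rewrite lee_fin | exact: hC].
(* At [s = 0] the rearrangement may be infinite while [(phi 0)^-1] is 0, so the bound is set to
   infinity at that single point. *)
pose h s : \bar R := if s == 0 then +oo%E else (N * (phi s)^-1)%:E.
have mh : measurable_fun `]0%R, t] h.
  apply: (@eq_measurable_fun _ _ _ _ _ (fun s => (N%:E * ((phi s)^-1)%:E)%E)).
    move=> s; rewrite inE/= in_itv/= => /andP[s0 _].
    by rewrite /h gt_eqF// EFinM.
  by apply: measurable_funeM; exact: mphi.
apply: (@le_trans _ _ (\int[mu]_(s in `[0%R, t]) h s)%E).
  apply: ge0_le_integral_any => s; first by move=> _; exact: drearr_ge0.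
  rewrite /= in_itv/= => /andP[s0 st]; rewrite /h; case: eqP => [_|/eqP sn].
    exact: leey.
  by apply: key; rewrite lt_neqAle eq_sym sn s0 (le_trans st).
rewrite -integral_itv_obnd_cbnd//.
have -> : (\int[mu]_(s in `]0%R, t]) h s =
    \int[mu]_(s in `]0%R, t]) (N%:E * ((phi s)^-1)%:E))%E.
  apply: eq_integral => s; rewrite inE/= in_itv/= => /andP[s0 _].
  by rewrite /h gt_eqF// EFinM.
rewrite ge0_integralZl//; last first.
- move=> s /=; rewrite in_itv/= => /andP[s0 st]; rewrite lee_fin invr_ge0 ltW//.
  by rewrite phi_gt0// s0 (le_trans st).
- exact: mphi.
by rewrite integral_itv_obnd_cbnd//; exact: mphi.
Qed.

(** * The weight and its dyadic levels *)

Local Notation D := (`](0 : R), (1 : R)[%classic : set R).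
Local Notation leftD := (`](0 : R), (2^-1 : R)]%classic : set R).
Local Notation rightD := (`](2^-1 : R), (1 : R)[%classic : set R).

(* The norm of [f] in C(M_phi^0) is equivalent to the supremum over dyadic
   levels of the integrals of [|f| * wt] over the level sets: near 0 the weight
   increases to infinity, near 1 it decreases to 0.  Outside (0, 1) the value 1
   only keeps the weight invertible. *)
Definition wt x : R :=
  if 0 < x < 1 then (if x <= 2^-1 then phi x / x else phi (1 - x)) else 1.

Definition wt0 : R := phi 2^-1 / 2^-1.

(** At least 1 on [(0, 1)] and growing towards both ends, [wt0] being the value of [wt] at 1/2.
    Level [k] thus consists of a piece on the left, where the weight is about [wt0 * 2 ^+ k], and a
    piece on the right, where it is about [wt0 / 2 ^+ k]. *)
Definition wt_ratio x : R := if x <= 2^-1 then wt x / wt0 else wt0 / wt x.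

Definition lev x : nat := trunc_log 2 (Num.truncn (wt_ratio x)).

Lemma wt_left x : leftD x -> wt x = phi x / x.
Proof.
rewrite /= in_itv/= => /andP[x0 x1]; rewrite /wt x0 x1.
by have -> : x < 1 by lra.
Qed.

Lemma wt_right x : rightD x -> wt x = phi (1 - x).
Proof.
rewrite /= in_itv/= => /andP[x0 x1]; rewrite /wt x1 leNgt x0.
by have -> : 0 < x by lra.
Qed.

Lemma wt_gt0 x : 0 < wt x.
Proof.
rewrite /wt; case: ifPn => // /andP[x0 x1]; case: ifPn => _.
  by rewrite divr_gt0// phi_gt0// x0 ltW.
by apply: phi_gt0; apply/andP; split; lra.
Qed.

Lemma phi_half_gt0 : 0 < phi 2^-1.
Proof. by apply: phi_gt0; apply/andP; split; lra. Qed.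

Lemma wt0_gt0 : 0 < wt0.
Proof. by rewrite divr_gt0// ?phi_half_gt0// invr_gt0. Qed.

Lemma D_split : D = leftD `|` rightD.
Proof.
apply/seteqP; split=> x /=; rewrite !in_itv/=.
  by move=> /andP[x0 x1]; case: (lerP x 2^-1) => h; [left|right]; rewrite ?x0.
by case=> /andP[x0 x1]; apply/andP; split; lra.
Qed.

Lemma leftD_D : leftD `<=` D. Proof. by rewrite D_split => x; left. Qed.

Lemma rightD_D : rightD `<=` D. Proof. by rewrite D_split => x; right. Qed.

Lemma left_ratio x : leftD x -> wt_ratio x = wt x / wt0.
Proof. by rewrite /= in_itv/= /wt_ratio => /andP[_ ->]. Qed.

Lemma right_ratio x : rightD x -> wt_ratio x = wt0 / wt x.
Proof. by rewrite /= in_itv/= /wt_ratio => /andP[h _]; rewrite leNgt h. Qed.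

Lemma wt_left_homo x y : leftD x -> leftD y -> x <= y -> wt y <= wt x.
Proof.
move=> Lx Ly xy; rewrite !wt_left//; move: Lx Ly.
rewrite /= !in_itv/= => /andP[x0 x1] /andP[y0 y1].
by apply: phi_div_decr => //; lra.
Qed.

Lemma wt_right_homo x y : rightD x -> rightD y -> x <= y -> wt y <= wt x.
Proof.
move=> Lx Ly xy; rewrite !wt_right//; move: Lx Ly.
rewrite /= !in_itv/= => /andP[x0 x1] /andP[y0 y1].
by apply: phi_homo; lra.
Qed.

Lemma ratio_ge1 x : D x -> 1 <= wt_ratio x.
Proof.
rewrite D_split => -[Lx|Rx].
  rewrite left_ratio// ler_pdivlMr ?wt0_gt0// mul1r.
  have <- : wt 2^-1 = wt0 by rewrite wt_left//= in_itv/= invr_gt0 lexx ltr0n.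
  apply: wt_left_homo => //; first by rewrite /= in_itv/= invr_gt0 lexx ltr0n.
  by move: Lx; rewrite /= in_itv/= => /andP[].
rewrite right_ratio// ler_pdivlMr ?wt_gt0// mul1r wt_right//.
move: Rx; rewrite /= in_itv/= => /andP[x0 x1].
apply: (@le_trans _ _ (phi 2^-1)); first by apply: phi_homo; lra.
by rewrite /wt0 invrK ler_peMr ?ler1n// ltW// phi_half_gt0.
Qed.

Lemma levP x : D x -> 2 ^+ lev x <= wt_ratio x < 2 ^+ (lev x).+1.
Proof.
move=> /ratio_ge1 r1; have r0 : 0 <= wt_ratio x by apply: le_trans r1.
have /andP[h1 h2] := truncn_itv r0.
have n0 : (0 < Num.truncn (wt_ratio x))%N by rewrite truncn_gt0.
have /andP[h3 h4] := trunc_log_bounds (ltnSn 1) n0.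
apply/andP; split.
  by apply: le_trans h1; rewrite -natrX ler_nat.
by apply: lt_le_trans h2 _; rewrite -natrX ler_nat.
Qed.

Lemma lev_homo x y : D x -> D y -> wt_ratio x <= wt_ratio y -> (lev x <= lev y)%N.
Proof.
move=> /levP/andP[h1 _] /levP/andP[_ h2] h; rewrite -ltnS.
have : 2 ^+ lev x < 2 ^+ (lev y).+1 :> R by apply: le_lt_trans h1 (le_lt_trans h h2).
by rewrite ltr_eXn2l ?ltr1n.
Qed.

Lemma lev_left x : leftD x -> wt0 * 2 ^+ lev x <= wt x < wt0 * 2 ^+ (lev x).+1.
Proof.
move=> Lx; have := levP (leftD_D Lx); rewrite left_ratio//.
by rewrite ler_pdivlMr ?wt0_gt0// ltr_pdivrMr ?wt0_gt0// !(mulrC wt0).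
Qed.

Lemma lev_right x : rightD x ->
  wt0 / 2 ^+ (lev x).+1 < wt x <= wt0 / 2 ^+ lev x.
Proof.
move=> Rx; have := levP (rightD_D Rx); rewrite right_ratio//.
move: (wt x) (wt_gt0 x) wt0 wt0_gt0 => y y0 w w0.
rewrite ler_pdivlMr// ltr_pdivrMr// ltr_pdivrMr ?exprn_gt0//.
by rewrite ler_pdivlMr ?exprn_gt0// andbC !(mulrC y).
Qed.

Lemma lev_left_homo x y : leftD x -> leftD y -> x <= y -> (lev y <= lev x)%N.
Proof.
move=> Lx Ly xy; apply: lev_homo; [exact: leftD_D..|].
by rewrite !left_ratio// ler_pM2r ?invr_gt0 ?wt0_gt0// wt_left_homo.
Qed.

Lemma lev_right_homo x y : rightD x -> rightD y -> x <= y -> (lev x <= lev y)%N.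
Proof.
move=> Rx Ry xy; apply: lev_homo; [exact: rightD_D..|].
rewrite !right_ratio// ler_pM2l ?wt0_gt0// lef_pV2 ?posrE ?wt_gt0//.
exact: wt_right_homo.
Qed.

Lemma measurable_D g : measurable_fun leftD g -> measurable_fun rightD g ->
  measurable_fun D g.
Proof. by move=> mL mR; rewrite D_split; apply/measurable_funU. Qed.

Lemma measurable_wt : measurable_fun D wt.
Proof.
apply: measurable_D; apply: antitone_on_itv_measurable;
  try exact: interval_is_interval.
- exact: wt_left_homo.
- exact: wt_right_homo.
Qed.

Lemma measurable_lev_block k : measurable (block D lev k).
Proof.
have mf : measurable_fun D (fun x => (lev x)%:R : R).
  apply: measurable_D.
    apply: antitone_on_itv_measurable; first exact: interval_is_interval.
    by move=> x y Lx Ly xy; rewrite ler_nat lev_left_homo.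
  apply: monotone_on_itv_measurable; first exact: interval_is_interval.
  by move=> x y Lx Ly xy; rewrite ler_nat lev_right_homo.
have := mf (measurable_itv _) [set (k%:R : R)] (measurable_set1 _).
rewrite (_ : _ @^-1` _ = [set x | lev x = k])//.
by apply/seteqP; split=> x /=; [move=> /eqP; rewrite eqr_nat => /eqP|move=> ->].
Qed.

Lemma measurable_D01 g : measurable_fun D g -> measurable_fun D01 g.
Proof.
move=> mg; have -> : D01 = [set (0 : R)] `|` (D `|` [set (1 : R)]).
  apply/seteqP; split=> x /=; rewrite !in_itv/=.
    move=> /andP[x0 x1]; have [<-|xn0] := eqVneq 0 x; first by left.
    have [->|xn1] := eqVneq x 1; first by right; right.
    by right; left; rewrite !lt_neqAle xn0 x0 xn1 x1.
  by case=> [->|[/andP[x0 x1]|->]]; apply/andP; split; lra.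
apply/measurable_funU => //; first exact: measurableU.
split; first exact: measurable_fun_set1.
by apply/measurable_funU => //; split=> //; exact: measurable_fun_set1.
Qed.

Lemma D_D01 : D `<=` D01.
Proof. by apply: subset_itv; rewrite bnd_simp. Qed.

Lemma measurable_D01_D g : measurable_fun D01 g -> measurable_fun D g.
Proof. by apply: measurable_funS => //; exact: D_D01. Qed.

(** * Unweighted integrals in terms of block integrals *)

Lemma block_weighted_int g G (al : nat -> R) (M S : R) :
  measurable_fun D g -> measurable G -> G `<=` D -> 0 <= M ->
  (forall k, 0 <= al k) ->
  (forall x, G x -> `|g x| <= al (lev x) * `|g x * wt x|) ->
  (forall k, (block_int D lev (fun x => g x * wt x)%R k <= M%:E)%E) ->
  (forall m, \sum_(k < m) al k <= S) ->
  (\int[mu]_(x in G) (`|g x|)%:E <= (S * M)%:E)%E.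
Proof.
move=> mg mG sG M0 al0 hal hM hS.
(* On each block [|g|] is at most [al k] times the weighted function, whose integral there is at
   most [M]. In the uses below [al] is geometric and cut off at one level, so that [S] is comparable
   to its largest term. *)
pose F k := G `&` block D lev k.
have mF k : measurable (F k) by apply: measurableI => //; exact: measurable_lev_block.
have GE : G = \bigcup_k F k.
  apply/seteqP; split=> [x Gx|x [k _ []]//].
  by exists (lev x) => //; split=> //; split=> //; exact: sG.
have mgw : measurable_fun D (fun x => g x * wt x).
  by apply: measurable_funM => //; exact: measurable_wt.
have sF k : F k `<=` D by move=> x [/sG].
rewrite GE ge0_integral_bigcup//; last first.
- by move=> i j _ _ [x [[_ [_ /= <-]] [_ [_ /= <-]]]].
- rewrite -GE; apply/measurable_EFinP; apply: measurableT_comp => //.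
  exact: measurable_funS mg.
apply: nneseries_le => [k|m]; first by apply: integral_ge0 => x _; rewrite lee_fin.
apply: (@le_trans _ _ (\sum_(0 <= k < m) (al k * M)%:E)%E); last first.
  rewrite sumEFin lee_fin -mulr_suml big_mkord.
  by apply: ler_wpM2r => //; exact: hS.
apply: lee_sum => k _.
apply: (@le_trans _ _ ((al k)%:E * \int[mu]_(x in F k) (`|g x * wt x|)%:E)%E).
  rewrite -ge0_integralZl//; last 3 first.
  - exact: mF.
  - apply/measurable_EFinP; apply: measurableT_comp => //.
    exact: (measurable_funS (measurable_itv _) (@sF k)).
  - by rewrite lee_fin.
  apply: ge0_le_integral_any => x; first by rewrite lee_fin.
  by move=> [Gx [_ /= <-]]; rewrite -EFinM lee_fin; exact: hal.
rewrite EFinM; apply: lee_wpmul2l; first by rewrite lee_fin.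
apply: le_trans (hM k); apply: ge0_subset_integral => //.
- exact: mF.
- exact: measurable_lev_block.
- by apply: measurable_abs_block => //; exact: measurable_lev_block.
- by move=> x [].
Qed.

Lemma sum_half_powers_tail K m :
  \sum_(k < m) (if (K <= k)%N then 2 ^- k else 0) <= 2 * 2 ^- K :> R.
Proof.
have z n : (n <= K)%N -> \sum_(k < n) (if (K <= k)%N then 2 ^- k else 0) = 0 :> R.
  by move=> nK; rewrite big1// => i _; rewrite leqNgt (leq_trans (ltn_ord i)).
have [mK|Km] := leqP m K; first by rewrite z// mulr_ge0// invr_ge0 exprn_ge0.
rewrite -(subnKC (ltnW Km)).
have -> : \sum_(k < K + (m - K)) (if (K <= k)%N then 2 ^- k else 0) =
    2 * 2 ^- K - 2 * 2 ^- (K + (m - K)) :> R.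
  elim: (m - K)%N => [|j ih]; first by rewrite addn0 z// subrr.
  by rewrite addnS big_ord_recr/= ih leq_addr exprS invfM; lra.
by rewrite gerBl mulr_ge0// invr_ge0 exprn_ge0.
Qed.

Lemma sum_powers_head K m :
  \sum_(k < m) (if (k <= K)%N then 2 ^+ k else 0) <= 2 * 2 ^+ K :> R.
Proof.
have -> : \sum_(k < m) (if (k <= K)%N then 2 ^+ k else 0) =
    2 ^+ (minn m K.+1) - 1 :> R.
  elim: m => [|m ih]; first by rewrite big_ord0 min0n expr0 subrr.
  rewrite big_ord_recr/= ih; case: leqP => mK.
    by rewrite minnSS (minn_idPl (leqW mK)) (minn_idPl mK) exprS; lra.
  by rewrite minnSS (minn_idPr mK) (minn_idPr (ltnW mK)) addr0.
rewrite lerBlDr; apply: (@le_trans _ _ (2 ^+ K.+1)); last by rewrite exprS lerDl.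
by rewrite ler_weXn2l ?ler1n// geq_minr.
Qed.

(** The weight decreases on the left half, so only levels from [lev x] on occur in [(0, x]]; the sum
    of [2 ^- k / wt0] over them is at most [2 * 2 ^- lev x / wt0 <= 4 / wt x]. *)
Lemma left_int_le g (M : R) x : measurable_fun D g -> 0 <= M ->
  (forall k, (block_int D lev (fun x => g x * wt x)%R k <= M%:E)%E) ->
  leftD x -> (\int[mu]_(y in `]0%R, x]) (`|g y|)%:E <= (4 * M / wt x)%:E)%E.
Proof.
move=> mg M0 hM Lx; have w0 := wt0_gt0; have wx := wt_gt0 x.
have /andP[x0 x1] : 0 < x <= 2^-1 by move: Lx; rewrite /= in_itv.
pose al k : R := (if (lev x <= k)%N then 2 ^- k else 0) / wt0.
have sub y : `]0%R, x]%classic y -> leftD y /\ y <= x.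
  by rewrite /= !in_itv/= => /andP[y0 yx]; rewrite y0 yx (le_trans yx).
apply: (@le_trans _ _ ((2 * 2 ^- lev x / wt0) * M)%:E).
  apply: (@block_weighted_int g _ al) => //.
  - by move=> y /sub[/leftD_D].
  - by move=> k; rewrite divr_ge0 ?(ltW w0)//; case: ifP => // _; rewrite invr_ge0 exprn_ge0.
  - move=> y /sub[Ly yx]; have wy := wt_gt0 y.
    rewrite /al lev_left_homo// normrM (gtr0_norm wy) mulrCA ler_peMr//.
    rewrite mulrAC ler_pdivlMr// mul1r mulrC ler_pdivlMr ?exprn_gt0//.
    by have /andP[] := lev_left Ly.
  - move=> m; rewrite -mulr_suml ler_pM2r ?invr_gt0//.
    exact: sum_half_powers_tail.
rewrite lee_fin [leRHS]mulrAC; apply: ler_wpM2r => //.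
have /andP[_ h] := lev_left Lx; rewrite exprS in h.
have p0 : 0 < 2 ^+ lev x :> R by rewrite exprn_gt0.
move: (wt x) wx wt0 w0 (2 ^+ lev x) p0 h => y y0 w w0 p p0 h.
rewrite ler_pdivlMr// -[2 / p / w]mulrA -invfM mulrAC.
by rewrite ler_pdivrMr ?mulr_gt0//; lra.
Qed.

(** Only levels up to [lev x] occur in [(1/2, x]], and [1 / wt] is below [2 ^+ k.+1 / wt0] on level
    [k]: a geometric sum governed by its last term. *)
Lemma right_int_le g (M : R) x : measurable_fun D g -> 0 <= M ->
  (forall k, (block_int D lev (fun x => g x * wt x)%R k <= M%:E)%E) ->
  rightD x -> (\int[mu]_(y in `]2^-1%R, x]) (`|g y|)%:E <= (4 * M / wt x)%:E)%E.
Proof.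
move=> mg M0 hM Rx; have w0 := wt0_gt0; have wx := wt_gt0 x.
have /andP[x0 x1] : 2^-1 < x < 1 by move: Rx; rewrite /= in_itv.
pose al k : R := (if (k <= lev x)%N then 2 ^+ k else 0) * (2 / wt0).
have sub y : `]2^-1%R, x]%classic y -> rightD y /\ y <= x.
  by rewrite /= !in_itv/= => /andP[y0 yx]; rewrite y0 yx (le_lt_trans yx).
have w2 : 0 < 2 / wt0 by rewrite divr_gt0.
apply: (@le_trans _ _ ((2 * 2 ^+ lev x * (2 / wt0)) * M)%:E).
  apply: (@block_weighted_int g _ al) => //.
  - by move=> y /sub[/rightD_D].
  - by move=> k; rewrite mulr_ge0 ?(ltW w2)//; case: ifP => // _; rewrite exprn_ge0.
  - move=> y /sub[Ry yx]; have wy := wt_gt0 y.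
    rewrite /al lev_right_homo// normrM (gtr0_norm wy) mulrCA ler_peMr//.
    have /andP[h _] := lev_right Ry; move: h.
    rewrite exprS ltr_pdivrMr ?mulr_gt0 ?exprn_gt0// => h.
    rewrite mulrA mulrAC ler_pdivlMr// mul1r; lra.
  - move=> m; rewrite -mulr_suml ler_pM2r//.
    exact: sum_powers_head.
rewrite lee_fin [leRHS]mulrAC; apply: ler_wpM2r => //.
have /andP[_ h] := lev_right Rx.
have p0 : 0 < 2 ^+ lev x :> R by rewrite exprn_gt0.
move: (wt x) wx wt0 w0 {w2 al} (2 ^+ lev x) p0 h => y y0 w w0 p p0.
rewrite ler_pdivlMr// => h.
by rewrite ler_pdivlMr// mulrA mulrAC ler_pdivrMr//; lra.
Qed.

Lemma ereal_cvg0P (u : nat -> \bar R) : (forall n, (0 <= u n)%E) ->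
  (u n @[n --> \oo] --> 0%E) <-> (forall e, 0 < e -> exists N, forall n,
    (N <= n)%N -> (u n <= e%:E)%E).
Proof.
move=> u0; split=> [/fine_cvgP[[N1 _ h1] h2] e e0|h].
  have /vanishesP/(_ e e0)[N2 hN2] := h2.
  exists (maxn N1 N2) => n; rewrite geq_max => /andP[n1 n2].
  rewrite -(fineK (h1 n n1)) lee_fin; apply: le_trans (hN2 n n2).
  exact: ler_norm.
have fin (e : R) n : (u n <= e%:E)%E -> u n \is a fin_num.
  by move=> ue; rewrite ge0_fin_numE// (le_lt_trans ue)// ltry.
apply/fine_cvgP; split.
  by have [N hN] := h 1 ltr01; exists N => // n /= Nn; exact: fin (hN n Nn).
apply/vanishesP => e e0; have [N hN] := h e e0; exists N => n Nn /=.
by rewrite ger0_norm ?fine_ge0// -lee_fin (fineK (fin _ _ (hN n Nn))) hN.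
Qed.

(** * Two-sided estimates between Cesaro averages and block integrals *)

Local Notation Int0 f x := (\int[mu]_(t in `[0%R, x]) (`|f t|)%:E)%E.

Lemma measurable_abs f E : measurable_fun D01 f -> E `<=` D01 ->
  measurable_fun E (fun t => (`|f t|)%:E).
Proof.
move=> mf sA; apply/measurable_EFinP; apply: measurableT_comp => //.
exact: (measurable_funS (measurable_itv _) sA).
Qed.

Lemma itv_oc_D01 x : x <= 1 -> `]0%R, x]%classic `<=` D01.
Proof.
move=> x1 t /=; rewrite !in_itv/= => /andP[t0 tx].
by rewrite (ltW t0) (le_trans tx).
Qed.

Lemma itv_cc_D01 x : x <= 1 -> `[0%R, x]%classic `<=` D01.
Proof.
move=> x1 t /=; rewrite !in_itv/= => /andP[t0 tx].
by rewrite t0 (le_trans tx).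
Qed.

Lemma int_oc f x : measurable_fun D01 f -> x <= 1 ->
  Int0 f x = (\int[mu]_(t in `]0%R, x]) (`|f t|)%:E)%E.
Proof.
move=> mf x1; rewrite -integral_itv_obnd_cbnd//.
by apply: measurable_abs => //; exact: itv_oc_D01.
Qed.

Lemma int_homo f x y : measurable_fun D01 f -> x <= y -> y <= 1 ->
  (Int0 f x <= Int0 f y)%E.
Proof.
move=> mf xy y1; apply: ge0_subset_integral => //.
- by apply: measurable_abs => //; exact: itv_cc_D01.
- by apply: subset_itv; rewrite ?lexx// bnd_simp.
Qed.

Lemma int_ge0 f x : (0 <= Int0 f x)%E.
Proof. by apply: integral_ge0 => t _; rewrite lee_fin. Qed.

Lemma int_fin f x : (Int0 f x < +oo)%E -> Int0 f x \is a fin_num.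
Proof. by move=> h; rewrite ge0_fin_numE ?int_ge0. Qed.

Lemma CabsE f x : (Int0 f x < +oo)%E -> Cabs f x = x^-1 * fine (Int0 f x).
Proof. by move=> h; rewrite /Cabs fineM// int_fin. Qed.

Lemma Cabs_ge0 f x : 0 < x -> 0 <= Cabs f x.
Proof.
move=> x0; apply: fine_ge0; apply: mule_ge0; last exact: int_ge0.
by rewrite lee_fin invr_ge0 ltW.
Qed.

Lemma measurable_Cabs f : measurable_fun D01 f ->
  (forall x, 0 < x < 1 -> (Int0 f x < +oo)%E) -> measurable_fun D01 (Cabs f).
Proof.
move=> mf fin; apply: measurable_D01.
apply: (@eq_measurable_fun _ _ _ _ _ (fun x => x^-1 * fine (Int0 f x))).
  by move=> x; rewrite inE/= in_itv/= => x01; rewrite CabsE// fin.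
apply: measurable_funM.
  apply: antitone_on_itv_measurable; first exact: interval_is_interval.
  move=> x y /=; rewrite !in_itv/= => /andP[x0 _] /andP[y0 _] xy.
  by rewrite lef_pV2.
apply: monotone_on_itv_measurable; first exact: interval_is_interval.
move=> x y /=; rewrite !in_itv/= => x01 y01 xy.
rewrite fine_le ?int_fin ?fin//; apply: int_homo => //.
by have /andP[_ /ltW] := y01.
Qed.

(** On the left half the constant 4 suffices. On the right half [x^-1 <= 2], the interval [(0, 1/2]]
    contributes [2 * M / phi 2^-1] and the rest [4 * M / phi (1 - x)], which gives
    [12 = 2 * (2 + 4)]. *)
Lemma Cabs_le g (M : R) x : measurable_fun D01 g -> 0 <= M ->
  (forall k, (block_int D lev (fun x => g x * wt x)%R k <= M%:E)%E) ->
  0 < x < 1 -> (Int0 g x < +oo)%E /\ Cabs g x <= 12 * M / phi (dist01 x).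
Proof.
move=> mg M0 hM x01; have /andP[x0 x1] := x01.
have mgD := measurable_D01_D mg.
suff [c [hc hcx]] : exists c : R, (Int0 g x <= c%:E)%E /\
    x^-1 * c <= 12 * M / phi (dist01 x).
  have fin : (Int0 g x < +oo)%E by apply: le_lt_trans hc (ltry _).
  split=> //; rewrite CabsE//; apply: le_trans hcx.
  rewrite ler_pM2l ?invr_gt0// -lee_fin fineK// int_fin//.
rewrite int_oc//; last exact: ltW.
have [xh|hx] := lerP x 2^-1.
  have Lx : leftD x by rewrite /= in_itv/= x0 xh.
  exists (4 * M / wt x); split; first exact: left_int_le.
  have px : 0 < phi x by rewrite phi_gt0// x0 ltW.
  have -> : dist01 x = x by rewrite /dist01; apply/min_idPl; lra.
  rewrite wt_left//.
  have -> : x^-1 * (4 * M / (phi x / x)) = 4 * (M / phi x).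
    by field; rewrite !gt_eqF.
  rewrite -[12 * M / _]mulrA; have : 0 <= M / phi x by rewrite divr_ge0// ltW.
  lra.
have Rx : rightD x by rewrite /= in_itv/= hx x1.
have Lh : leftD 2^-1 by rewrite /= in_itv/= invr_gt0 lexx ltr0n.
have px : 0 < phi (1 - x) by apply: phi_gt0; apply/andP; split; lra.
have ph := phi_half_gt0.
have le : phi (1 - x) <= phi 2^-1 by apply: phi_homo; lra.
exists (4 * M / wt 2^-1 + 4 * M / wt x); split.
  have -> : `]0%R, x]%classic = `]0%R, 2^-1%R]%classic `|` `]2^-1%R, x]%classic.
    apply/seteqP; split=> t /=; rewrite !in_itv/=.
      by move=> /andP[t0 tx]; case: (lerP t 2^-1) => h; [left|right]; rewrite ?t0.
    by case=> /andP[t0 tx]; apply/andP; split; lra.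
  rewrite ge0_integral_setU//; last 2 first.
  - apply: measurable_abs => // t /= [|]; rewrite !in_itv/= => /andP[t0 tx];
      by apply/andP; split; lra.
  - by apply/disj_setPS => t [] /=; rewrite !in_itv/= => /andP[_ h1] /andP[h2 _]; lra.
  rewrite EFinD leeD//; first exact: left_int_le.
  exact: right_int_le.
have -> : dist01 x = 1 - x by rewrite /dist01; apply/min_idPr; lra.
rewrite wt_left// wt_right// invf_div.
have h1 : 4 * M * (2^-1 / phi 2^-1) <= 2 * M / phi (1 - x).
  have -> : 4 * M * (2^-1 / phi 2^-1) = 2 * M / phi 2^-1.
    by field; rewrite gt_eqF.
  by apply: ler_wpM2l; [exact: mulr_ge0 | rewrite lef_pV2 ?posrE].
have h2 : x^-1 <= 2 by rewrite -[leRHS]invrK lef_pV2 ?posrE// ?invr_gt0// ltW.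
have m0 : 0 <= M / phi (1 - x) by rewrite divr_ge0// ltW.
apply: (@le_trans _ _ (2 * (6 * (M / phi (1 - x))))); last lra.
apply: ler_pM => //.
- by rewrite invr_ge0 ltW.
- by rewrite addr_ge0// ?mulr_ge0// ?invr_ge0 ?divr_ge0// ltW.
- lra.
Qed.

Lemma weighted_int_le f G (c : R) x : measurable_fun D01 f -> measurable G ->
  G `<=` D -> G `<=` `[0%R, x]%classic -> x <= 1 -> 0 <= c ->
  (forall t, G t -> wt t <= c) -> (Int0 f x < +oo)%E ->
  (\int[mu]_(t in G) (`|f t * wt t|)%:E <= (c * fine (Int0 f x))%:E)%E.
Proof.
move=> mf mG sG sGx x1 c0 hc fin.
have sG1 : G `<=` D01 by apply: subset_trans sG D_D01.
apply: (@le_trans _ _ (\int[mu]_(t in G) (c%:E * (`|f t|)%:E))%E).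
  apply: ge0_le_integral_any => t; first by rewrite lee_fin.
  move=> Gt; rewrite -EFinM lee_fin normrM mulrC (gtr0_norm (wt_gt0 t)).
  by apply: ler_wpM2r => //; exact: hc.
rewrite ge0_integralZl//; last exact: measurable_abs.
rewrite EFinM (fineK (int_fin fin)); apply: lee_wpmul2l; first by rewrite lee_fin.
apply: ge0_subset_integral => //.
by apply: measurable_abs => //; exact: itv_cc_D01.
Qed.

(** Let [tau] be the supremum of the piece. The weight there is at most [4 * phi tau / tau]: it
    varies by a factor 2 on a level, and some point of the piece lies above [tau / 2]. On
    [[tau, 2 * tau)] the average is at least [J / (2 * tau)], with [J] the integral of [|f|] up to
    [tau], whence the factor 8. The set [A] localises the estimate: the test interval lies in
    [[0, del)], which lets order continuity reach the high levels. *)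
Lemma left_block_le f k (A : set R) (del : R) : measurable_fun D01 f ->
  (forall x, 0 < x < 1 -> (Int0 f x < +oo)%E) -> measurable A ->
  (forall x, 0 <= x < del -> A x) -> del <= 1 ->
  (forall x, leftD x -> lev x = k -> x <= del / 2) ->
  (\int[mu]_(t in leftD `&` block D lev k) (`|f t * wt t|)%:E <=
    8%:E * mnorm phi (fun x => Cabs f x * \1_A x)%R)%E.
Proof.
move=> mf fin mA sA del1 hdel; set E0 := leftD `&` block D lev k.
have mE0 : measurable E0 by apply: measurableI => //; exact: measurable_lev_block.
have [[x0 E0x0]|nE] := pselect (exists x, E0 x); last first.
  rewrite (_ : E0 = set0); last by apply/seteqP; split=> // x E0x; apply: nE; exists x.
  by rewrite integral_set0; apply: mule_ge0; [rewrite lee_fin | exact: mnorm_ge0].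
pose tau := sup E0.
have ubE : ubound E0 (2^-1) by move=> x [Lx _]; move: Lx; rewrite /= in_itv/= => /andP[].
have hsE : has_sup E0 by split; [exists x0 | exists 2^-1].
have leE x : E0 x -> x <= tau by move=> Ex; apply: sup_ubound => //; exists 2^-1.
have tau2 : tau <= 2^-1 by apply: sup_le_ub => //; exists x0.
have taud : tau <= del / 2.
  by apply: sup_le_ub; [exists x0 | move=> x [Lx [_ kx]]; exact: hdel].
have tau0 : 0 < tau.
  apply: lt_le_trans (leE _ E0x0); have [Lx _] := E0x0; move: Lx.
  by rewrite /= in_itv/= => /andP[].
have tauh : 0 < tau / 2 by rewrite divr_gt0.
have [t E0t ht] := sup_adherent tauh hsE; rewrite -/tau in ht.
have pt : 0 < phi tau by apply: phi_gt0; apply/andP; split; lra.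
have hw x : E0 x -> wt x <= 4 * phi tau / tau.
  move=> [Lx [_ /= kx]]; have [Lt [_ /= kt]] := E0t.
  have /andP[_ h1] := lev_left Lx; have /andP[h2 _] := lev_left Lt.
  rewrite kx exprS in h1; rewrite kt in h2.
  have tt0 : 0 < t by move: Lt; rewrite /= in_itv/= => /andP[].
  have h3 : wt t <= 2 * phi tau / tau.
    rewrite wt_left// ler_pdivlMr// mulrAC ler_pdivrMr//.
    have pht : phi t <= phi tau by apply: phi_homo; rewrite ?(ltW tt0) ?leE//; lra.
    apply: (@le_trans _ _ (phi tau * tau)); first by apply: ler_wpM2r => //; exact: ltW.
    by rewrite -mulrA (mulrC 2) -mulrA ler_pM2l//; lra.
  rewrite -!mulrA in h1 h2 h3 *; lra.
have I0 : (Int0 f tau < +oo)%E by apply: fin; apply/andP; split; lra.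
pose J := fine (Int0 f tau).
have J0 : 0 <= J by apply: fine_ge0; exact: int_ge0.
have sE0 : E0 `<=` `[0%R, tau]%classic.
  move=> x Ex; have [Lx _] := Ex; move: Lx; rewrite /= !in_itv/= => /andP[x0' _].
  by rewrite (ltW x0') leE.
apply: (@le_trans _ _ (4 * phi tau / tau * J)%:E).
  apply: weighted_int_le => //.
  - by move=> x [/leftD_D].
  - lra.
  - by rewrite divr_ge0 ?mulr_ge0// ltW.
have -> : (4 * phi tau / tau * J)%:E = (8%:E * (phi tau * (J / (2 * tau)))%:E)%E.
  by rewrite -EFinM; congr EFin; field; rewrite gt_eqF.
apply: lee_wpmul2l; first by rewrite lee_fin.
have mCA : measurable_fun D01 (fun x => Cabs f x * \1_A x).
  by apply: measurable_funM; [exact: measurable_Cabs | exact: measurable_indic].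
apply: (@mnorm_ge _ `[tau, 2 * tau[%classic tau) => //.
- move=> x /=; rewrite !in_itv/= => /andP[h1 h2]; apply/andP; split; lra.
- rewrite lebesgue_measure_itv/= lte_fin ltr_pMl// ltr1n -EFinB; congr EFin; lra.
- by rewrite tau0; lra.
- by rewrite divr_ge0// mulr_ge0// ltW.
move=> x /=; rewrite in_itv/= => /andP[h1 h2].
have x0' : 0 < x by lra.
have x1 : x < 1 by lra.
rewrite indicE mem_set ?mulr1; last by apply: sA; apply/andP; split; lra.
rewrite ger0_norm ?Cabs_ge0// CabsE ?fin ?x0'// mulrC.
apply: ler_pM => //; first by rewrite invr_ge0 mulr_ge0// ltW.
  by rewrite lef_pV2 ?posrE ?mulr_gt0//; exact: ltW.
apply: fine_le; [exact: int_fin|by apply: int_fin; apply: fin; rewrite x0'|].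
by apply: int_homo => //; exact: ltW.
Qed.

(** The test interval is [[sg, 1)], with [sg] the supremum of the piece: there the average is at
    least the integral up to [sg], since [x < 1]. The weight is at most [4 * phi (1 - sg)]: one
    factor 2 inside the level, another from [phi_half] at a point within [2 * (1 - sg)] of 1. *)
Lemma right_block_le f k (A : set R) (del : R) : measurable_fun D01 f ->
  (forall x, 0 < x < 1 -> (Int0 f x < +oo)%E) -> measurable A ->
  (forall x, 1 - del <= x < 1 -> A x) ->
  (forall x, rightD x -> lev x = k -> 1 - del <= x) ->
  (\int[mu]_(t in rightD `&` block D lev k) (`|f t * wt t|)%:E <=
    4%:E * mnorm phi (fun x => Cabs f x * \1_A x)%R)%E.
Proof.
move=> mf fin mA sA hdel; set E0 := rightD `&` block D lev k.
have mE0 : measurable E0 by apply: measurableI => //; exact: measurable_lev_block.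
have [[x0 E0x0]|nE] := pselect (exists x, E0 x); last first.
  rewrite (_ : E0 = set0); last by apply/seteqP; split=> // x E0x; apply: nE; exists x.
  by rewrite integral_set0; apply: mule_ge0; [rewrite lee_fin | exact: mnorm_ge0].
have w0 := wt0_gt0.
have wk0 : 0 < wt0 / 2 ^+ k.+1 by rewrite divr_gt0// exprn_gt0.
(* The weight tends to 0 at 1 but stays above [wt0 / 2 ^+ k.+1] on level [k], so the piece keeps a
   distance from 1 and [sg < 1]. *)
have [d /andP[d0 d1] hd] := phi_small wk0.
have ubE : ubound E0 (1 - d).
  move=> x [Rx [_ /= kx]]; have /andP[h _] := lev_right Rx; rewrite kx in h.
  rewrite leNgt; apply/negP => dx; move: h; apply/negP; rewrite -leNgt wt_right//.
  apply: hd; move: Rx; rewrite /= in_itv/= => /andP[_ x1].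
  by apply/andP; split; lra.
pose sg := sup E0.
have hsE : has_sup E0 by split; [exists x0 | exists (1 - d)].
have leE x : E0 x -> x <= sg by move=> Ex; apply: sup_ubound => //; exists (1 - d).
have sgd : sg <= 1 - d by apply: sup_le_ub => //; exists x0.
have sgh : 2^-1 < sg.
  apply: lt_le_trans (leE _ E0x0); have [Lx _] := E0x0; move: Lx.
  by rewrite /= in_itv/= => /andP[].
pose tau := 1 - sg; have tauE : tau = 1 - sg by []; have tau0 : 0 < tau by rewrite /tau; lra.
have tau2 : tau < 2^-1 by rewrite /tau; lra.
have [t E0t ht] := sup_adherent tau0 hsE; rewrite -/sg in ht.
have pt : 0 < phi tau by apply: phi_gt0; apply/andP; split; lra.
have hw x : E0 x -> wt x <= 4 * phi tau.
  move=> [Rx [_ /= kx]]; have [Rt [_ /= kt]] := E0t.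
  have /andP[_ h1] := lev_right Rx; have /andP[h2 _] := lev_right Rt.
  rewrite kx in h1; rewrite kt exprS invfM in h2.
  have h3 : wt t <= 2 * phi tau.
    rewrite wt_right//; have := @phi_half (2 * tau).
    have -> : 2 * tau / 2 = tau by field.
    have h : 0 <= 2 * tau <= 1 by apply/andP; split; lra.
    move=> /(_ h); apply: le_trans; move: Rt; rewrite /= in_itv/= => /andP[_ tt].
    by apply: phi_homo; lra.
  lra.
have I0 : (Int0 f sg < +oo)%E by apply: fin; apply/andP; split; lra.
pose J := fine (Int0 f sg).
have J0 : 0 <= J by apply: fine_ge0; exact: int_ge0.
have sE0 : E0 `<=` `[0%R, sg]%classic.
  move=> x Ex; have [Lx _] := Ex; move: Lx; rewrite /= !in_itv/= => /andP[x0' _].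
  by rewrite leE// andbT; lra.
apply: (@le_trans _ _ (4 * phi tau * J)%:E).
  apply: weighted_int_le => //.
  - by move=> x [/rightD_D].
  - lra.
  - by rewrite mulr_ge0// ltW.
have -> : (4 * phi tau * J)%:E = (4%:E * (phi tau * J)%:E)%E.
  by rewrite -EFinM mulrA.
apply: lee_wpmul2l; first by rewrite lee_fin.
have mCA : measurable_fun D01 (fun x => Cabs f x * \1_A x).
  by apply: measurable_funM; [exact: measurable_Cabs | exact: measurable_indic].
have sg1 : sg < 1 by lra.
apply: (@mnorm_ge _ `[sg, 1%R[%classic tau) => //.
- move=> x /=; rewrite !in_itv/= => /andP[h1 h2]; apply/andP; split; lra.
- by rewrite lebesgue_measure_itv/= lte_fin sg1 -EFinB.
- by rewrite tau0; lra.
move=> x /=; rewrite in_itv/= => /andP[h1 h2].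
have x0' : 0 < x by lra.
rewrite indicE mem_set ?mulr1; last first.
  apply: sA; rewrite h2 andbT; apply: le_trans h1.
  apply: le_trans (leE _ E0x0); have [Rx [_ kx]] := E0x0; exact: hdel.
rewrite ger0_norm ?Cabs_ge0// CabsE ?fin ?x0'//.
apply: (@le_trans _ _ (fine (Int0 f x))).
  apply: fine_le; [exact: int_fin|by apply: int_fin; apply: fin; rewrite x0'|].
  by apply: int_homo => //; exact: ltW.
apply: ler_peMl; first by apply: fine_ge0; exact: int_ge0.
by rewrite invf_ge1// ltW.
Qed.

Lemma block_int_le f k (A : set R) (del : R) : measurable_fun D01 f ->
  (forall x, 0 < x < 1 -> (Int0 f x < +oo)%E) -> measurable A -> del <= 1 ->
  (forall x, 0 <= x < del -> A x) -> (forall x, 1 - del <= x < 1 -> A x) ->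
  (forall x, leftD x -> lev x = k -> x <= del / 2) ->
  (forall x, rightD x -> lev x = k -> 1 - del <= x) ->
  (block_int D lev (fun x => f x * wt x)%R k <=
    12%:E * mnorm phi (fun x => Cabs f x * \1_A x)%R)%E.
Proof.
move=> mf fin mA del1 sA1 sA2 h1 h2.
have mfw : measurable_fun D (fun x => f x * wt x).
  by apply: measurable_funM; [exact: measurable_D01_D | exact: measurable_wt].
have mL : measurable (leftD `&` block D lev k).
  by apply: measurableI => //; exact: measurable_lev_block.
have mR : measurable (rightD `&` block D lev k).
  by apply: measurableI => //; exact: measurable_lev_block.
have BE : block D lev k = (leftD `&` block D lev k) `|` (rightD `&` block D lev k).
  rewrite -setIUl -D_split; apply/esym/setIidPr => x [] //.
rewrite /block_int BE ge0_integral_setU//; last 2 first.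
- by rewrite -BE; apply: measurable_abs_block => //; exact: measurable_lev_block.
- apply/disj_setPS => t [[] /=]; rewrite !in_itv/= => /andP[_ h3] _ [/andP[h4 _] _].
  by lra.
have -> : 12%:E = (8%:E + 4%:E)%E :> \bar R by rewrite -EFinD; congr EFin; lra.
rewrite ge0_muleDl ?lee_fin//; apply: leeD.
  exact: left_block_le sA1 del1 h1.
exact: right_block_le sA2 h2.
Qed.

(** By monotonicity of the weight on each half, [wt_ratio] is bounded at the points of the left half
    beyond [d / 2] and of the right half below [1 - d], so their levels are bounded. *)
Lemma lev_large (d : R) : 0 < d <= 1 -> exists K, forall k, (K <= k)%N ->
  (forall x, leftD x -> lev x = k -> x <= d / 2) /\
  (forall x, rightD x -> lev x = k -> 1 - d <= x).
Proof.
move=> /andP[d0 d1]; have w0 := wt0_gt0.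
have d2 : leftD (d / 2) by rewrite /= in_itv/=; apply/andP; split; lra.
have w2 := wt_gt0 (d / 2).
have pd : 0 < phi d by rewrite phi_gt0// d0.
have m0 : 0 < Num.min (wt0 / (2 * wt (d / 2))) (phi d / (2 * wt0)).
  by rewrite lt_min; apply/andP; split; apply: divr_gt0 => //; exact: mulr_gt0.
have [K _] := small_half_power 0 m0.
rewrite le_min => /andP[hK1 hK2]; exists K => k Kk.
have pK : 0 < 2 ^+ K :> R by rewrite exprn_gt0.
have pk : 0 < 2 ^+ k :> R by rewrite exprn_gt0.
have Kkle : 2 ^+ K <= 2 ^+ k :> R by rewrite ler_weXn2l ?ler1n.
split=> x hx kx; rewrite leNgt; apply/negP => lt.
  have /andP[h1 _] := lev_left hx; rewrite kx in h1.
  have h2 := wt_left_homo d2 hx (ltW lt).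
  move: hK1; rewrite ler_pdivlMr ?mulr_gt0// mulrC ler_pdivrMr// => hK1.
  have := ler_wpM2l (ltW w0) Kkle; lra.
have /andP[_ h1] := lev_right hx; rewrite kx wt_right// in h1.
have h2 : phi d <= phi (1 - x).
  by move: hx; rewrite /= in_itv/= => /andP[x0 x1]; apply: phi_homo; lra.
move: {hK1 m0} wt0 w0 hK2 h1 => w w0.
rewrite ler_pdivlMr ?mulr_gt0// mulrC ler_pdivrMr// ler_pdivlMr// => hK2 h1.
have := ler_wpM2l (ltW pd) Kkle; have := ler_wpM2r (ltW pk) h2; lra.
Qed.

(** * The isomorphism onto the c_0-sum *)

Definition ends (d : R) : set R := `[0%R, d]%classic `|` `[1 - d, 1%R]%classic.

Lemma ends_sub (d : R) : 0 < d <= 1 -> ends d `<=` D01.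
Proof.
move=> /andP[d0 d1] x /= []; rewrite /= !in_itv/= => /andP[h1 h2];
  by apply/andP; split; lra.
Qed.

Lemma ends_homo (d d' : R) : d <= d' -> ends d `<=` ends d'.
Proof.
move=> dd x []; rewrite /= in_itv/= => /andP[h1 h2]; [left|right];
  by rewrite /= in_itv/=; apply/andP; split; lra.
Qed.

Lemma ends_cap (u : nat -> R) : (forall n, 0 < u n <= 1) ->
  (forall e, 0 < e -> exists n, u n < e) ->
  \bigcap_n ends (u n) `<=` [set (0 : R)] `|` [set (1 : R)].
Proof.
move=> u01 small x h; have := ends_sub (u01 0%N) (h 0%N I).
rewrite /= in_itv/= => /andP[x0 x1].
apply: contrapT => /not_orP[/eqP xn0 /eqP xn1].
have x0' : 0 < x by rewrite lt_neqAle eq_sym xn0.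
have x1' : x < 1 by rewrite lt_neqAle xn1.
have m0 : 0 < Num.min x (1 - x) by rewrite lt_min x0' subr_gt0.
have [n] := small _ m0; rewrite lt_min => /andP[hn1 hn2].
by case: (h n I) => /=; rewrite in_itv/= => /andP[h1 h2]; lra.
Qed.

(** The norm bound is [block_int_le] with [A] everything. For the decay, order continuity is applied
    to neighbourhoods of the two ends that shrink to a null set, and [lev_large] puts the high
    levels inside them. *)
Lemma CesM0_c0L1 f : CesM0 phi f ->
  c0L1 D lev (fun x => f x * wt x) /\
  (c0L1_norm D lev (fun x => f x * wt x)%R <= 12%:E * cnorm phi f)%E.
Proof.
move=> [mf [fin [[_ nfin] oc]]].
have mfw : measurable_fun D (fun x => f x * wt x).
  by apply: measurable_funM; [exact: measurable_D01_D | exact: measurable_wt].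
have le k : (block_int D lev (fun x => f x * wt x)%R k <= 12%:E * cnorm phi f)%E.
  have hL x : leftD x -> lev x = k -> x <= 1 / 2.
    by rewrite /= in_itv/= => /andP[_ x1] _; lra.
  have hR x : rightD x -> lev x = k -> 1 - 1 <= x.
    by rewrite /= in_itv/= => /andP[x0 _] _; lra.
  have := @block_int_le f k setT 1 mf fin measurableT (lexx 1)
    (fun _ _ => I) (fun _ _ => I) hL hR.
  have -> // : (fun x => Cabs f x * \1_setT x) = Cabs f.
  by apply/funext => x; rewrite indicT mulr1.
split; last exact: c0L1_norm_le.
split=> //.
  move=> k; apply: le_lt_trans (le k) _.
  by rewrite lte_mul_pinfty// /cnorm.
move=> e e0.
pose A (n : nat) := ends n.+1%:R^-1.
have n0 n : 0 < n.+1%:R^-1 :> R by rewrite invr_gt0.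
have n1 n : n.+1%:R^-1 <= 1 :> R by rewrite invf_le1// ler1n.
have mA n : measurable (A n) by apply: measurableU.
have small d : 0 < d -> exists n : nat, n.+1%:R^-1 < d.
  move=> d0; exists (Num.truncn d^-1).
  rewrite invf_plt ?posrE//; have id0 : 0 <= d^-1 by rewrite invr_ge0 ltW.
  by have /andP[] := truncn_itv id0.
have sAD n : A n `<=` D01 by apply: ends_sub; rewrite n0 n1.
have decA n : A n.+1 `<=` A n.
  by apply: ends_homo; rewrite lef_pV2 ?posrE// ler_nat.
have capA : \bigcap_n A n `<=` [set (0 : R)] `|` [set (1 : R)].
  by apply: ends_cap => // n; rewrite n0 n1.
have mcapA : measurable (\bigcap_n A n) by apply: bigcapT_measurable.
have nullA : mu (\bigcap_n A n) = 0%E.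
  apply/eqP; rewrite eq_le measure_ge0 andbT.
  apply: le_trans (le_lebesgue_measure mcapA _ capA) _; first exact: measurableU.
  apply: le_trans (lebesgue_measureU _ _) _ => //.
  by rewrite !lebesgue_measure_set1 adde0.
have e12 : 0 < e / 12 by rewrite divr_gt0.
have := oc A (fun n => conj (mA n) (@sAD n)) decA nullA.
move=> /(ereal_cvg0P (fun n => mnorm_ge0 _))/(_ _ e12)[N /(_ N (leqnn _)) hN].
have [K hK] : exists K, forall k, (K <= k)%N ->
    (forall x, leftD x -> lev x = k -> x <= N.+1%:R^-1 / 2) /\
    (forall x, rightD x -> lev x = k -> 1 - N.+1%:R^-1 <= x).
  by apply: lev_large; rewrite n0 n1.
exists K => k Kk; have [h1 h2] := hK k Kk.
apply: le_trans (block_int_le mf fin (mA N) (n1 N) _ _ h1 h2) _.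
- by move=> x /andP[x0 x1]; left; rewrite /= in_itv/= x0 ltW.
- by move=> x /andP[x0 x1]; right; rewrite /= in_itv/= x0 ltW.
apply: (@le_trans _ _ (12%:E * (e / 12)%:E)%E).
  by apply: lee_wpmul2l => //; rewrite lee_fin.
by rewrite -EFinM lee_fin mulrCA divff ?mulr1.
Qed.

(** The weight is bounded below on finitely many levels: by [wt0] on the left half and by
    [wt0 / 2 ^+ K] on the right half. *)
Lemma low_int_fin f K : c0L1 D lev (fun x => f x * wt x) ->
  measurable_fun D f -> (\int[mu]_(t in low D lev K) (`|f t|)%:E < +oo)%E.
Proof.
move=> cF mf; have fin := c0L1_norm_fin cF; have w0 := wt0_gt0.
have w2 : 0 < 2 / wt0 by rewrite divr_gt0.
pose al k : R := (if (k <= K)%N then 2 ^+ k else 0) * (2 / wt0).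
apply: le_lt_trans (ltry (2 * 2 ^+ K * (2 / wt0) *
  fine (c0L1_norm D lev (fun x => f x * wt x)))).
apply: (@block_weighted_int f _ al) => //.
- by apply: mlow => //; exact: measurable_lev_block.
- by move=> x [].
- by apply: fine_ge0; exact: c0L1_norm_ge0.
- by move=> k; rewrite mulr_ge0 ?(ltW w2)//; case: ifP => // _; rewrite exprn_ge0.
- move=> x [Dx /= /ltnW lx]; have wx := wt_gt0 x.
  rewrite /al lx normrM (gtr0_norm wx) mulrCA ler_peMr//.
  have p0 : 0 < 2 ^+ lev x :> R by rewrite exprn_gt0.
  have h : wt0 <= 2 ^+ lev x * 2 * wt x.
    have p1 : 1 <= 2 ^+ lev x :> R by rewrite exprn_ege1// ler1n.
    move: Dx; rewrite D_split => -[Lx|Rx].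
      have /andP[h _] := lev_left Lx.
      have h1 : wt0 <= wt x by apply: le_trans h; rewrite ler_peMr// ltW.
      apply: le_trans h1 _; rewrite ler_peMl// ?(ltW wx)//; lra.
    have /andP[h _] := lev_right Rx.
    by move: h; rewrite exprS ltr_pdivrMr ?mulr_gt0//; lra.
  by rewrite mulrA mulrAC ler_pdivlMr// mul1r.
- move=> k; rewrite fineK//; exact: block_int_le_norm.
- by move=> m; rewrite -mulr_suml ler_pM2r//; exact: sum_powers_head.
Qed.

(** Split [f] at level [K]. The tail has norm at most [e], so [Cabs_le] bounds its average. The
    remaining part is integrable and vanishes on an interval [(0, x0]], because levels near 0 are
    high; its average is at most its integral divided by [x0]. *)
Lemma Cabs_decomp f (e : R) : measurable_fun D01 f ->
  c0L1 D lev (fun x => f x * wt x) -> 0 < e ->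
  (forall x, 0 < x < 1 -> (Int0 f x < +oo)%E) ->
  exists2 M, 0 <= M & forall x, 0 < x < 1 ->
    Cabs f x <= M + 12 * e / phi (dist01 x).
Proof.
move=> mf cF e0 fin; have mfD := measurable_D01_D mf.
have mD : measurable D by exact: measurable_itv.
have [K hK] : exists K, forall M, (K <= M)%N ->
    fine (c0L1_norm D lev (fun t => f t * wt t * \1_(~` low D lev M) t)) <= e.
  by apply: tail_cut_small => //; exact: measurable_lev_block.
have mlowK : measurable (low D lev K) by apply: mlow => //; exact: measurable_lev_block.
pose g x := f x * \1_(~` low D lev K) x.
have mg : measurable_fun D01 g.
  by apply: measurable_funM => //; apply: measurable_indic; exact: measurableC.
have gE : (fun x => g x * wt x) = (fun x => f x * wt x * \1_(~` low D lev K) x).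
  by apply/funext => x; rewrite /g mulrAC.
have hg k : (block_int D lev (fun x => g x * wt x)%R k <= e%:E)%E.
  rewrite gE; apply: le_trans (block_int_le_norm _ _ _ _) _.
  rewrite -[X in (X <= _)%E]fineK; first by rewrite lee_fin hK.
  by apply: c0L1_norm_fin; apply: c0L1_cut => //; exact: measurableC.
have IKfin := low_int_fin K cF mfD.
pose IK := fine (\int[mu]_(t in low D lev K) (`|f t|)%:E)%E.
have IK0 : 0 <= IK by apply: fine_ge0; apply: integral_ge0 => t _; rewrite lee_fin.
have [x0 /andP[x00 x0h] hx0] := phi_div_unbounded (wt0 * 2 ^+ K).
have emp y : 0 < y <= x0 -> ~ low D lev K y.
  move=> /andP[y0 yx] [_ /= ly].
  have Ly : leftD y by rewrite /= in_itv/= y0 (le_trans yx).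
  have Lx : leftD x0 by rewrite /= in_itv/= x00.
  have h1 := wt_left_homo Ly Lx yx; rewrite [wt x0]wt_left// in h1.
  have /andP[_ h2] := lev_left Ly.
  have h3 : 2 ^+ (lev y).+1 <= 2 ^+ K :> R by rewrite ler_weXn2l ?ler1n.
  have := ler_wpM2l (ltW wt0_gt0) h3; lra.
exists (IK / x0); first by rewrite divr_ge0// ltW.
move=> x x01; have /andP[xp x1] := x01.
have [gfin hC] := Cabs_le mg (ltW e0) hg x01.
apply: (@le_trans _ _ (IK / x0 + Cabs g x)); last by rewrite lerD2l.
have sx := itv_oc_D01 (ltW x1).
have mI1 : measurable (`]0%R, x]%classic `&` low D lev K) by apply: measurableI.
have mI2 : measurable (`]0%R, x]%classic `\` low D lev K) by apply: measurableD.
have split_le : (Int0 f x <= \int[mu]_(t in `]0%R, x]%classic `&` low D lev K) (`|f t|)%:E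
    + Int0 g x)%E.
  rewrite int_oc//; last exact: ltW.
  rewrite -{1}(setUIDK `]0%R, x]%classic (low D lev K)) ge0_integral_setU//; last 2 first.
  - by rewrite setUIDK; exact: measurable_abs.
  - by apply/disj_setPS => t [[_ h1] [_ /= /(_ h1)]].
  apply: leeD => //; rewrite int_oc//; last exact: ltW.
  apply: (@le_trans _ _ (\int[mu]_(t in `]0%R, x]%classic `\` low D lev K) (`|g t|)%:E)%E).
    apply: ge0_le_integral_any => t; first by rewrite lee_fin.
    by move=> [_ nl]; rewrite /g indicE mem_set// mulr1.
  by apply: ge0_subset_integral => //; exact: measurable_abs.
have ffin := fin x x01; have xV : 0 < x^-1 by rewrite invr_gt0.
rewrite !CabsE//.
have [xx0|x0x] := lerP x x0.
  apply: ler_wpDl; first by rewrite divr_ge0// ltW.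
  rewrite ler_pM2l//; apply: fine_le; [exact: int_fin..|].
  apply: le_trans split_le _; rewrite (_ : _ `&` _ = set0) ?integral_set0 ?add0e//.
  apply/seteqP; split=> // t [] /=; rewrite in_itv/= => /andP[t0 tx].
  by apply: emp; rewrite t0 (le_trans tx).
have h : fine (Int0 f x) <= IK + fine (Int0 g x).
  rewrite -lee_fin EFinD !fineK ?int_fin//; last first.
    by rewrite ge0_fin_numE// integral_ge0// => t _; rewrite lee_fin.
  apply: le_trans split_le _; apply: leeD => //.
  apply: ge0_subset_integral => //.
  by apply: measurable_abs => // t [/D_D01].
apply: (@le_trans _ _ (x^-1 * (IK + fine (Int0 g x)))); first by rewrite ler_pM2l.
rewrite mulrDr lerD2r mulrC; apply: ler_wpM2l => //.
by rewrite lef_pV2 ?posrE// ltW.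
Qed.

(** Both claims are instances of [mnorm_le]. For the norm, [A] is empty and the constant is
    [48 = 4 * 12]. For order continuity, [Cabs_decomp] leaves a bounded part, whose norm on a set of
    small measure is small since [phi] tends to 0, and a multiple of [1 / phi] that is as small as
    desired. *)
Lemma c0L1_CesM0 f C : 0 < C ->
  (forall t, 0 < t <= 1 ->
    (\int[mu]_(s in `[0%R, t]) ((phi s)^-1)%:E <= (C * (t / phi t))%:E)%E) ->
  c0L1 D lev (fun x => f x * wt x) ->
  CesM0 phi f /\
  (cnorm phi f <= (48 * C)%:E * c0L1_norm D lev (fun x => f x * wt x)%R)%E.
Proof.
move=> C0 hC cF; have [mF _ _] := cF.
have mfD : measurable_fun D f.
  apply: (@eq_measurable_fun _ _ _ _ _ (fun x => f x * wt x * (wt x)^-1)).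
    by move=> x _; rewrite mulfK// gt_eqF// wt_gt0.
  apply: measurable_funM => //; apply: measurable_D;
    apply: monotone_on_itv_measurable; try exact: interval_is_interval.
  - move=> x y Lx Ly xy; rewrite lef_pV2 ?posrE ?wt_gt0//; exact: wt_left_homo.
  - move=> x y Lx Ly xy; rewrite lef_pV2 ?posrE ?wt_gt0//; exact: wt_right_homo.
have mf := measurable_D01 mfD.
have nfin := c0L1_norm_fin cF.
pose M := fine (c0L1_norm D lev (fun x => f x * wt x)).
have M0 : 0 <= M by apply: fine_ge0; exact: c0L1_norm_ge0.
have hM k : (block_int D lev (fun x => f x * wt x)%R k <= M%:E)%E.
  by rewrite fineK//; exact: block_int_le_norm.
have fin x : 0 < x < 1 -> (Int0 f x < +oo)%E by move=> /(Cabs_le mf M0 hM)[].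
have mC := measurable_Cabs mf fin.
have h2 : 0 < 2^-1 :> R by rewrite invr_gt0.
have le : (cnorm phi f <= (48 * C)%:E * c0L1_norm D lev (fun x => f x * wt x)%R)%E.
  rewrite -(fineK nfin) -EFinM -/M.
  have -> : 48 * C * M = C * (0 * phi (2 * 2^-1) + 4 * (12 * M)) by lra.
  apply: (mnorm_le C0 hC mC measurable0) => //.
  - by rewrite measure0 lee_fin ltW.
  - by rewrite divff.
  - by rewrite mulr_ge0.
  - move=> x x01; rewrite mul0r add0r; have /andP[x0 _] := x01.
    by rewrite ger0_norm ?Cabs_ge0//; have [] := Cabs_le mf M0 hM x01.
split=> //; split=> //; split=> //; split.
  by split=> //; apply: le_lt_trans le _; rewrite -(fineK nfin) -EFinM ltry.
move=> A hA dA muA; apply/ereal_cvg0P => [n|e e0]; first exact: mnorm_ge0.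
(* The part bounded by a multiple of [1 / phi] contributes [48 * C] times this, that is [e / 2]; the
   choice of [d] keeps the bounded part within the other half. *)
have e1 : 0 < e / (96 * C) by rewrite divr_gt0// mulr_gt0.
have [M1 M10 hM1] := Cabs_decomp mf cF e1 fin.
have e2 : 0 < e / (2 * C * (M1 + 1)).
  by rewrite divr_gt0// !mulr_gt0// ltr_wpDl.
have [d /andP[d0 d1] hd] := phi_small e2.
have mA n : measurable (A n) by have [] := hA n.
have sA n : A n `<=` D01 by have [] := hA n.
have muA0 : mu (A n) @[n --> \oo] --> 0%E.
  rewrite -muA; apply: nonincreasing_cvg_mu => //.
  - apply: le_lt_trans (le_lebesgue_measure (mA 0%N) _ (@sA 0%N)) _ => //.
    by rewrite lebesgue_measure_itv/= lte_fin ltr01 -EFinB ltry.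
  - by apply: bigcapT_measurable => n; exact: mA.
  - by apply/nonincreasing_seqP => n; apply/subsetPset; exact: dA.
have d20 : 0 < d / 2 by rewrite divr_gt0.
have [N hN] := (ereal_cvg0P (fun n => measure_ge0 _ _)).1 muA0 _ d20.
exists N => n Nn.
apply: (@le_trans _ _ (C * (M1 * phi (2 * (d / 2)) + 4 * (12 * (e / (96 * C)))))%:E).
  apply: (mnorm_le C0 hC _ (mA n) (hN n Nn)) => //.
  - by apply: measurable_funM => //; exact: measurable_indic.
  - lra.
  - by rewrite mulr_ge0// ltW.
  - move=> x x01; have /andP[x0 x1] := x01; rewrite normrM ger0_norm ?Cabs_ge0//.
    have dx : 0 < dist01 x <= 1.
      by rewrite /dist01 lt_min ge_min x0 (ltW x1) subr_gt0 x1.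
    have r0 : 0 <= 12 * (e / (96 * C)) / phi (dist01 x).
      apply: divr_ge0; first by apply: mulr_ge0 => //; exact: ltW.
      by apply: ltW; exact: phi_gt0.
    rewrite indicE; case: (x \in A n); last by rewrite normr0 !mulr0 add0r.
    by rewrite normr1 !mulr1; exact: hM1.
have -> : 2 * (d / 2) = d by field.
have hphi : phi d <= e / (2 * C * (M1 + 1)) by apply: hd; rewrite d0 lexx.
rewrite lee_fin mulrDr.
have -> : C * (4 * (12 * (e / (96 * C)))) = e / 2 by field; rewrite gt_eqF.
have M11 : 0 < M1 + 1 by rewrite ltr_wpDl.
have : C * (M1 * phi d) <= e / 2.
  apply: (@le_trans _ _ (C * ((M1 + 1) * (e / (2 * C * (M1 + 1)))))).
    rewrite ler_pM2l//; apply: ler_pM => //; last lra.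
    by rewrite ltW// phi_gt0// d0.
  rewrite le_eqVlt; apply/orP; left; apply/eqP.
  by field; rewrite !gt_eqF.
lra.
Qed.

Lemma CesM0_DunfordPettis : DunfordPettis (CesM0 phi) (cnorm phi).
Proof.
have [C C0 hC] := integral_inv_phi.
have mD : measurable D by exact: measurable_itv.
have mB := measurable_lev_block.
have muD : (mu D < +oo)%E.
  by rewrite lebesgue_measure_itv/= lte_fin ltr01 -EFinB ltry.
have N2ge f : (0 <= c0L1_norm D lev f)%E by exact: c0L1_norm_ge0.
pose K := 48 * C + 12.
have K0 : 0 < K by rewrite /K; lra.
have scale (a b : R) (z : \bar R) : a <= b -> (0 <= z)%E -> (a%:E * z <= b%:E * z)%E.
  by move=> ab z0; apply: lee_wpmul2r => //; rewrite lee_fin.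
apply: (@DunfordPettis_transfer R _ (c0L1 D lev) _ (c0L1_norm D lev) wt K K0).
- by move=> x; rewrite gt_eqF// wt_gt0.
- by move=> f; split=> [/CesM0_c0L1[]//|/(c0L1_CesM0 C0 hC)[]].
- by move=> a f; exact: c0L1Z.
- by move=> a f [mf _ _]; exact: c0L1_normZ.
- exact: c0L1_0.
- exact: c0L1_norm0.
- by move=> f; exact: mnorm_ge0.
- move=> f /CesM0_c0L1[cF _]; have [_ h] := c0L1_CesM0 C0 hC cF.
  by apply: le_trans h _; apply: scale => //; rewrite /K; lra.
- move=> f /CesM0_c0L1[_ h]; apply: le_trans h _; apply: scale.
    by rewrite /K; lra.
  exact: mnorm_ge0.
- exact: N2ge.
- exact: c0L1_DunfordPettis.
Qed.

End ConcaveWeight.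

Theorem theorem11 (R : realType) (phi : R -> R) :
  phi 0 = 0 ->
  (forall t, 0 < t <= 1 -> 0 < phi t) ->
  (forall x y, 0 <= x -> x <= y -> y <= 1 -> phi x <= phi y) ->
  (forall x y a, 0 <= x <= 1 -> 0 <= y <= 1 -> 0 <= a <= 1 ->
     (1 - a) * phi x + a * phi y <= phi ((1 - a) * x + a * y)) ->
  phi t @[t --> 0^'+] --> 0 ->
  q0 phi < 1 ->
  DunfordPettis (CesM0 phi) (cnorm phi).
Proof.
move=> phi0 phi_gt0 phi_homo phi_concave phi_lim q0_lt1.
exact: CesM0_DunfordPettis.
Qed.
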